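(* Let $n\ge 1$ and let $\xi(x)$, $x\in\mathbb{R}^n$, be a real-valued measurable mean-square continuous homogeneous isotropic Gaussian random field with zero mean, whose isotropic spectral density $\varphi$ has the form $$\varphi(|\lambda|)=\frac{h(|\lambda|)}{|\lambda|^{n-\alpha_0}}\prod_{i=1}^{k-1}\frac{1}{\bigl||\lambda|-a_i\bigr|^{1-\alpha_i}},\qquad \lambda\in\mathbb{R}^n,$$ where $k\in\mathbb{N}$, $0=a_0<a_1<\dots<a_{k-1}$, $0<\alpha_0<n$, $0<\alpha_i<1$ for $i=1,\dots,k-1$, the function $\lambda\mapsto\varphi(|\lambda|)$ belongs to $L_1(\mathbb{R}^n)$, and $h\ge 0$ is a bounded function on $[0,+\infty)$ which is continuous in some neighbourhood of each $a_i$ and satisfies $h(a_i)\neq 0$, $i=0,\dots,k-1$. Let $j\in\{1,\dots,k-1\}$ and let $f_{a_j,r}:\mathbb{R}^n\to\mathbb{R}$, $r>0$, be a family of admissible weight functions at $a_j$ (as defined in the context) with associated function $g_{a_j}$. Put $$V_{a_j}=a_j^{1-\alpha_0}\prod_{\substack{i=1\\ i\ne j}}^{k-1}|a_j-a_i|^{1-\alpha_i}.$$ Then, as $r\to\infty$, the finite-dimensional distributions of the process $$X_{r,a_j}(t)=\begin{cases}\displaystyle\frac{\sqrt{V_{a_j}}}{\sqrt{2\,h(a_j)}\;r^{\,n-\alpha_j/2}}\int_{\mathbb{R}^n}f_{a_j,rt}(x)\,\xi(x)\,dx, & t\in(0,1],\\[2mm] 0,& t=0,\end{cases}$$ converge weakly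 to the finite-dimensional distributions of the process $$X_{a_j}(t)=\begin{cases}\displaystyle t^n\int_{\mathbb{R}^n}\frac{g_{a_j}(|u|t)}{|u|^{\frac{n-\alpha_j}{2}}}\,dZ(u), & t\in(0,1],\\[2mm] 0,& t=0,\end{cases}$$ where $Z(\cdot)$ is the Wiener measure on $(\mathbb{R}^n,\mathfrak{B}^n)$.
   Context: Isotropic spectral density: the field $\xi$ has isotropic spectral density $\varphi:[0,\infty)\to[0,\infty)$ if $\lambda^{n-1}\varphi(\lambda)\in L_1([0,\infty))$ and the spectral function is $\mathbf{\Phi}(|u|)=\frac{2\pi^{n/2}}{\Gamma(n/2)}\int_0^{|u|}z^{n-1}\varphi(z)\,dz$. Equivalently, $\xi$ has the spectral representation $\xi(x)=\int_{\mathbb{R}^n}e^{i\langle\lambda,x\rangle}\sqrt{\varphi(|\lambda|)}\,dW(\lambda)$, where $W$ is the Wiener measure on $(\mathbb{R}^n,\mathfrak{B}^n)$, so that $\mathrm{cov}(\xi(y+x),\xi(y))=\int_{\mathbb{R}^n}e^{i\langle\lambda,x\rangle}\varphi(|\lambda|)\,d\lambda$. Wiener measure on $(\mathbb{R}^n,\mathfrak{B}^n)$: Gaussian white noise on the Borel $\sigma$-algebra $\mathfrak{B}^n$ of $\mathbb{R}^n$, i.e. a centred Gaussian orthogonal random measure whose control measure is Lebesgue measure (in the spectral representation of a real field it is understood to be complex-valued with $W(-A)=\overline{W(A)}$). Admissible weight functions at a point $a\ge 0$: a family of radial, essentially non-zero functions $f_{a,r}:\mathbb{R}^n\to\mathbb{R}$,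 $r>0$, such that (1) $f_{a,r}\in L_1(\mathbb{R}^n)\cap L_2(\mathbb{R}^n)$; (2) the Fourier transform of $r^{-n}f_{a,r}$ has the form $g_a(r(|\lambda|-a))$, that is, $r^{-n}\int_{\mathbb{R}^n}e^{i\langle\lambda,x\rangle}f_{a,r}(x)\,dx=g_a(r(|\lambda|-a))$, with a function $g_a$ not depending on $r$; (3) $g_a(s)$, $s\in\mathbb{R}$, is an even function, and there is a constant $C$ with $g_a^2(s)\le C/s$ for all $s>0$. *)

(* Defs.v *)
From HB Require Import structures.
From mathcomp Require Import all_boot all_order all_algebra.
From mathcomp Require Import all_classical all_reals all_analysis.
From mathcomp Require Import measurable_realfun.

Set Implicit Arguments.
Unset Strict Implicit.
Unset Printing Implicit Defensive.

Import Order.TTheory GRing.Theory Num.Theory.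
Import numFieldNormedType.Exports.

Local Open Scope classical_set_scope.
Local Open Scope ring_scope.

(* 'rV[R]_n is equipped with the Borel sigma-algebra of its topology. *)
Section borel_rV.
Context (R : realType) (n : nat).

Let borel := <<s [set U : set 'rV[R]_n | open U] >>.

Let borel0 : borel set0. Proof. exact: sigma_algebra0. Qed.

Let borelC A : borel A -> borel (~` A). Proof. exact: sigma_algebraC. Qed.

Let borelU (F : (set 'rV[R]_n)^nat) :
  (forall i, borel (F i)) -> borel (\bigcup_i F i).
Proof. exact: sigma_algebra_bigcup. Qed.

HB.instance Definition _ :=
  @isMeasurable.Build default_measure_display 'rV[R]_n
    borel borel0 borelC borelU.

End borel_rV.

Section measurable_rV.
Context (R : realType).

Lemma open_measurable_rV n (U : set 'rV[R]_n) : open U -> measurable U.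
Proof. by move=> oU; exact: sub_sigma_algebra. Qed.

Lemma measurable_coord_rV n (i : 'I_n) :
  measurable_fun [set: 'rV[R]_n] (fun x => x ord0 i : R).
Proof.
apply: (measurability _ (RGenOInfty.measurableE R)) => //.
move=> _ [_ [a ->] <-]; rewrite setTI; apply: open_measurable_rV.
apply: open_comp; last exact: interval_open.
by move=> x _; exact: coord_continuous.
Qed.

Lemma measurable_rVP d (T : measurableType d) n (f : T -> 'rV[R]_n) :
  measurable_fun [set: T] f <->
  forall i, measurable_fun [set: T] (fun w => f w ord0 i : R).
Proof.
split=> [mf i|mf].
  by apply: (measurableT_comp (measurable_coord_rV i)).
apply: (measurability [set U : set 'rV[R]_n | open U]) => //.
move=> _ [U /= oU <-]; rewrite setTI.
pose B (p : 'rV[rat]_n * nat) : set 'rV[R]_n :=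
  [set x | forall i, ball (ratr (p.1 ord0 i) : R) p.2.+1%:R^-1 (x ord0 i)].
pose I := [set p | B p `<=` U].
have UE : U = \bigcup_(p in I) B p.
  apply/seteqP; split=> [x Ux|x [p Ip]]; last exact: Ip.
  have /nbhs_ballP[e /= e0 xeU] := open_nbhs_nbhs (conj oU Ux).
  have [k _ ke] : exists2 k, True & k.+1%:R^-1 + k.+1%:R^-1 < e.
    have [k] := @ltr_add_invr R 0 (e / 2) ltac:(by rewrite divr_gt0).
    by rewrite add0r => ke; exists k => //; rewrite (splitr e) ltrD.
  have k0 : 0 < k.+1%:R^-1 :> R by rewrite invr_gt0.
  have /choice[q qx] : forall i, exists q : rat,
      ball (ratr q : R) k.+1%:R^-1 (x ord0 i).
    move=> i; have [|q] := @rat_in_itvoo R (x ord0 i - k.+1%:R^-1)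
      (x ord0 i + k.+1%:R^-1); first by rewrite ltrD2l gtrN.
    rewrite in_itv/= => /andP[q1 q2]; exists q.
    by rewrite /ball/= ltr_norml ltrBrDl q1 ltrBlDl.
  exists (\row_i q i, k); last by move=> i; rewrite mxE.
  move=> y By; apply: xeU; split=> // i j.
  rewrite !ord1; have := By j; rewrite /= mxE => qy.
  have xy := ball_triangle (ball_sym (qx j)) qy.
  exact: (le_ball (ltW ke) xy).
rewrite UE preimage_bigcup bigcup_mkcond.
apply: countable_bigcupT_measurable => [|p]; first exact: countableP.
case: ifPn => // _.
rewrite (_ : _ @^-1` _ = \bigcap_(i in [set: 'I_n])
  ((fun w => f w ord0 i : R) @^-1` ball (ratr (p.1 ord0 i) : R) p.2.+1%:R^-1)).
  apply: fin_bigcap_measurable => // i _; rewrite -[X in measurable X]setTI.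
  by apply: mf => //; apply: open_measurable; exact: ball_open.
by apply/seteqP; split=> [w Bw i _|w Bw i]; exact: Bw.
Qed.

End measurable_rV.

Section lebesgue_rV.
Context (R : realType).

Definition rV_cons n (p : R * 'rV[R]_n) : 'rV[R]_n.+1 :=
  \row_i oapp (p.2 ord0) p.1 (unlift ord0 i).

Definition rV_uncons n (x : 'rV[R]_n.+1) : R * 'rV[R]_n :=
  (x ord0 ord0, \row_i x ord0 (lift ord0 i)).

Lemma rV_consK n : cancel (@rV_cons n) (@rV_uncons n).
Proof.
move=> [a x]; rewrite /rV_uncons mxE unlift_none/=; congr pair.
by apply/rowP => i; rewrite !mxE liftK.
Qed.

Lemma measurable_rV_cons n : measurable_fun setT (@rV_cons n).
Proof.
apply/measurable_rVP => i; rewrite /rV_cons.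
under eq_fun do rewrite mxE.
case: unliftP => [j _|_]/=; last exact: measurable_fst.
by apply: (measurableT_comp (measurable_coord_rV j)); exact: measurable_snd.
Qed.

Lemma measurable_rV_uncons n : measurable_fun setT (@rV_uncons n).
Proof.
apply/measurable_fun_pairP; split; first exact: measurable_coord_rV.
apply/measurable_rVP => i /=; under eq_fun do rewrite mxE.
exact: measurable_coord_rV.
Qed.

Section lebesgue_rV_step.
Context n (mu : {sigma_finite_measure set 'rV[R]_n -> \bar R}).

Definition lebesgue_rV_step : set 'rV[R]_n.+1 -> \bar R :=
  pushforward (@lebesgue_measure R \x mu)%E (@rV_cons n).

Let lebesgue_rV_step0 : lebesgue_rV_step set0 = 0%E.
Proof. by rewrite /lebesgue_rV_step /pushforward preimage_set0 measure0. Qed.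

Let lebesgue_rV_step_ge0 A : (0 <= lebesgue_rV_step A)%E.
Proof. by rewrite /lebesgue_rV_step /pushforward measure_ge0. Qed.

Let lebesgue_rV_step_sigma_additive : semi_sigma_additive lebesgue_rV_step.
Proof.
move=> F mF tF mUF; rewrite /lebesgue_rV_step /pushforward preimage_bigcup.
have mcons A : measurable A -> measurable (@rV_cons n @^-1` A).
  by move=> mA; rewrite -[X in measurable X]setTI; exact: measurable_rV_cons.
apply: measure_semi_sigma_additive => [k||].
- exact: mcons.
- apply/trivIsetP => /= i j _ _ ij; rewrite -preimage_setI.
  by move/trivIsetP : tF => /(_ _ _ _ _ ij) ->//; rewrite preimage_set0.
- by rewrite -preimage_bigcup; exact: mcons.
Qed.

HB.instance Definition _ := isMeasure.Build _ _ _ lebesgue_rV_step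
  lebesgue_rV_step0 lebesgue_rV_step_ge0 lebesgue_rV_step_sigma_additive.

Let lebesgue_rV_step_sigma_finite : sigma_finite setT lebesgue_rV_step.
Proof.
have [F FT Foo] : sigma_finite setT (@lebesgue_measure R \x mu)%E.
  have /sigma_finiteP[F [TF ndF Foo]] := sigma_finiteT (@lebesgue_measure R).
  have /sigma_finiteP[G [TG ndG Goo]] := sigma_finiteT mu.
  exists (fun k => F k `*` G k) => [|k].
    rewrite -setXTT TF TG predeqE => -[x y]; split => [|[k _ [? ?]]].
      move=> [/= [l _ Flx] [k _ Gky]]; exists (maxn l k) => //; split.
      - by move: x Flx; exact/subsetPset/ndF/leq_maxl.
      - by move: y Gky; exact/subsetPset/ndG/leq_maxr.
    by split; exists k.
  have [? ?] := Foo k; have [? ?] := Goo k; split; first exact: measurableX.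
  by rewrite product_measure1E// lte_mul_pinfty// ge0_fin_numE.
exists (fun k => @rV_uncons n @^-1` F k) => [|k].
  by rewrite -preimage_bigcup -FT preimage_setT.
have [mF Fk] := Foo k; split.
  by rewrite -[X in measurable X]setTI; exact: measurable_rV_uncons.
rewrite /lebesgue_rV_step /pushforward -comp_preimage.
by rewrite (_ : _ \o _ = id)//; apply/funext/rV_consK.
Qed.

HB.instance Definition _ := Measure_isSigmaFinite.Build _ _ _
  lebesgue_rV_step lebesgue_rV_step_sigma_finite.

End lebesgue_rV_step.

(* Iterated product of one-dimensional Lebesgue measures, transported along
   R * 'rV[R]_m ~ 'rV[R]_m.+1; see lebesgue_rV_box. *)
Fixpoint lebesgue_rV n : {sigma_finite_measure set 'rV[R]_n -> \bar R} :=
  if n is m.+1 then lebesgue_rV_step (lebesgue_rV m) else \d_(0 : 'rV[R]_0).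

Lemma lebesgue_rV_box n (A : 'I_n -> set R) : (forall i, measurable (A i)) ->
  lebesgue_rV n [set x | forall i, A i (x ord0 i)] =
  (\prod_(i < n) lebesgue_measure (A i))%E.
Proof.
elim: n A => [|n IH] A mA.
  by rewrite big_ord0 /= diracE mem_set// => -[].
rewrite big_ord_recl -IH => [|i]; last exact: mA.
rewrite /= /lebesgue_rV_step /pushforward -product_measure1E//.
  congr product_measure1.
  apply/seteqP; split=> [[a x] /= Aax|[a x] /= [Aa Ax] i].
    split=> [|i]; first by have := Aax ord0; rewrite mxE unlift_none.
    by have := Aax (lift ord0 i); rewrite mxE liftK.
  by rewrite mxE; case: unliftP => [j ->|->] //=.
  exact: (mA ord0).
rewrite [X in measurable X](_ : _ = \bigcap_(i in [set: 'I_n])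
  ((fun x : 'rV[R]_n => x ord0 i : R) @^-1` A (lift ord0 i))).
  apply: fin_bigcap_measurable => // i _; rewrite -[X in measurable X]setTI.
  exact: measurable_coord_rV.
by apply/seteqP; split=> [w Bw i _|w Bw i]; exact: Bw.
Qed.

End lebesgue_rV.

Section euclidean.
Context (R : realType) (n : nat).
Implicit Types x y : 'rV[R]_n.

Definition dotp x y : R := \sum_i x ord0 i * y ord0 i.

(* The Euclidean norm; the library norm `|x| on 'rV[R]_n is the sup norm. *)
Definition enorm x : R := Num.sqrt (dotp x x).

End euclidean.

Definition Gamma (R : realType) (s : R) : R :=
  \int[lebesgue_measure]_(x in `]0, +oo[) (x `^ (s - 1) * expR (- x)).

Section gaussian.
Context d (T : measurableType d) (R : realType) (P : probability T R).

(* Degenerate laws (s = 0) are Gaussian. *)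
Definition gaussian_rv (X : T -> R) : Prop :=
  measurable_fun setT X /\
  exists m s : R, forall A : set R, measurable A ->
    P (X @^-1` A) = if s == 0 then \d_m A else normal_prob m s A.

Definition gaussian_family (I : Type) (D : set I) (X : I -> T -> R) : Prop :=
  forall (m : nat) (t : 'I_m -> I) (c : 'I_m -> R), (forall i, D (t i)) ->
    gaussian_rv (fun w => \sum_(i < m) c i * X (t i) w).

End gaussian.

Section random_field.
Context d (T : measurableType d) (R : realType) (P : probability T R) (n : nat).
Implicit Types (xi : 'rV[R]_n -> T -> R).

Definition measurable_field xi : Prop :=
  measurable_fun setT (fun p : 'rV[R]_n * T => xi p.1 p.2).

Definition zero_mean xi : Prop := forall x, expectation P (xi x) = 0%E.

Definition mean_square_continuous xi : Prop :=
  forall x, expectation P (fun w => (xi y w - xi x w) ^+ 2) @[y --> x] --> 0%E.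

(* Homogeneity and isotropy are understood in the wide sense. *)
Definition homogeneous xi : Prop :=
  (forall x y, expectation P (xi x) = expectation P (xi y)) /\
  forall x y z, covariance P (xi (x + z)) (xi (y + z)) =
                covariance P (xi x) (xi y).

Definition isotropic xi : Prop :=
  forall Q : 'M[R]_n, Q *m Q^T = 1%:M -> \det Q = 1 ->
    (forall x, expectation P (xi (x *m Q)) = expectation P (xi x)) /\
    forall x y, covariance P (xi (x *m Q)) (xi (y *m Q)) =
                covariance P (xi x) (xi y).

(* Bochner representation cov (xi (y + x)) (xi y) = \int e^(i<u, x>) F(du) of
   the covariance function by a finite Borel measure F, split into its real
   and imaginary parts; the latter vanishes because xi is real-valued. *)
Definition spectral_measure xi (F : {measure set 'rV[R]_n -> \bar R}) : Prop :=
  [/\ (F setT < +oo)%E,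
      forall x y, covariance P (xi (y + x)) (xi y) =
        (\int[F]_u (cos (dotp u x))%:E)%E
    & forall x, (\int[F]_u (sin (dotp u x))%:E)%E = 0%E].

Definition spectral_function xi (Phi : R -> R) : Prop :=
  exists2 F : {measure set 'rV[R]_n -> \bar R}, spectral_measure xi F &
    forall r, 0 <= r -> F [set u | enorm u <= r] = (Phi r)%:E.

(* Only the values of phi on [0, +oo[ matter. *)
Definition isotropic_spectral_density xi (phi : R -> R) : Prop :=
  [/\ forall z, 0 <= z -> 0 <= phi z,
      lebesgue_measure.-integrable `[0, +oo[ (fun z => (z ^+ n.-1 * phi z)%:E)
    & spectral_function xi (fun r =>
        2 * pi `^ (n%:R / 2) / Gamma (n%:R / 2) *
        \int[lebesgue_measure]_(z in `[0, r]) (z ^+ n.-1 * phi z))].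

End random_field.

Section white_noise.
Context d (T : measurableType d) (R : realType) (P : probability T R) (n : nat).
Local Notation mu := (lebesgue_rV R n).

Definition finite_volume (A : set 'rV[R]_n) : Prop :=
  measurable A /\ (mu A < +oo)%E.

(* Centred Gaussian orthogonal random measure with control measure mu, indexed
   by the Borel sets of finite volume. *)
Definition white_noise (Z : set 'rV[R]_n -> T -> R) : Prop :=
  [/\ gaussian_family P finite_volume Z,
      forall A, finite_volume A -> expectation P (Z A) = 0%E,
      forall A B, finite_volume A -> finite_volume B ->
        expectation P (fun w => Z A w * Z B w) = mu (A `&` B)
    & forall F : (set 'rV[R]_n)^nat, trivIset setT F ->
        (forall k, finite_volume (F k)) -> finite_volume (\bigcup_k F k) ->
        expectation P (fun w =>
          (Z (\bigcup_k F k) w - \sum_(k < N) Z (F k) w) ^+ 2)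
          @[N --> \oo] --> 0%E].

(* e represents the step function \sum_((c, A) in e) c * \1_A. *)
Definition step_fun (e : seq (R * set 'rV[R]_n)) (u : 'rV[R]_n) : R :=
  \sum_(p <- e) p.1 * \1_(p.2) u.

Definition step_integral (Z : set 'rV[R]_n -> T -> R)
    (e : seq (R * set 'rV[R]_n)) (w : T) : R :=
  \sum_(p <- e) p.1 * Z p.2 w.

Definition is_wiener_integral (Z : set 'rV[R]_n -> T -> R)
    (f : 'rV[R]_n -> R) (I : T -> R) : Prop :=
  [/\ measurable_fun setT f, measurable_fun setT I &
    exists e : nat -> seq (R * set 'rV[R]_n),
    [/\ forall k p, p \in e k -> finite_volume p.2,
        (\int[mu]_u ((f u - step_fun (e k) u) ^+ 2)%:E)%E
          @[k --> \oo] --> 0%E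
      & expectation P (fun w => (I w - step_integral Z (e k) w) ^+ 2)
          @[k --> \oo] --> 0%E]].

(* A version of the integral of f against Z, which exists and is almost surely
   unique for f in L^2; the default value 0 is used for other f. *)
Definition wiener_integral (Z : set 'rV[R]_n -> T -> R) (f : 'rV[R]_n -> R) :
  T -> R := xget (cst 0) [set I | is_wiener_integral Z f I].

End white_noise.

Section weights.
Context (R : realType) (n : nat).
Local Notation mu := (lebesgue_rV R n).

(* The Fourier transform of r^-n f_r is split into its real and imaginary
   parts, g being real-valued. *)
Definition admissible_weights (a : R) (f : R -> 'rV[R]_n -> R) (g : R -> R) :
  Prop :=
  [/\ forall r, 0 < r ->
        [/\ forall x y, enorm x = enorm y -> f r x = f r y,
            ~ {ae mu, forall x, f r x = 0},
            mu.-integrable setT (fun x => (f r x)%:E)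
          & mu.-integrable setT (fun x => (f r x ^+ 2)%:E)],
      forall r, 0 < r -> forall l : 'rV[R]_n,
        r ^- n * \int[mu]_x (cos (dotp l x) * f r x) = g (r * (enorm l - a)) /\
        r ^- n * \int[mu]_x (sin (dotp l x) * f r x) = 0,
      forall s, g (- s) = g s
    & exists C : R, forall s, 0 < s -> g s ^+ 2 <= C / s].

End weights.

(* Weak convergence, as r --> +oo, of the finite-dimensional distributions of
   X r = (X r t)_(t in D) to those of Y. *)
Definition fdd_converge (R : realType) (D : set R)
    d (T : measurableType d) (P : probability T R) (X : R -> R -> T -> R)
    d' (T' : measurableType d') (P' : probability T' R) (Y : R -> T' -> R) :
  Prop :=
  [/\ forall r t, 0 < r -> D t -> measurable_fun setT (X r t),
      forall t, D t -> measurable_fun setT (Y t)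
    & forall (m : nat) (t : 'I_m -> R), (forall i, D (t i)) ->
      forall G : 'rV[R]_m -> R, continuous G ->
      (exists M : R, forall v, `|G v| <= M) ->
      expectation P (fun w => G (\row_i X r (t i) w)) @[r --> +oo%R] -->
      expectation P' (fun w => G (\row_i Y (t i) w))].

(* Main.v *)
Require Import Defs.
From HB Require Import structures.
From mathcomp Require Import all_boot all_order all_algebra.
From mathcomp Require Import all_classical all_reals all_analysis.
From mathcomp Require Import measurable_realfun ring lra.

Set Implicit Arguments.
Unset Strict Implicit.
Unset Printing Implicit Defensive.

Import Order.TTheory GRing.Theory Num.Theory.
Import numFieldNormedType.Exports.

Local Open Scope classical_set_scope.
Local Open Scope ring_scope.

(** At finitely many times the normalised integrals of the field and the limit
    process are centred Gaussian vectors, so their convergence in law reduces to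
    the convergence of the variances of all linear combinations.

    This reduction is gausslike_weak_cvg.  A variable X is called gausslike when
    E cos (X + b) has the value prescribed by its variance for every b.  Linear
    combinations of values of a centred Gaussian family are gausslike, and so are
    their mean-square limits; this covers the integrals of f against xi
    (field_integral_gausslike), because xi is mean-square continuous, and the
    Wiener integrals (wiener_gausslike).  A bounded continuous function is
    uniformly close, on a large box, to a trigonometric polynomial with the same
    bound (trig_approx); expectations of trigonometric polynomials are functions
    of variances, and the complement of the box is controlled by second moments.

    The variances.  Put g* (s) = \sum_i c i * t i ^ n * g (t i * s).  By Fubini's
    theorem the variance of an integral of the field is the integral of the
    squared Fourier transform of the weight against the spectral measure
    (field_integral_msq).  The latter has the radial density
    w (z) = z ^ (n - 1) * phi (z) times the area of the unit sphere, whence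
    a variance proportional to
      r ^ (alpha j) * \int_0^oo g* (r * (z - a j)) ^ 2 * w (z) dz.
    Near a j the function w is |z - a j| ^ (alpha j - 1) times a function that
    tends to h (a j) / V.  Substituting z = a j + v / r and letting r grow leaves
      h (a j) / V * \int_R g* (v) ^ 2 * |v| ^ (alpha j - 1) dv,
    and the rest of the half-line contributes O(r ^ (alpha j - 1)) because
    g* (s) ^ 2 = O(1 / s) (tame_localize).  As g* is even, the integral over R is
    twice the one over the half-line; the factor 2 cancels the one in the
    normalisation.  On the other side the isometry of the Wiener integral gives
    the variance \int g* (|u|) ^ 2 * |u| ^ (alpha j - n) du, which in polar
    coordinates (ge0_integral_enorm) is the same number.  The constant of polar
    coordinates matches the one in the definition of the spectral density because
    the Gaussian integral evaluates the volume of the unit ball through Gamma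
    (unit_ball_volumeE). *)

(** * Change of variables and linearity of the integral *)

Section transport.
Context d d' (X : measurableType d) (Y : measurableType d') (R : realType).
Variables (mu : {measure set X -> \bar R}) (nu : {measure set Y -> \bar R}).
Variables (p : X -> Y) (w : X -> R).
Hypotheses (mp : measurable_fun setT p) (mw : measurable_fun setT w).
Hypothesis w0 : forall x, 0 <= w x.
Hypothesis nuE : forall A, measurable A ->
  nu A = (\int[mu]_(x in p @^-1` A) (w x)%:E)%E.
Local Open Scope ereal_scope.
Import HBNNSimple.

(** One statement covers image measures (w = 1), densities (p = id) and affine
    substitutions (w constant).  The hypothesis is the case of indicators;
    simple functions and monotone convergence give the rest. *)
Lemma ge0_integral_transport (f : Y -> \bar R) :
  measurable_fun setT f -> (forall y, 0 <= f y) ->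
  \int[nu]_y f y = \int[mu]_x (f (p x) * (w x)%:E).
Proof.
move=> mf f0; pose h := nnsfun_approx measurableT mf.
have mpA A : measurable A -> measurable (p @^-1` A).
  by move=> mA; rewrite -[X in measurable X]setTI; exact: mp.
have fE y : f y = limn (fun n => (h n y)%:E).
  by apply/esym/cvg_lim => //; exact: cvg_nnsfun_approx.
have -> : \int[nu]_y f y = limn (fun n => \int[nu]_y (h n y)%:E).
  under eq_integral do rewrite fE.
  apply: monotone_convergence => //.
  - by move=> n; apply/measurable_EFinP; exact/measurable_funP.
  - by move=> n x _ //=; rewrite lee_fin.
  - by move=> x _ a b ab; rewrite lee_fin; exact/lefP/nd_nnsfun_approx.
have -> : \int[mu]_x (f (p x) * (w x)%:E) =
    limn (fun n => \int[mu]_x ((h n (p x))%:E * (w x)%:E)).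
  have fwE x : f (p x) * (w x)%:E = limn (fun n => (h n (p x))%:E * (w x)%:E).
    apply/esym/cvg_lim => //; apply: cvgeZr => //.
    exact: cvg_nnsfun_approx.
  under eq_integral do rewrite fwE.
  apply: monotone_convergence => //.
  - move=> n; apply/emeasurable_funM; apply/measurable_EFinP => //.
    by apply: measurableT_comp => //; exact/measurable_funP.
  - by move=> n x _ //=; rewrite mule_ge0// lee_fin.
  - move=> x _ a b ab; rewrite lee_wpmul2r ?lee_fin//.
    exact/lefP/nd_nnsfun_approx.
congr (limn _); apply/funext => n.
transitivity (\int[nu]_y
   (\sum_(r \in range (h n)) (r * \1_(h n @^-1` [set r]) y)%:E)).
  by apply: eq_integral => t tE; rewrite /= fimfunE -fsumEFin.
rewrite ge0_integral_fsum//; last 2 first.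
  - by move=> r; apply/measurable_EFinP/measurable_funM.
  - by move=> m y Ey; exact: nnfun_muleindic_ge0.
transitivity (\int[mu]_x (\sum_(r \in range (h n))
    (r * \1_(h n @^-1` [set r]) (p x))%:E * (w x)%:E)); last first.
  apply: eq_integral => x xE.
  rewrite -ge0_mule_fsuml => [|y]; last exact: nnfun_muleindic_ge0.
  by rewrite fsumEFin // -(fimfunE _ (p x)).
have mi r : measurable_fun setT (fun x => (r * \1_(h n @^-1` [set r]) (p x))%:E).
  apply/measurable_EFinP/measurable_funM => //.
  have m1 : measurable_fun setT (\1_(h n @^-1` [set r]) : Y -> R) by [].
  exact: (measurableT_comp m1 mp).
rewrite ge0_integral_fsum//; last 2 first.
  - by move=> r; apply: emeasurable_funM => //; apply/measurable_EFinP.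
  - move=> m x _; apply: mule_ge0; last by rewrite lee_fin.
    by rewrite EFinM nnfun_muleindic_ge0.
apply: eq_fsbigr => r rhn.
under eq_integral do rewrite EFinM.
rewrite integralZl_indic_nnsfun => //.
rewrite integral_indic// setIT nuE//.
under [RHS]eq_integral do rewrite EFinM -muleA.
rewrite ge0_integralZl//.
- congr (_ * _); rewrite integral_mkcond; apply: eq_integral => x _.
  rewrite patchE indicE; have [xp|xp] := boolP (x \in _).
    by rewrite mem_set ?mul1e//; move: xp; rewrite inE.
  by rewrite memNset ?mul0e//; move: xp; rewrite notin_setE.
- apply: emeasurable_funM; apply/measurable_EFinP => //.
  have m1 : measurable_fun setT (\1_(h n @^-1` [set r]) : Y -> R) by [].
  exact: (measurableT_comp m1 mp).
- by move=> t Et; rewrite mule_ge0 ?lee_fin ?w0.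
- by move: rhn; rewrite inE => -[t _ <-]; rewrite lee_fin.
Qed.

End transport.

Section affine.
Context (R : realType).
Local Notation leb := (@lebesgue_measure R).

Let measurable_affine (c m : R) : measurable_fun setT (fun x : R => c * x + m).
Proof. by apply: measurable_funD => //; exact: measurable_funM. Qed.

(* For c > 0 both sides are measures in A that agree on half-open intervals;
   reflection reduces c < 0 to this case. *)
Let lebesgue_affine_gt0 (c m : R) (A : set R) : 0 < c -> measurable A ->
  leb A = (c%:E * leb ((fun x : R => (c * x + m)%R) @^-1` A))%E.
Proof.
move=> c0 mA.
have mf : measurable_fun setT (fun x => c * x + m : measurableTypeR R).
  exact: measurable_affine.
have cn : 0 <= c by exact: ltW.
pose nu := mscale (NngNum cn)
  (measure_function_pushforward__canonical__measure_function_Measure leb mf).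
rewrite (@lebesgue_measure_unique _ nu)//.
move=> _ [[a b] _ <-] /=; rewrite /nu/= /mscale/= /pushforward.
rewrite (_ : _ @^-1` _ = `](a - m) / c, (b - m) / c]%classic); last first.
  apply/seteqP; split => x /=; rewrite !in_itv/=;
  by rewrite ltr_pdivrMr// ler_pdivlMr// ltrBlDr lerBrDr mulrC.
rewrite !lebesgue_measure_itv/= !lte_fin ltr_pM2r ?invr_gt0// ltrD2r.
case: ifPn => _; last by rewrite mule0.
rewrite -!EFinB -EFinM; congr EFin; field; exact: lt0r_neq0.
Qed.

Lemma lebesgue_affine (c m : R) (A : set R) : c != 0 -> measurable A ->
  leb A = (`|c|%:E * leb ((fun x : R => (c * x + m)%R) @^-1` A))%E.
Proof.
rewrite neq_lt => /orP[c0|c0] mA; last first.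
  by rewrite gtr0_norm//; exact: lebesgue_affine_gt0.
have c0' : 0 < - c by rewrite oppr_gt0.
rewrite ltr0_norm// -[LHS]lebesgue_measureN// /pushforward.
rewrite (@lebesgue_affine_gt0 (- c) (- m))//; last first.
  by rewrite -[X in measurable X]setTI; exact: oppr_measurable.
congr (_ * leb _)%E; apply/seteqP.
by split=> x /=; rewrite mulNr opprD !opprK.
Qed.

Lemma ge0_integral_affine (c m : R) (f : R -> \bar R) : c != 0 ->
  measurable_fun setT f -> (forall x, 0 <= f x)%E ->
  (\int[leb]_x f x = \int[leb]_x (f (c * x + m)%R * `|c|%:E))%E.
Proof.
move=> c0 mf f0.
apply: (@ge0_integral_transport _ _ _ _ _ leb leb (fun x => c * x + m)
  (cst `|c|)) => //.
- exact: measurable_affine.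
- move=> A mA; rewrite (@eq_integral _ _ _ _ _ (cst `|c|%:E))//.
  rewrite integral_cst//; first exact: lebesgue_affine.
  by rewrite -[X in measurable X]setTI; exact: measurable_affine.
Qed.

End affine.

Section integrable_linear.
Context d (T : measurableType d) (R : realType) (mu : {measure set T -> \bar R}).
Implicit Types f g : T -> R.

Lemma integrable_scale c f : mu.-integrable setT (fun x => (f x)%:E) ->
  mu.-integrable setT (fun x => (c * f x)%:E).
Proof.
move=> fi; have := integrableZl _ c fi => /(_ measurableT).
by apply: eq_integrable => // x _; rewrite EFinM.
Qed.

Lemma integrable_scaler c f : mu.-integrable setT (fun x => (f x)%:E) ->
  mu.-integrable setT (fun x => (f x * c)%:E).
Proof.
move=> /(integrable_scale c); apply: eq_integrable => // x _.
by rewrite mulrC.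
Qed.

Lemma integrable_add f g : mu.-integrable setT (fun x => (f x)%:E) ->
  mu.-integrable setT (fun x => (g x)%:E) ->
  mu.-integrable setT (fun x => (f x + g x)%:E).
Proof.
move=> fi gi; have := integrableD _ fi gi => /(_ measurableT).
by apply: eq_integrable => // x _; rewrite EFinD.
Qed.

Lemma integrable_sub f g : mu.-integrable setT (fun x => (f x)%:E) ->
  mu.-integrable setT (fun x => (g x)%:E) ->
  mu.-integrable setT (fun x => (f x - g x)%:E).
Proof.
move=> fi gi; have := integrableB _ fi gi => /(_ measurableT).
by apply: eq_integrable => // x _; rewrite EFinB.
Qed.

End integrable_linear.

Lemma Rintegral_sum d (T : measurableType d) (R : realType)
    (mu : {measure set T -> \bar R})
    (I : Type) (r : seq I) (f : I -> T -> R) :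
  (forall i, mu.-integrable setT (EFin \o f i)) ->
  mu.-integrable setT (EFin \o (fun x => \sum_(i <- r) f i x)) /\
  \int[mu]_x (\sum_(i <- r) f i x) = \sum_(i <- r) \int[mu]_x f i x.
Proof.
move=> fi; elim: r => [|i r [ih1 ih2]].
  rewrite big_nil; split.
    by under eq_fun do rewrite /= big_nil; exact: integrable0.
  by rewrite /Rintegral; under eq_integral do rewrite big_nil; rewrite integral0.
split.
  have := integrable_add (fi i) ih1.
  by apply: eq_integrable => // x _; rewrite /= big_cons.
under eq_Rintegral do rewrite big_cons.
by rewrite RintegralD// ih2 big_cons.
Qed.

(** * Square-integrable functions *)

Lemma cvg_Rintegral_dominated d (T : measurableType d) (R : realType)
    (mu : {measure set T -> \bar R}) (D : set T) (f_ : nat -> T -> R)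
    (f : T -> R) (g : T -> \bar R) : measurable D ->
  (forall k, measurable_fun D (f_ k)) -> measurable_fun D f ->
  {ae mu, forall x, D x -> f_ k x @[k --> \oo] --> f x} ->
  mu.-integrable D g ->
  (forall k x, D x -> (`|f_ k x|%:E <= g x)%E) ->
  mu.-integrable D (EFin \o f) /\
  \int[mu]_(x in D) f_ k x @[k --> \oo] --> \int[mu]_(x in D) f x.
Proof.
move=> mD mf_ mf ff ig fg.
have [i1 _ i3] : [/\ mu.-integrable D (EFin \o f),
  [sequence (\int[mu]_(x in D) `|(f_ k x)%:E - (f x)%:E|)%E]_k @ \oo --> 0%E &
  [sequence (\int[mu]_(x in D) (f_ k x)%:E)%E]_k @ \oo -->
    (\int[mu]_(x in D) (f x)%:E)%E].
  apply: (@dominated_convergence _ _ _ mu _ mD (fun k x => (f_ k x)%:E)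
    (EFin \o f) g) => //.
  - by move=> k; exact/measurable_EFinP.
  - exact/measurable_EFinP.
  - apply: filterS ff => x fx Dx; apply: cvg_EFin; last exact: fx.
    by near=> k.
  - by apply: aeW => x k Dx /=; exact: fg.
split=> //; apply: fine_cvg; rewrite fineK//.
exact: integrable_fin_num.
Unshelve. all: by end_near. Qed.

Section square_integrable.
Context d (T : measurableType d) (R : realType).
Variable mu : {measure set T -> \bar R}.
Implicit Types f g : T -> R.

(** The same pair of notions serves for second moments under a probability and
    for energies with respect to Lebesgue measure or a spectral measure, so
    that an isometry reads as an equality between two instances of msq. *)
Definition sqint f := measurable_fun setT f /\
  mu.-integrable setT (fun x => (f x ^+ 2)%:E).

Definition msq f : R := \int[mu]_x (f x ^+ 2).

Lemma msq_ge0 f : 0 <= msq f.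
Proof. by apply: Rintegral_ge0 => x _; exact: sqr_ge0. Qed.

Lemma msqE f : sqint f -> (msq f)%:E = (\int[mu]_x (f x ^+ 2)%:E)%E.
Proof. by move=> [_ fi]; rewrite fineK//; exact: integrable_fin_num. Qed.

Lemma sqintP f : measurable_fun setT f ->
  (\int[mu]_x (f x ^+ 2)%:E < +oo)%E -> sqint f.
Proof.
move=> mf fi; split=> //; apply/integrableP; split.
  by apply/measurable_EFinP; exact: measurable_funX.
by under eq_integral do rewrite gee0_abs ?lee_fin ?sqr_ge0//.
Qed.

Lemma sqint_mul f g : sqint f -> sqint g ->
  mu.-integrable setT (fun x => (f x * g x)%:E).
Proof.
move=> [mf fi] [mg gi]; apply: le_integrable (integrableD _ fi gi) => //.
  by apply/measurable_EFinP; exact: measurable_funM.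
move=> x _ /=; rewrite lee_fin [leRHS]ger0_norm ?addr_ge0 ?sqr_ge0//.
rewrite ler_norml; apply/andP; split; nra.
Qed.

Lemma sqintZ (a : R) f : sqint f -> sqint (fun x => a * f x).
Proof.
move=> [mf fi]; split; first exact: measurable_funM.
have := integrableZl _ (a ^+ 2) fi => /(_ measurableT).
by apply: eq_integrable => // x _; rewrite exprMn EFinM.
Qed.

Lemma sqintD f g : sqint f -> sqint g -> sqint (fun x => f x + g x).
Proof.
move=> [mf fi] [mg gi]; split; first exact: measurable_funD.
have := integrableZl _ 2 (integrableD _ fi gi) => /(_ measurableT measurableT).
apply: le_integrable => //.
  by apply/measurable_EFinP/measurable_funX; exact: measurable_funD.
move=> x _ /=; rewrite lee_fin [leLHS]ger0_norm ?sqr_ge0// [leRHS]ger0_norm.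
  by have := sqr_ge0 (f x - g x); nra.
by rewrite mulr_ge0// addr_ge0// sqr_ge0.
Qed.

Lemma sqintB f g : sqint f -> sqint g -> sqint (fun x => f x - g x).
Proof.
move=> sf sg; have := sqintD sf (sqintZ (-1) sg).
by under [X in sqint X -> _]eq_fun do rewrite mulN1r.
Qed.

Lemma sqint0 : sqint (cst 0).
Proof.
split=> //; apply: eq_integrable (integrable0 _ _) => // x _ /=.
by rewrite expr0n.
Qed.

Lemma msqZ (a : R) f : sqint f -> msq (fun x => a * f x) = a ^+ 2 * msq f.
Proof.
move=> [mf fi]; rewrite /msq -RintegralZl//.
by apply: eq_Rintegral => x _; rewrite exprMn.
Qed.

(** Polarising f ^+ 2 - g ^+ 2 = (f - g) * (2 * f - (f - g)) and splitting the
    product by Young's inequality makes msq continuous for mean-square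
    convergence without square roots. *)
Lemma msq_dist f g (e : R) : 0 < e -> sqint f -> sqint g ->
  `|msq f - msq g| <= e * msq f + (1 + e^-1) * msq (fun x => f x - g x).
Proof.
move=> e0 sf sg; have sfg := sqintB sf sg.
have [mf fi] := sf; have [mg gi] := sg; have [mfg fgi] := sfg.
have i1 : mu.-integrable setT (fun x => (e * f x ^+ 2)%:E).
  exact: (integrable_scale e fi).
have i2 : mu.-integrable setT
    (fun x => ((1 + e^-1) * (f x - g x) ^+ 2)%:E).
  exact: (integrable_scale (1 + e^-1) fgi).
have i3 : mu.-integrable setT
    (EFin \o (fun x => f x ^+ 2 - g x ^+ 2)).
  exact: (integrable_sub fi gi).
rewrite -RintegralB// (le_trans (le_normr_Rintegral _ i3))//.
rewrite /msq -!RintegralZl// -RintegralD//; apply: le_Rintegral => //.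
- exact: (integrable_norm i3).
- exact: (integrable_add i1 i2).
move=> x _; rewrite mulrDl mul1r.
have h1 : e^-1 * (f x - g x) ^+ 2 + e * f x ^+ 2
    - 2 * (f x * (f x - g x)) = e^-1 * (f x - g x - e * f x) ^+ 2.
  by field; exact: lt0r_neq0.
have h2 : e^-1 * (f x - g x) ^+ 2 + e * f x ^+ 2
    + 2 * (f x * (f x - g x)) = e^-1 * (f x - g x + e * f x) ^+ 2.
  by field; exact: lt0r_neq0.
have h1' : 0 <= e^-1 * (f x - g x - e * f x) ^+ 2.
  by rewrite mulr_ge0 ?sqr_ge0// invr_ge0 ltW.
have h2' : 0 <= e^-1 * (f x - g x + e * f x) ^+ 2.
  by rewrite mulr_ge0 ?sqr_ge0// invr_ge0 ltW.
have h3 := sqr_ge0 (f x - g x).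
rewrite ler_norml; apply/andP; split; nra.
Qed.

Lemma msq_cvg f (f_ : nat -> T -> R) : sqint f -> (forall k, sqint (f_ k)) ->
  msq (fun x => f x - f_ k x) @[k --> \oo] --> 0 ->
  msq (f_ k) @[k --> \oo] --> msq f.
Proof.
move=> sf sf_ cf; apply/cvgrPdist_le => e e0.
have M0 := msq_ge0 f.
pose c := e / (2 * (msq f + 1)).
have c0 : 0 < c by rewrite divr_gt0// mulr_gt0// ltr_wpDl.
have c1 : 0 < 1 + c^-1 by rewrite addr_gt0// invr_gt0.
have : \forall k \near \oo, msq (fun x => f x - f_ k x) <= e / (2 * (1 + c^-1)).
  move/cvgrPdist_le : cf => /(_ (e / (2 * (1 + c^-1)))).
  have e2 : 0 < e / (2 * (1 + c^-1)) by rewrite divr_gt0// mulr_gt0.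
  move=> /(_ e2); apply: filterS => k; rewrite sub0r normrN ger0_norm//.
  exact: msq_ge0.
apply: filterS => k hk; rewrite (le_trans (msq_dist c0 sf (sf_ k)))//.
have h1 : c * msq f <= e / 2.
  rewrite /c mulrAC ler_pdivrMr ?mulr_gt0 ?ltr_wpDl//.
  have : e / 2 * (2 * (msq f + 1)) = e * msq f + e by field.
  by move=> ->; rewrite lerDl ltW.
have h2 : (1 + c^-1) * msq (fun x => f x - f_ k x) <= e / 2.
  rewrite mulrC -ler_pdivlMr// (le_trans hk)//.
  by rewrite invfM mulrA.
by rewrite (splitr e) lerD.
Qed.

(** Cauchy-Schwarz for the measure of density |F|: the quadratic polynomial
    t |-> \int |F| * (t - sgn F * D) ^+ 2 is nonnegative. *)
Lemma Rintegral_weighted_sqr (F D : T -> R) :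
  measurable_fun setT D -> mu.-integrable setT (fun x => (F x)%:E) ->
  mu.-integrable setT (fun x => (`|F x| * D x ^+ 2)%:E) ->
  mu.-integrable setT (fun x => (F x * D x)%:E) /\
  (\int[mu]_x (F x * D x)) ^+ 2 <=
    (\int[mu]_x `|F x|) * \int[mu]_x (`|F x| * D x ^+ 2).
Proof.
move=> mD iF iFD.
have mF : measurable_fun setT F by apply/measurable_EFinP; exact: measurable_int iF.
have iaF : mu.-integrable setT (fun x => `|F x|%:E).
  exact: (integrable_norm iF).
have iFD1 : mu.-integrable setT (fun x => (F x * D x)%:E).
  apply: le_integrable (integrableD _ iaF iFD) => //.
    by apply/measurable_EFinP; exact: measurable_funM.
  move=> x _ /=; rewrite lee_fin [leRHS]ger0_norm; last first.
    by rewrite addr_ge0// mulr_ge0// sqr_ge0.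
  rewrite normrM -(real_normK (num_real (D x))).
  have h : 0 <= `|F x| * (1 - `|D x| + `|D x| ^+ 2).
    by rewrite mulr_ge0//; have := sqr_ge0 (`|D x| - 2^-1); nra.
  by move: h; nra.
split=> //.
set A := \int[mu]_x `|F x|; set B := \int[mu]_x (`|F x| * D x ^+ 2).
set M := \int[mu]_x (F x * D x).
have q t : 0 <= A * t ^+ 2 - 2 * t * M + B.
  have i1 : mu.-integrable setT (EFin \o (fun x => t ^+ 2 * `|F x|)).
    exact: (integrable_scale (t ^+ 2) iaF).
  have i2 : mu.-integrable setT (EFin \o (fun x => 2 * t * (F x * D x))).
    exact: (integrable_scale (2 * t) iFD1).
  have i3 : mu.-integrable setT
      (EFin \o (fun x => t ^+ 2 * `|F x| - 2 * t * (F x * D x))).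
    exact: (integrable_sub i1 i2).
  rewrite (_ : _ + B = \int[mu]_x (t ^+ 2 * `|F x| - 2 * t * (F x * D x)
      + `|F x| * D x ^+ 2)); last first.
    by rewrite RintegralD// RintegralB// !RintegralZl// mulrC.
  apply: Rintegral_ge0 => x _.
  have [F0|F0] := leP 0 (F x); last first.
    rewrite ltr0_norm//; have : - F x * (t + D x) ^+ 2 >= 0.
      by rewrite mulr_ge0 ?sqr_ge0// oppr_ge0 ltW.
    by move=> h; rewrite (le_trans h)// le_eqVlt; apply/orP; left; apply/eqP; ring.
  rewrite ger0_norm//.
  have : F x * (t - D x) ^+ 2 >= 0 by rewrite mulr_ge0 ?sqr_ge0.
  by move=> h; rewrite (le_trans h)// le_eqVlt; apply/orP; left; apply/eqP; ring.
have A0 : 0 <= A by apply: Rintegral_ge0.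
have B0 : 0 <= B by apply: Rintegral_ge0 => x _; rewrite mulr_ge0 ?sqr_ge0.
move: A0; rewrite le_eqVlt => /orP[/eqP A0|A0].
  rewrite -A0 mul0r; have [->|M0] := eqVneq M 0; first by rewrite expr0n.
  have := q ((B + 1) / (2 * M)); rewrite -A0 mul0r.
  have -> : 2 * ((B + 1) / (2 * M)) * M = B + 1 by field.
  by move=> h; exfalso; move: h; rewrite leNgt => /negP; apply; lra.
have := q (M / A).
have -> : A * (M / A) ^+ 2 - 2 * (M / A) * M + B = (A * B - M ^+ 2) / A.
  by field; exact: lt0r_neq0.
by rewrite pmulr_lge0 ?invr_gt0// subr_ge0.
Qed.

End square_integrable.

Section L2_complete.
Context d (T : measurableType d) (R : realType).
Variable mu : {measure set T -> \bar R}.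

(** Riesz-Fischer for a sequence with geometrically small increments.  The
    function S = \sum_k 4 ^+ k * (f_ k.+1 - f_ k) ^+ 2 is integrable, hence
    finite almost everywhere; where it is, the increments are at most
    sqrt S * 2 ^- k, so f_ converges pointwise, and 4 * S dominates every
    (f - f_ k) ^+ 2. *)
Lemma sqint_complete (f_ : nat -> T -> R) : (forall k, sqint mu (f_ k)) ->
  (forall k, msq mu (fun x => f_ k.+1 x - f_ k x) <= 8^-1 ^+ k) ->
  exists2 f, sqint mu f & msq mu (fun x => f x - f_ k x) @[k --> \oo] --> 0.
Proof.
move=> sf df.
pose dl k x := f_ k.+1 x - f_ k x.
pose u k x : \bar R := (4 ^+ k * dl k x ^+ 2)%:E.
have sdl k : sqint mu (dl k) by exact: sqintB.
have u0 k x : (0 <= u k x)%E by rewrite lee_fin mulr_ge0 ?sqr_ge0// exprn_ge0.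
have mu_ k : measurable_fun setT (u k).
  apply/measurable_EFinP/measurable_funM => //; apply: measurable_funX.
  by case: (sdl k).
pose S x := (\sum_(0 <= k <oo) u k x)%E.
have S0 x : (0 <= S x)%E by apply: nneseries_ge0.
have mS : measurable_fun setT S.
  by apply: ge0_emeasurable_sum => // k x _ _; exact: u0.
have iu k : (\int[mu]_x u k x <= (2^-1 ^+ k)%:E)%E.
  under eq_integral do rewrite /u EFinM.
  rewrite integralZl//; last by case: (sdl k).
  rewrite -msqE// -EFinM lee_fin.
  rewrite (@le_trans _ _ (4 ^+ k * 8^-1 ^+ k))//.
    by rewrite ler_wpM2l ?exprn_ge0//; exact: df.
  by rewrite -exprMn (_ : 4 * 8^-1 = 2^-1 :> R)//; lra.
have half0 : 2^-1 ^+ k @[k --> \oo] --> (0 : R).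
  have := @cvg_geometric R 1 2^-1; rewrite /geometric/=.
  under eq_fun do rewrite mul1r.
  by apply; rewrite ger0_norm// invf_lt1// ltr1n.
have iS : (\int[mu]_x S x < +oo)%E.
  rewrite /S integral_nneseries//.
  apply: (@le_lt_trans _ _ (\sum_(0 <= k <oo) (2 / (2 ^ (k + 1))%:R)%:E)%E).
    apply: lee_nneseries => [k _ _|k _]; first exact: integral_ge0.
    apply: (le_trans (iu k)); rewrite lee_fin addn1 natrX exprS invfM mulrA.
    by rewrite divff// mul1r exprVn.
  have /cvg_lim := @cvg_geometric_eseries_half R 2 0.
  by rewrite /eseries/= => ->//; rewrite ltry.
have intS : mu.-integrable setT S.
  by apply/integrableP; split=> //; under eq_integral do rewrite gee0_abs//.
have Sfin : {ae mu, forall x, S x \is a fin_num}.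
  by have := integrable_ae measurableT intS; apply: filterS => x; exact.
have dlb x k : S x \is a fin_num ->
    `|dl k x| <= Num.sqrt (fine (S x)) * 2^-1 ^+ k.
  move=> Sx; have uS : 4 ^+ k * dl k x ^+ 2 <= fine (S x).
    rewrite -lee_fin fineK//; apply: le_trans (nneseries_lim_ge k.+1 _) => //.
    by rewrite big_nat_recr//= leeDr// sume_ge0.
  have -> : `|dl k x| = Num.sqrt (4 ^+ k * dl k x ^+ 2) * 2^-1 ^+ k.
    rewrite sqrtrM ?exprn_ge0// sqrtr_sqr (_ : 4 = 2 ^+ 2)//; last first.
      by rewrite -natrX.
    rewrite exprAC sqrtr_sqr [`|2 ^+ _|]ger0_norm ?exprn_ge0// mulrAC -exprMn divff//.
    by rewrite expr1n mul1r.
  by rewrite ler_wpM2r ?exprn_ge0// ler_sqrt// fine_ge0.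
have fb x n p : S x \is a fin_num ->
    `|f_ (n + p)%N x - f_ n x| <= Num.sqrt (fine (S x)) * (2 * 2^-1 ^+ n).
  move=> Sx; rewrite (@le_trans _ _ (Num.sqrt (fine (S x)) *
      (2 * (2^-1 ^+ n - 2^-1 ^+ (n + p))))) //.
    elim: p => [|p ih]; first by rewrite addn0 !subrr normr0 !mulr0.
    rewrite addnS (_ : _ - _ = dl (n + p)%N x + (f_ (n + p)%N x - f_ n x)).
      rewrite (le_trans (ler_normD _ _))//.
      rewrite (le_trans (lerD (dlb x (n + p)%N Sx) ih))//.
      by rewrite -mulrDr ler_wpM2l ?sqrtr_ge0// exprS; lra.
    by rewrite /dl addrA subrK.
  by rewrite ler_wpM2l ?sqrtr_ge0// ler_wpM2l// lerBlDr lerDl exprn_ge0.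
have fcvg x : S x \is a fin_num -> cvgn (f_^~ x).
  move=> Sx; apply/cauchy_cvgP; apply/cauchy_exP => e e0.
  have : Num.sqrt (fine (S x)) * (2 * 2^-1 ^+ n) @[n --> \oo] --> (0 : R).
    rewrite -[X in _ --> X](mulr0 (Num.sqrt (fine (S x)))).
    apply: cvgM; first exact: cvg_cst.
    by rewrite -[X in _ --> X](mulr0 2); apply: cvgM => //; exact: cvg_cst.
  move=> /cvgrPdist_lt /(_ _ e0) [n _ /(_ n (leqnn n))].
  rewrite sub0r normrN => /(le_lt_trans (ler_norm _)) hn.
  exists (f_ n x); exists n => // m /= nm.
  rewrite -ball_normE/= distrC (le_lt_trans _ hn)//.
  by rewrite -(subnKC nm); exact: fb.
pose f x : R := if S x \is a fin_num then limn (f_^~ x) else 0.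
pose g_ k x : R := if S x \is a fin_num then f_ k x else 0.
have mfin : measurable_fun setT (fun x => S x \is a fin_num).
  apply: (measurable_fun_bool true); rewrite setTI.
  have := emeasurable_fin_num measurableT mS; rewrite setTI.
  by congr measurable; apply/seteqP; split.
have mg k : measurable_fun setT (g_ k).
  by apply: measurable_fun_ifT => //; case: (sf k).
have gf x : g_ k x @[k --> \oo] --> f x.
  by rewrite /g_ /f; case: ifPn => Sx; [exact: fcvg|exact: cvg_cst].
have mf : measurable_fun setT f.
  by apply: (measurable_fun_cvg mg) => x _; exact: gf.
have ffb x n : S x \is a fin_num -> (f x - f_ n x) ^+ 2 <= 4 * fine (S x).
  move=> Sx; have : `|f x - f_ n x| <= Num.sqrt (fine (S x)) * 2.
    have cf : `|g_ m x - f_ n x| @[m --> \oo] --> `|f x - f_ n x|.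
      by apply: cvg_norm; apply: cvgB (gf x) (cvg_cst _).
    rewrite -(cvg_lim _ cf)//; apply: limr_le; first by apply/cvg_ex; eexists; exact: cf.
    exists n => // m /= nm; rewrite /g_ Sx -(subnKC nm) (le_trans (fb _ _ _ Sx))//.
    by rewrite ler_wpM2l ?sqrtr_ge0// ler_piMr// exprn_ile1// invf_le1// ler1n.
  move=> h; rewrite -[leLHS]real_normK ?num_real//.
  rewrite (le_trans (lerXn2r 2 _ _ h)) ?nnegrE ?mulr_ge0 ?sqrtr_ge0//.
  by rewrite exprMn sqr_sqrtr ?fine_ge0// mulrC -natrX.
have ffS n x : (`|(f x - f_ n x) ^+ 2|%:E <= 4%:E * S x)%E.
  rewrite ger0_norm ?sqr_ge0//.
  have [Sx|Sx] := boolP (S x \is a fin_num).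
    by rewrite -(fineK Sx) -EFinM lee_fin; exact: ffb.
  suff -> : S x = +oo%E by rewrite gt0_muley ?lte_fin// leey.
  by move: Sx (S0 x); case: (S x).
have i4S : mu.-integrable setT (fun x => 4%:E * S x)%E by exact: integrableZl.
have mff n : measurable_fun setT (fun x => (f x - f_ n x) ^+ 2).
  by apply/measurable_funX/measurable_funB => //; case: (sf n).
have sff n : sqint mu (fun x => f x - f_ n x).
  split; first by apply: measurable_funB => //; case: (sf n).
  apply: le_integrable i4S => //; first exact/measurable_EFinP.
  by move=> x _ /=; rewrite (le_trans (ffS n x))// lee_abs.
exists f.
  have := sqintD (sff 0%N) (sf 0%N).
  by under [X in sqint _ X -> _]eq_fun do rewrite subrK.
have ae0 : {ae mu, forall x, setT x ->
    (f x - f_ n x) ^+ 2 @[n --> \oo] --> (cst 0 x : R)}.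
  apply: filterS Sfin => x Sx _ /=.
  have c : f x - g_ n x @[n --> \oo] --> f x - f x.
    by apply: cvgB; [exact: cvg_cst|exact: gf].
  have := cvg_comp _ _ c (@exprn_continuous R 2 (f x - f x)).
  by rewrite subrr expr0n /= /g_ Sx; exact.
have [_] := cvg_Rintegral_dominated measurableT mff
  (measurable_cst _) ae0 i4S (fun n x _ => ffS n x).
by rewrite [X in _ --> X](_ : _ = 0)// /Rintegral integral0.
Qed.

End L2_complete.

Section msq_extra.
Context d (T : measurableType d) (R : realType).
Variable mu : {measure set T -> \bar R}.
Implicit Types f g : T -> R.

Lemma msqD_le f g : sqint mu f -> sqint mu g ->
  msq mu (fun x => f x + g x) <= 2 * msq mu f + 2 * msq mu g.
Proof.
move=> sf sg; have [[_ fi] [_ gi]] := (sf, sg).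
have h1 : mu.-integrable setT (EFin \o (fun x => 2 * f x ^+ 2)).
  exact: (integrable_scale 2 fi).
have h2 : mu.-integrable setT (EFin \o (fun x => 2 * g x ^+ 2)).
  exact: (integrable_scale 2 gi).
rewrite /msq -!RintegralZl// -RintegralD//; apply: le_Rintegral => //.
- by case: (sqintD sf sg).
- exact: (integrable_add h1 h2).
by move=> x _; have := sqr_ge0 (f x - g x); nra.
Qed.

Lemma cvg_msqD0 (f_ g_ : nat -> T -> R) :
  (forall k, sqint mu (f_ k)) -> (forall k, sqint mu (g_ k)) ->
  msq mu (f_ k) @[k --> \oo] --> 0 -> msq mu (g_ k) @[k --> \oo] --> 0 ->
  msq mu (fun x => f_ k x + g_ k x) @[k --> \oo] --> 0.
Proof.
move=> sf sg cf cg.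
apply: (@squeeze_cvgr _ _ _ _ (cst 0)
  (fun k => 2 * msq mu (f_ k) + 2 * msq mu (g_ k))).
- by apply: nearW => k; rewrite msq_ge0 msqD_le.
- exact: cvg_cst.
rewrite [X in _ --> X](_ : 0 = 2 * 0 + 2 * 0); last by rewrite mulr0 addr0.
by apply: cvgD; apply: cvgM => //; exact: cvg_cst.
Qed.

Lemma msq_cvg0P (f_ : nat -> T -> R) : (forall k, sqint mu (f_ k)) ->
  (\int[mu]_x (f_ k x ^+ 2)%:E)%E @[k --> \oo] --> 0%E <->
  msq mu (f_ k) @[k --> \oo] --> 0.
Proof.
move=> sf; split=> [h|h].
  exact: (fine_cvg h).
rewrite (_ : (fun k => _) = fun k => (msq mu (f_ k))%:E).
  by apply/fine_cvgP; split; [exact: nearW|exact: h].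
by apply/funext => k; rewrite msqE.
Qed.

End msq_extra.

Lemma sqint_integrable d (T : measurableType d) (R : realType)
    (P : probability T R) (f : T -> R) :
  sqint P f -> P.-integrable setT (EFin \o f).
Proof.
move=> sf; have s1 : sqint P (cst 1).
  split=> //; under eq_fun do rewrite expr1n.
  exact: finite_measure_integrable_cst.
have := sqint_mul sf s1.
by apply: eq_integrable => // x _; rewrite /= mulr1.
Qed.

(** * Centred Gaussian laws through their cosine moments *)

Section gaussian_laws.
Context (R : realType).
Local Notation leb := (@lebesgue_measure R).
Local Notation N01 := (@normal_prob R 0 1).

Lemma integral_transport d d' (X : measurableType d) (Y : measurableType d')
    (mu : {measure set X -> \bar R}) (nu : {measure set Y -> \bar R})
    (p : X -> Y) (f : Y -> \bar R) : measurable_fun setT p ->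
  (forall A, measurable A -> nu A = mu (p @^-1` A)) ->
  measurable_fun setT f ->
  (\int[nu]_y f y = \int[mu]_x f (p x))%E.
Proof.
move=> mp nuE mf.
have ge0 (h : Y -> \bar R) : measurable_fun setT h -> (forall y, 0 <= h y)%E ->
    (\int[nu]_y h y = \int[mu]_x h (p x))%E.
  move=> mh h0; rewrite (@ge0_integral_transport _ _ _ _ _ mu nu p (cst 1))//.
    by apply: eq_integral => x _; rewrite mule1.
  move=> A mA; rewrite (@eq_integral _ _ _ _ _ (cst 1%E))// integral_cst//.
    by rewrite mul1e nuE.
  by rewrite -[X in measurable X]setTI; exact: mp.
rewrite [LHS]integralE [RHS]integralE.
have hp : (\int[nu]_y f^\+ y = \int[mu]_x (fun x => f (p x))^\+ x)%E.
  rewrite (ge0 _ (measurable_funepos mf) (fun y => funepos_ge0 f y)).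
  by apply: eq_integral => x _; rewrite !funeposE.
have hn : (\int[nu]_y f^\- y = \int[mu]_x (fun x => f (p x))^\- x)%E.
  rewrite (ge0 _ (measurable_funeneg mf) (fun y => funeneg_ge0 f y)).
  by apply: eq_integral => x _; rewrite !funenegE.
by rewrite hp hn.
Qed.

Lemma integral_normal_prob (m s : R) (f : R -> \bar R) :
  measurable_fun setT f -> (forall x, 0 <= f x)%E ->
  (\int[normal_prob m s]_x f x = \int[leb]_x (f x * (normal_pdf m s x)%:E))%E.
Proof.
move=> mf f0.
apply: (@ge0_integral_transport _ _ _ _ _ leb (normal_prob m s) id) => //.
- exact: measurable_normal_pdf.
- by move=> x; exact: normal_pdf_ge0.
Qed.

Lemma normal_pdf_affine (m s x : R) : s != 0 ->
  normal_pdf m s (s * x + m) * `|s| = normal_pdf 0 1 x.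
Proof.
move=> s0; rewrite !normal_pdfE ?oner_eq0// /normal_fun addrK subr0.
rewrite /normal_peak expr1n mul1r.
have -> : - (s * x) ^+ 2 / (s ^+ 2 *+ 2) = - x ^+ 2 / (1 *+ 2) :> R.
  by rewrite -mulr_natr; field.
rewrite mulrAC; congr (_ * _).
rewrite -mulrnAr sqrtrM ?sqr_ge0// sqrtr_sqr invfM.
by rewrite mulrAC mulVf ?mul1r// normr_eq0.
Qed.

Lemma normal_prob_affine (m s : R) (A : set R) : s != 0 -> measurable A ->
  normal_prob m s A = N01 ((fun x => s * x + m) @^-1` A).
Proof.
move=> s0 mA; have ms : measurable_fun setT (fun x : R => s * x + m).
  by apply: measurable_funD => //; exact: measurable_funM.
transitivity (\int[normal_prob m s]_x (\1_A x)%:E)%E.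
  by rewrite integral_indic// setIT.
rewrite integral_normal_prob//; last by apply/measurable_EFinP.
rewrite (ge0_integral_affine m s0)//; last 2 first.
- apply: emeasurable_funM; apply/measurable_EFinP => //.
  exact: measurable_normal_pdf.
- by move=> x; rewrite mule_ge0 ?lee_fin// normal_pdf_ge0.
have mA' : measurable ((fun x => s * x + m) @^-1` A).
  by rewrite -[X in measurable X]setTI; exact: ms.
transitivity (\int[N01]_x (\1_((fun x => s * x + m) @^-1` A) x)%:E)%E;
  last by rewrite integral_indic// setIT.
rewrite integral_normal_prob//; last by apply/measurable_EFinP.
apply: eq_integral => x _; rewrite -muleA -EFinM normal_pdf_affine//.
Qed.

(** Writing the law as an affine image of the standard normal law treats the
    degenerate case s = 0 and the other ones alike. *)
Lemma gaussian_rv_law d (T : measurableType d) (P : probability T R)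
    (X : T -> R) : gaussian_rv P X -> exists m s : R,
  forall f : R -> \bar R, measurable_fun setT f ->
    (\int[P]_w f (X w) = \int[N01]_x f (s * x + m)%R)%E.
Proof.
move=> [mX [m [s Xlaw]]]; exists m, s => f mf.
have ms : measurable_fun setT (fun x : R => s * x + m).
  by apply: measurable_funD => //; exact: measurable_funM.
have [s0|s0] := eqVneq s 0.
  rewrite s0 in Xlaw *; rewrite eqxx in Xlaw.
  transitivity (\int[\d_m]_y f y)%E.
    by symmetry; apply: (integral_transport mX) => // A mA; exact/esym/Xlaw.
  rewrite integral_dirac// diracT mul1e.
  under eq_integral do rewrite mul0r add0r.
  have /= -> := integral_cst N01 measurableT (f m).
  by rewrite [X in (_ * X)%E]probability_setT mule1.
rewrite (negbTE s0) in Xlaw.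
transitivity (\int[normal_prob m s]_y f y)%E.
  by symmetry; apply: (@integral_transport _ _ _ _ P (normal_prob m s) X f mX)
    => // A mA; exact/esym/Xlaw.
apply: (@integral_transport _ _ _ _ N01 (normal_prob m s) _ f ms) => // A mA.
exact: normal_prob_affine.
Qed.

(** The normal density depends on the deviation through its square only, so
    that the deviations 1 and -1 give the same law; the affine change of
    variables from one to the other is the reflection. *)
Lemma N01_even (f : R -> \bar R) : measurable_fun setT f ->
  (\int[N01]_x f (- x)%R = \int[N01]_x f x)%E.
Proof.
move=> mf; symmetry; apply: integral_transport => // A mA.
have E : @normal_prob R 0 1 = normal_prob 0 (-1).
  apply/funext => B; rewrite /normal_prob; apply: eq_integral => x _.
  rewrite !normal_pdfE ?oppr_eq0 ?oner_eq0//.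
  by rewrite /normal_peak /normal_fun sqrrN.
transitivity (normal_prob 0 (-1) A); first by rewrite -E.
rewrite normal_prob_affine ?oppr_eq0 ?oner_eq0//.
by congr (normal_prob _ _ _); apply/seteqP; split=> x /=; rewrite mulN1r addr0.
Qed.

(** As x ^+ 2 <= 4 * exp (x ^+ 2 / 4), the function x ^+ 2 * normal_pdf 0 1 x
    is at most a multiple of the density of variance 2. *)
Lemma sqint_N01 : sqint N01 id.
Proof.
apply: sqintP => //; rewrite integral_normal_prob//; last 2 first.
- by apply/measurable_EFinP; exact: measurable_funX.
- by move=> x; rewrite lee_fin sqr_ge0.
pose s : R := Num.sqrt 2; pose K := 4 * normal_peak (1 : R) / normal_peak s.
have s0 : s != 0 by rewrite gt_eqF// sqrtr_gt0.
have K0 : 0 <= K.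
  by rewrite /K mulr_ge0 ?invr_ge0 ?mulr_ge0 ?normal_peak_ge0.
apply: (@le_lt_trans _ _ (\int[leb]_x (K%:E * (normal_pdf 0 s x)%:E))%E).
  apply: ge0_le_integral => //.
  - by move=> x _; rewrite mule_ge0 ?lee_fin ?sqr_ge0 ?normal_pdf_ge0.
  - apply: emeasurable_funM; apply/measurable_EFinP.
      exact: measurable_funX.
    exact: measurable_normal_pdf.
  - apply: emeasurable_funM => //; apply/measurable_EFinP.
    exact: measurable_normal_pdf.
  move=> x _; rewrite -!EFinM lee_fin !normal_pdfE ?oner_eq0// /K [leRHS]mulrA.
  rewrite divfK ?gt_eqF ?normal_peak_gt0//.
  rewrite mulrCA [leRHS]mulrAC [leRHS]mulrC ler_wpM2l ?normal_peak_ge0//.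
  rewrite /normal_fun subr0 expr1n sqr_sqrtr//.
  have -> : - x ^+ 2 / (1 *+ 2) = - (x ^+ 2 / 4) + - x ^+ 2 / (2 *+ 2) by field.
  rewrite expRD mulrA ler_wpM2r ?expR_ge0//.
  rewrite expRN ler_pdivrMr ?expR_gt0//.
  have := expR_ge1Dx (x ^+ 2 / 4); lra.
rewrite ge0_integralZl//; last 2 first.
- by apply/measurable_EFinP; exact: measurable_normal_pdf.
- by move=> x _; rewrite lee_fin normal_pdf_ge0.
by rewrite integral_normal_pdf mule1 ltry.
Qed.

Lemma N01_mean : (\int[N01]_x x%:E = 0)%E.
Proof.
have i1 := sqint_integrable sqint_N01.
have mE : measurable_fun [set: R] EFin by exact/measurable_EFinP.
have h := N01_even mE.
move: h; under eq_integral do rewrite EFinN.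
rewrite integralN; last exact: integrable_add_def.
rewrite -(fineK (integrable_fin_num _ i1))// -EFinN => -[] h.
by congr EFin; lra.
Qed.

(** If the second moment vanished, the density itself would vanish almost
    everywhere, against its total mass 1. *)
Lemma N01_var_gt0 : 0 < msq N01 (@idfun R).
Proof.
rewrite lt_neqAle msq_ge0 andbT eq_sym; apply/negP => /eqP k0.
have := msqE sqint_N01; rewrite k0 => h.
have := integral_normal_pdf (0:R) 1.
suff -> : (\int[leb]_x (normal_pdf 0 1 x)%:E = 0)%E
  by case=> /eqP; rewrite eq_sym oner_eq0.
move: h; rewrite integral_normal_prob//; last 2 first.
- by apply/measurable_EFinP; exact: measurable_funX.
- by move=> x; rewrite lee_fin sqr_ge0.
move=> h.
have mp : measurable_fun setT (fun x : R => (normal_pdf 0 1 x)%:E).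
  by apply/measurable_EFinP; exact: measurable_normal_pdf.
have mxp : measurable_fun setT
    (fun x : R => (x ^+ 2)%:E * (normal_pdf 0 1 x)%:E)%E.
  by apply: emeasurable_funM => //; apply/measurable_EFinP; exact: measurable_funX.
have /(ae_eq_integral_abs leb measurableT mxp) ae0 :
    (\int[leb]_x `|(x ^+ 2)%:E * (normal_pdf 0 1 x)%:E| = 0)%E.
  apply: (etrans _ (esym h)); apply: eq_integral => x _; rewrite gee0_abs//.
  by rewrite mule_ge0 ?lee_fin ?sqr_ge0 ?normal_pdf_ge0.
rewrite -(@integral_setD1 _ _ 0)//; last exact: measurable_funTS.
rewrite (@ge0_ae_eq_integral _ _ _ leb _ _ (cst 0%E))//.
- by rewrite integral0.
- exact: measurableD.
- exact: measurable_funTS.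
- by move=> x _; rewrite lee_fin normal_pdf_ge0.
apply: filterS ae0 => x /(_ I) /eqP; rewrite mule_eq0 => /orP[|/eqP//].
by rewrite eqe sqrf_eq0 => /eqP -> [_ /(_ erefl)].
exact: measurableD.
Qed.

End gaussian_laws.

Section trigo_extra.
Context (R : realType).

Lemma cos_lipschitz (x y : R) : `|cos x - cos y| <= `|x - y|.
Proof.
wlog xy : x y / y <= x.
  move=> h; have [|/ltW xy] := leP y x; first exact: h.
  by rewrite distrC [leRHS]distrC; exact: h.
have [c _ ->] := @MVT_segment R cos (fun z => - sin z) y x xy
  (fun z _ => is_derive_cos z)
  (continuous_subspaceT (@continuous_cos R)).
by rewrite normrM normrN ler_piMl// sin_max.
Qed.

Lemma measurable_cos : measurable_fun setT (@cos R).
Proof. by apply: continuous_measurable_fun; exact: continuous_cos. Qed.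

Lemma measurable_sin : measurable_fun setT (@sin R).
Proof. by apply: continuous_measurable_fun; exact: continuous_sin. Qed.

End trigo_extra.

Section gausslike.
Context (R : realType).
Local Notation N01 := (@normal_prob R 0 1).

(** The value of E cos (X + b) for a centred Gaussian X of variance v: the
    quotient v / msq N01 id is the square of the factor that gives a standard
    variable the variance v. *)
Definition gauss_cos (b v : R) : R :=
  \int[N01]_x cos (Num.sqrt (v / msq N01 id) * x + b).

(** The trace of being centred Gaussian on which the whole argument runs.  The
    shifts b = 0 and b = - pi / 2 give the real and imaginary parts of the
    characteristic function at 1, and the condition survives mean-square
    limits. *)
Definition gausslike d (T : measurableType d) (P : probability T R)
  (X : T -> R) := sqint P X /\
  forall b, \int[P]_w cos (X w + b) = gauss_cos b (msq P X).

Let mcosa (a b : R) : measurable_fun setT (fun x : R => cos (a * x + b)).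
Proof.
apply: (measurableT_comp (@measurable_cos R)).
by apply: measurable_funD => //; exact: measurable_funM.
Qed.

Lemma integrable_bounded d (T : measurableType d) (P : probability T R)
  (f : T -> R) (M : R) : measurable_fun setT f -> (forall x, `|f x| <= M) ->
  P.-integrable setT (fun x => (f x)%:E).
Proof.
move=> mf fM; apply: (le_integrable measurableT _ _
  (finite_measure_integrable_cst P M measurableT)) => //; first exact/measurable_EFinP.
by move=> x _ /=; rewrite lee_fin (le_trans (fM x))// ler_norm.
Qed.

Lemma Rintegral_prob_cst d (T : measurableType d) (P : probability T R)
  (c : R) : \int[P]_w c = c.
Proof.
have /= h := integral_cst P measurableT c%:E.
by rewrite /Rintegral h [X in (_ * X)%E]probability_setT mule1.
Qed.

Lemma gauss_cos_cvg (b v : R) (v_ : nat -> R) :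
  v_ k @[k --> \oo] --> v -> gauss_cos b (v_ k) @[k --> \oo] --> gauss_cos b v.
Proof.
move=> cv.
have [] := @cvg_Rintegral_dominated _ _ _ N01 setT
  (fun k x => cos (Num.sqrt (v_ k / msq N01 id) * x + b))
  (fun x => cos (Num.sqrt (v / msq N01 id) * x + b)) (cst 1%E) measurableT
  (fun k => mcosa _ _) (mcosa _ _) _
  (finite_measure_integrable_cst N01 1 measurableT) _ => //.
  apply: aeW => x _; apply: continuous_cvg; first exact: continuous_cos.
  apply: cvgD; last exact: cvg_cst.
  apply: cvgM; last exact: cvg_cst.
  apply: continuous_cvg; first exact: sqrt_continuous.
  by apply: cvgM => //; exact: cvg_cst.
by move=> k x _ /=; rewrite lee_fin cos_max.
Qed.

Lemma gaussian_rv_gausslike d (T : measurableType d) (P : probability T R)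
    (X : T -> R) :
  gaussian_rv P X -> expectation P X = 0%E -> gausslike P X.
Proof.
move=> gX; have [mX _] := gX; have [m [s Xlaw]] := gaussian_rv_law gX.
have ms : measurable_fun setT (fun x : R => s * x + m).
  by apply: measurable_funD => //; exact: measurable_funM.
have kE := msqE (@sqint_N01 R); set k := msq N01 id in kE.
have k0 : 0 < k := @N01_var_gt0 R.
have iN := sqint_integrable (@sqint_N01 R).
have isN : N01.-integrable setT (EFin \o (fun x : R => s * x)).
  exact: (integrable_scale s iN).
have icst (c : R) : N01.-integrable setT (EFin \o cst c).
  exact: finite_measure_integrable_cst.
have hm : (\int[N01]_x (s * x + m)%:E = m%:E)%E.
  under eq_integral do rewrite EFinD.
  rewrite (integralD measurableT isN (icst m)) /=.
  rewrite [X in (X + _)%E](_ : _ = 0%E); last first.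
    under eq_integral do rewrite EFinM.
    by rewrite integralZl// N01_mean mule0.
  have /= -> := integral_cst N01 measurableT m%:E.
  by rewrite [X in (_ + _ * X)%E]probability_setT mule1 add0e.
rewrite unlock Xlaw; last by exact/measurable_EFinP.
rewrite hm => -[m0].
have E2 : (\int[P]_w (X w ^+ 2)%:E = (s ^+ 2 * k)%:E)%E.
  rewrite (Xlaw (fun x => (x ^+ 2)%:E)); last first.
    by apply/measurable_EFinP; exact: measurable_funX.
  transitivity (\int[N01]_x ((s ^+ 2)%:E * (x ^+ 2)%:E))%E.
    by apply: eq_integral => x _; rewrite m0 addr0 exprMn EFinM.
  rewrite integralZl//; first by rewrite -kE EFinM.
  by case: (@sqint_N01 R).
have sX : sqint P X by apply: sqintP => //; rewrite E2 ltry.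
split=> // b; have -> : msq P X = s ^+ 2 * k.
  by have := msqE sX; rewrite E2 => -[].
rewrite /gauss_cos -/k mulfK ?gt_eqF// sqrtr_sqr.
have -> : \int[P]_w cos (X w + b) = \int[N01]_x cos (s * x + b).
  rewrite /Rintegral (Xlaw (fun x => (cos (x + b))%:E)) ?m0; last first.
    apply/measurable_EFinP; apply: (measurableT_comp (@measurable_cos R)).
    exact: measurable_funD.
  by apply: f_equal; apply: eq_integral => x _; rewrite addr0.
have [s0|s0] := ger0P s; first by [].
rewrite /Rintegral -N01_even; last by apply/measurable_EFinP; exact: mcosa.
by apply: f_equal; apply: eq_integral => x _; rewrite mulrN mulNr.
Qed.

(** The cosine is 1-Lipschitz, so E cos (X_ k + b) converges to E cos (X + b);
    it also converges to the Gaussian value for the limit of the variances. *)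
Lemma gausslike_lim d (T : measurableType d) (P : probability T R)
    (X : T -> R) (X_ : nat -> T -> R) :
  (forall k, gausslike P (X_ k)) -> sqint P X ->
  msq P (fun w => X w - X_ k w) @[k --> \oo] --> 0 -> gausslike P X.
Proof.
move=> gX sX cX; split=> // b.
have sX_ k : sqint P (X_ k) by case: (gX k).
have mc (Y : T -> R) : measurable_fun setT Y ->
    measurable_fun setT (fun w => cos (Y w + b)).
  move=> mY; apply: (measurableT_comp (@measurable_cos R)).
  exact: measurable_funD.
have ic (Y : T -> R) : measurable_fun setT Y ->
    P.-integrable setT (EFin \o (fun w => cos (Y w + b))).
  move=> mY; apply: (@integrable_bounded _ _ P _ 1); first exact: mc.
  by move=> x; exact: cos_max.
have bnd k : (\int[P]_w cos (X w + b) - \int[P]_w cos (X_ k w + b)) ^+ 2 <=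
    msq P (fun w => X w - X_ k w).
  have [[mX _] [mXk _]] := (sX, sX_ k).
  rewrite -RintegralB//; [|exact: ic..].
  have mD : measurable_fun setT (fun w => cos (X w + b) - cos (X_ k w + b)).
    by apply: measurable_funB; exact: mc.
  have i1 : P.-integrable setT (fun x => (cst 1 x)%:E : \bar R).
    exact: finite_measure_integrable_cst.
  have hb w : (cos (X w + b) - cos (X_ k w + b)) ^+ 2 <= (X w - X_ k w) ^+ 2.
    rewrite -[leLHS]real_normK ?num_real// -[leRHS]real_normK ?num_real//.
    rewrite lerXn2r ?nnegrE//.
    rewrite (le_trans (cos_lipschitz _ _))// opprD addrACA subrr addr0//.
  have i2 : P.-integrable setT (fun w =>
      (`|cst 1 w| * (cos (X w + b) - cos (X_ k w + b)) ^+ 2)%:E).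
    have [_] := sqintB sX (sX_ k); apply: le_integrable => //.
      apply/measurable_EFinP; apply: measurable_funM.
        exact: measurableT_comp.
      exact: measurable_funX.
    by move=> w _ /=; rewrite normr1 mul1r lee_fin !ger0_norm ?sqr_ge0.
  have [_] := Rintegral_weighted_sqr mD i1 i2.
  under eq_Rintegral do rewrite mul1r.
  move/le_trans; apply.
  under [X in X * _ <= _]eq_Rintegral do rewrite normr1.
  under [X in _ * X <= _]eq_Rintegral do rewrite normr1 mul1r.
  rewrite Rintegral_prob_cst mul1r.
  apply: le_Rintegral => //.
  - move: i2; apply: eq_integrable => // w _ /=; by rewrite normr1 mul1r.
  - by case: (sqintB sX (sX_ k)).
have c1 : \int[P]_w cos (X_ k w + b) @[k --> \oo] --> \int[P]_w cos (X w + b).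
  apply/cvgrPdist_lt => e e0.
  move/cvgrPdist_lt : cX => /(_ (e ^+ 2) (exprn_gt0 _ e0)).
  apply: filterS => k; rewrite sub0r normrN => h.
  rewrite -(@ltr_pXn2r _ 2)// ?nnegrE ?ltW// real_normK ?num_real//.
  by rewrite (le_lt_trans (bnd k))// (le_lt_trans (ler_norm _)).
have c2 : \int[P]_w cos (X_ k w + b) @[k --> \oo] --> gauss_cos b (msq P X).
  rewrite (_ : (fun k => _) = fun k => gauss_cos b (msq P (X_ k))).
    exact: gauss_cos_cvg (msq_cvg sX sX_ cX).
  by apply/funext => k; exact: (proj2 (gX k)).
by rewrite -(cvg_lim _ c1)// -(cvg_lim _ c2).
Qed.

End gausslike.

(** * Approximation by trigonometric polynomials *)

Section trig_polynomials.
Context (R : realType) (m : nat).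
Implicit Types (x y : 'rV[R]_m) (G : 'rV[R]_m -> R).

Inductive trig : ('rV[R]_m -> R) -> Prop :=
| trig_cos a c b : trig (fun x => a * cos (\sum_i c i * x ord0 i + b))
| trig_add f g : trig f -> trig g -> trig (fun x => f x + g x).

Lemma trig_cst (a : R) : trig (cst a).
Proof.
rewrite (_ : cst a = fun x => a * cos (\sum_(i < m) 0 * x ord0 i + 0)).
  exact: (@trig_cos a (fun=> 0) 0).
apply/funext => x; rewrite big1 => [|i _]; last by rewrite mul0r.
by rewrite addr0 cos0 mulr1.
Qed.

(** Product-to-sum formula; a product of shifted cosines is again a sum of
    shifted cosines. *)
Lemma trig_mul f g : trig f -> trig g -> trig (fun x => f x * g x).
Proof.
move=> tf tg; elim: tf => [a c b|f1 f2 _ h1 _ h2]; last first.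
  by under eq_fun do rewrite mulrDl; exact: trig_add.
elim: tg => [a' c' b'|f1 f2 _ h1 _ h2]; last first.
  by under eq_fun do rewrite mulrDr; exact: trig_add.
have t1 := trig_cos (a * a' / 2) (fun i => c i + c' i) (b + b').
have t2 := trig_cos (a * a' / 2) (fun i => c i - c' i) (b - b').
have := trig_add t1 t2; congr trig; apply/funext => x.
set A := \sum_(i < m) c i * x ord0 i; set B := \sum_(i < m) c' i * x ord0 i.
have -> : \sum_(i < m) (c i + c' i) * x ord0 i = A + B.
  by rewrite -big_split; apply: eq_bigr => i _; rewrite mulrDl.
have -> : \sum_(i < m) (c i - c' i) * x ord0 i = A - B.
  by rewrite -sumrB; apply: eq_bigr => i _; rewrite mulrBl.
have -> : A + B + (b + b') = (A + b) + (B + b') by ring.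
have -> : A - B + (b - b') = (A + b) - (B + b') by ring.
by rewrite cosB cosD; field.
Qed.

Section bernstein.
Variable s : 'I_m -> 'rV[R]_m -> R.

Definition incr_at (i : 'I_m) (K : 'I_m -> nat) : 'I_m -> nat :=
  fun i' => (K i' + (i' == i))%N.

(** The expectation of F (K), where the trials listed in l are independent, a
    trial at i succeeds with probability s i x, and K i counts the successes at
    i.  This is the multivariate Bernstein operator in the variables s; the
    recursion on trials avoids binomial coefficients. *)
Fixpoint binom_mean (l : seq 'I_m) (F : ('I_m -> nat) -> R) (x : 'rV[R]_m) : R :=
  if l is i :: l' then
    s i x * binom_mean l' (F \o incr_at i) x + (1 - s i x) * binom_mean l' F x
  else F (fun=> 0%N).

Lemma trig_binom_mean l F : (forall i, trig (s i)) -> trig (binom_mean l F).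
Proof.
move=> ts; elim: l F => [|i l ih] F /=; first exact: trig_cst.
apply: trig_add; first exact: trig_mul.
apply: trig_mul => //; apply: trig_add; first exact: trig_cst.
have := trig_mul (trig_cst (-1)) (ts i).
by under [X in trig X -> _]eq_fun do rewrite mulN1r.
Qed.

Lemma binom_mean_le l F F' x : (forall i, 0 <= s i x <= 1) ->
  (forall K, F K <= F' K) -> binom_mean l F x <= binom_mean l F' x.
Proof.
move=> s01; elim: l F F' => [|i l ih] F F' FF' /=; first exact: FF'.
have /andP[s0 s1] := s01 i.
by rewrite lerD// ler_wpM2l ?subr_ge0//; apply: ih => // K; exact: FF'.
Qed.

Lemma binom_mean_cst l a x : binom_mean l (fun=> a) x = a.
Proof.
elim: l => [//|i l ih] /=.
by rewrite (_ : _ \o _ = fun=> a)// ih -mulrDl addrC subrK mul1r.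
Qed.

Lemma binom_mean_lin l a b F F' x :
  binom_mean l (fun K => a * F K + b * F' K) x =
  a * binom_mean l F x + b * binom_mean l F' x.
Proof.
elim: l F F' => [//|i l ih] F F' /=.
rewrite (_ : _ \o _ = fun K => a * (F \o incr_at i) K + b * (F' \o incr_at i) K)//.
by rewrite !ih; ring.
Qed.

Lemma binom_mean_sum l (I : Type) (r : seq I) (F : I -> ('I_m -> nat) -> R) x :
  binom_mean l (fun K => \sum_(j <- r) F j K) x =
  \sum_(j <- r) binom_mean l (F j) x.
Proof.
elim: r => [|j r ih].
  by rewrite big_nil; under eq_fun do rewrite big_nil; rewrite binom_mean_cst.
rewrite big_cons -ih.
have := binom_mean_lin l 1 1 (F j) (fun K => \sum_(j <- r) F j K) x.
rewrite !mul1r => <-; congr (binom_mean l _ x); apply/funext => K.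
by rewrite big_cons !mul1r.
Qed.

(** Bias plus variance of the binomial count K i. *)
Lemma binom_mean_sqr l i a x :
  binom_mean l (fun K => ((K i)%:R - a) ^+ 2) x =
  ((count_mem i l)%:R * s i x - a) ^+ 2 +
  (count_mem i l)%:R * (s i x * (1 - s i x)).
Proof.
elim: l a => [|i' l ih] a /=; first by rewrite !mul0r addr0.
rewrite [X in binom_mean l X](_ : _ \o _ =
    fun K => ((K i)%:R - (a - (i == i')%:R)) ^+ 2); last first.
  by apply/funext => K /=; rewrite /incr_at natrD opprB addrA addrAC.
rewrite !ih natrD [i' == i]eq_sym; case: eqVneq => [->|_] /=; last first.
  by rewrite subr0 add0r; ring.
by rewrite (_ : 1%:R = 1)//; ring.
Qed.

End bernstein.
End trig_polynomials.

Section uniform_continuity.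
Context (R : realType) (m : nat).

Definition box (K : R) : set 'rV[R]_m := [set x | forall i, `|x ord0 i| <= K].

Lemma compact_box (K : R) : compact (box K).
Proof.
have := @rV_compact R m (fun=> `[- K, K]%classic) (fun=> @segment_compact _ _ _).
congr compact; apply/seteqP; split=> x /= h i.
  by have := h i; rewrite in_itv/= ler_norml.
by rewrite in_itv/= -ler_norml.
Qed.

Lemma box_unif_continuous (G : 'rV[R]_m -> R) (K e : R) :
  continuous G -> 0 < e -> exists2 dlt, 0 < dlt &
    forall x y : 'rV[R]_m, box K x -> (forall i, `|x ord0 i - y ord0 i| < dlt) ->
      `|G x - G y| < e.
Proof.
move=> cG e0.
pose Q (dlt : R) (x : 'rV[R]_m) :=
  forall y : 'rV[R]_m, (forall i, `|x ord0 i - y ord0 i| < dlt) ->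
    `|G x - G y| < e.
have H : forall x, box K x -> \forall x' \near x & dlt \near 0^'+, Q dlt x'.
  move=> x _; have e2 : 0 < e / 2 by rewrite divr_gt0.
  have /cvgrPdist_lt/(_ _ e2)/nbhs_ballP[r /= r0 rG] := cG x.
  have r2 : 0 < r / 2 by rewrite divr_gt0.
  exists (ball x (r / 2), [set dlt : R | dlt < r / 2]) => /=.
    split; first exact: nbhsx_ballx.
    exact: nbhs_right_lt.
  move=> [x' dlt] /= [xx' dr] y x'y.
  have xy : ball x r y.
    rewrite (splitr r); apply: ball_triangle xx' _; split=> // i j.
    by rewrite !ord1 -ball_normE/= (lt_trans (x'y j)).
  have xx'r : ball x r x' by apply: le_ball xx'; rewrite ler_pdivrMr// ler_pMr// ler1n.
  have := rG _ xy; have := rG _ xx'r => /= h1 h2.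
  rewrite (_ : G x' - G y = (G x - G y) - (G x - G x')); last by ring.
  by rewrite (le_lt_trans (ler_normB _ _))// (splitr e) ltrD.
have /compact_near_coveringP hcov := @compact_box K.
have [dlt /= d0 hd] := hcov _ _ Q _ H.
exists (dlt / 2); first by rewrite divr_gt0.
move=> x y Kx; apply: (hd (dlt / 2)) => //=.
  rewrite sub0r normrN gtr0_norm ?divr_gt0// ltr_pdivrMr// ltr_pMr// ltr1n//.
by rewrite divr_gt0.
Qed.

End uniform_continuity.

Section trig_approximation.
Context (R : realType) (m : nat).

(** The derivative of sin is at least cos 1 > 0 on [-1, 1], so there sin x
    determines x with a Lipschitz inverse. *)
Lemma sin_expanding (x y : R) : -1 <= x <= 1 -> -1 <= y <= 1 ->
  cos 1 * `|x - y| <= `|sin x - sin y|.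
Proof.
wlog xy : x y / y <= x.
  move=> h x1 y1; have [|/ltW xy] := leP y x; first by move=> yx; exact: h.
  by rewrite distrC [leRHS]distrC; exact: h.
move=> x1 y1.
have [c cxy ->] := @MVT_segment R sin cos y x xy
  (fun z _ => is_derive_sin z) (continuous_subspaceT (@continuous_sin R)).
rewrite normrM ler_wpM2r// (le_trans _ (ler_norm _))//.
have pi1 : (1 : R) <= pi.
  by have := pi_ge2 R; lra.
have c1 : -1 <= c <= 1.
  by move: cxy; rewrite in_itv/=; lra.
have [c0|c0] := leP 0 c.
  have [->//|] := eqVneq c 1.
  move=> cn; apply: ltW; rewrite ltr_cos ?in_itv/=; lra.
rewrite -(cosN c); have [->//|] := eqVneq (- c) 1.
move=> cn; apply: ltW; rewrite ltr_cos ?in_itv/=; lra.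
Qed.

(** Bernstein approximation of G in the variables
    s i x = (1 + sin (x i / K)) / 2.  They are trigonometric polynomials with
    values in [0, 1] on the whole space, so the approximant is a trigonometric
    polynomial bounded by M everywhere.  On the box they determine x with a
    Lipschitz inverse: frequencies close to s x belong to nodes close to x, and
    the weight of the other frequencies is controlled by Chebyshev's
    inequality. *)
Lemma trig_approx (G : 'rV[R]_m -> R) (M K e : R) : continuous G ->
  (forall x, `|G x| <= M) -> 0 < K -> 0 < e ->
  exists f : 'rV[R]_m -> R, [/\ trig f, forall x, `|f x| <= M &
    forall x, box K x -> `|G x - f x| <= e].
Proof.
move=> cG GM K0 e0.
have e2 : 0 < e / 2 by rewrite divr_gt0.
have [dlt d0 Gd] := box_unif_continuous K cG e2.
have M0 : 0 <= M by apply: le_trans (GM 0).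
pose S i (x : 'rV[R]_m) := sin (x ord0 i / K).
pose s i x := (1 + S i x) / 2.
have [del delE] : exists del, del = cos 1 * dlt / K by eexists.
have del0 : 0 < del by rewrite delE divr_gt0// mulr_gt0// cos1_gt0.
pose N := (Num.truncn (4 * M * m%:R / (del ^+ 2 * e))).+1.
have N0 : 0 < N%:R :> R by rewrite ltr0n.
have hN : 2 * M * m%:R / (del ^+ 2 * N%:R) <= e / 2.
  have : 4 * M * m%:R / (del ^+ 2 * e) <= N%:R by apply: ltW; rewrite truncnS_gt.
  have de : 0 < del ^+ 2 by rewrite exprn_gt0.
  rewrite ler_pdivrMr ?mulr_gt0// => h.
  rewrite ler_pdivrMr ?mulr_gt0//; nra.
(* The frequency J i / N estimates s i x; the node inverts s at these
   frequencies, clipped to the range of s over the box. *)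
pose clip (u : R) := Num.max (- sin 1) (Num.min u (sin 1)).
pose node (J : 'I_m -> nat) : 'rV[R]_m :=
  \row_i (K * asin (clip (2 * (J i)%:R / N%:R - 1))).
pose F J := G (node J).
pose l := flatten (nseq N (enum 'I_m)).
have lN i : count_mem i l = N.
  rewrite /l; elim: (N) => [//|n ih] /=.
  by rewrite count_cat ih count_uniq_mem ?enum_uniq// mem_enum.
have sE x i : 0 <= s i x <= 1.
  have := sin_geN1 (x ord0 i / K); have := sin_le1 (x ord0 i / K).
  by rewrite /s /S => h1 h2; apply/andP; split; lra.
exists (binom_mean s l F); split.
- apply: trig_binom_mean => i.
  have := trig_cos (2^-1) (fun i' => (i' == i)%:R / K) (- (pi / 2)).
  move/(trig_add (trig_cst m (2^-1))).
  congr trig; apply/funext => x; rewrite (bigD1 i)//= eqxx big1 => [|i' /negbTE ->].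
    rewrite addr0 /s /S -cosBpihalf mul1r [_ / K]mulrC; lra.
  by rewrite !mul0r.
- move=> x; rewrite ler_norml; apply/andP; split.
  + rewrite -(binom_mean_cst s l (- M) x); apply: binom_mean_le => // J.
    by have := GM (node J); rewrite ler_norml => /andP[].
  + rewrite -[leRHS](binom_mean_cst s l M x); apply: binom_mean_le => // J.
    by have := GM (node J); rewrite ler_norml => /andP[].
move=> x Kx.
have [B BE] : exists B, B = 2 * M / del ^+ 2 by eexists.
have B0 : 0 <= B by rewrite BE; apply: divr_ge0; [exact: mulr_ge0|exact: sqr_ge0].
have C0 : 0 <= B * 4 / N%:R ^+ 2.
  by apply: divr_ge0; [exact: mulr_ge0|exact: sqr_ge0].
(* Chebyshev's inequality, as a pointwise bound of |G x - F J| by a quadratic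
   function of the counts, whose mean is explicit. *)
pose q (J : 'I_m -> nat) := e / 2 * 1 +
  (B * 4 / N%:R ^+ 2) * \sum_i ((J i)%:R - N%:R * s i x) ^+ 2.
have pi2 : (1 : R) <= pi / 2 by have := pi_ge2 R; lra.
have sin10 : 0 <= sin 1 :> R.
  by apply: sin_ge0_pi; have := pi_ge2 R; lra.
have hF J : `|G x - F J| <= q J.
  have [close|far] := boolP [forall i, `|2 * (J i)%:R / N%:R - 1 - S i x| < del].
    apply: (@le_trans _ _ (e / 2)); last first.
      rewrite /q mulr1 lerDl mulr_ge0//.
      by apply: sumr_ge0 => i _; exact: sqr_ge0.
    apply/ltW/Gd => // i; rewrite mxE.
    have xi : -1 <= x ord0 i / K <= 1.
      by rewrite -ler_norml normrM normfV (gtr0_norm K0) ler_pdivrMr// mul1r.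
    have Si : - sin 1 <= S i x <= sin 1.
      by rewrite -sinN !leNgt !ltr_sin -?leNgt// in_itv/=; lra.
    set u := 2 * _ / _ - 1; have := forallP close i; rewrite -/u => hu.
    have hclip : `|clip u - S i x| < del.
      move: hu Si; rewrite !ltr_norml /clip minEle maxEle.
      by case: ifPn; case: ifPn; rewrite -?ltNge; lra.
    have cu : - sin 1 <= clip u <= sin 1.
      rewrite /clip minEle maxEle.
      by case: ifPn; case: ifPn; rewrite -?ltNge; lra.
    have cu1 : -1 <= clip u <= 1 by have := sin_le1 (1 : R); lra.
    have sa : sin (asin (clip u)) = clip u.
      by rewrite asinK// in_itv.
    have ai : -1 <= asin (clip u) <= 1.
      have h1 := asin_lepi2 cu1; have h2 := asin_geNpi2 cu1.
      have ia : asin (clip u) \in `[- (pi / 2), pi / 2] by rewrite in_itv/= h2.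
      have i1 : (1 : R) \in `[- (pi / 2), pi / 2] by rewrite in_itv/=; lra.
      have iN1 : (-1 : R) \in `[- (pi / 2), pi / 2] by rewrite in_itv/=; lra.
      apply/andP; split; rewrite leNgt -ltr_sin// sa ?sinN -leNgt.
        by case/andP: cu.
      by case/andP: cu.
    have -> : x ord0 i - K * asin (clip u) = K * (x ord0 i / K - asin (clip u)).
      by field; exact: lt0r_neq0.
    rewrite normrM (gtr0_norm K0) mulrC -ltr_pdivlMr//.
    rewrite -(@ltr_pM2l _ (cos 1)) ?cos1_gt0// (le_lt_trans (sin_expanding xi ai))//.
    by rewrite sa distrC mulrA -delE.
  have [i far_i] := forallPn far.
  rewrite -leNgt in far_i.
  apply: (@le_trans _ _ (2 * M)).
    rewrite (le_trans (ler_normB _ _))//.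
    by have := GM x; have := GM (node J); rewrite /F; lra.
  apply: (@le_trans _ _ ((B * 4 / N%:R ^+ 2) * ((J i)%:R - N%:R * s i x) ^+ 2)).
    rewrite (_ : B * 4 / _ * _ = B * (2 * (J i)%:R / N%:R - 1 - S i x) ^+ 2); last first.
      by rewrite /s; field; exact: lt0r_neq0.
    rewrite BE mulrAC ler_pdivlMr ?exprn_gt0// ler_wpM2l ?mulr_ge0//.
    rewrite -[leRHS]real_normK ?num_real//.
    by rewrite lerXn2r ?nnegrE// ltW.
  rewrite /q mulr1; apply: ler_wpDl; first exact: ltW.
  rewrite ler_wpM2l//.
  by rewrite (bigD1 i)//= lerDl sumr_ge0// => i' _; exact: sqr_ge0.
have mq : binom_mean s l q x <= e.
  rewrite binom_mean_lin binom_mean_cst mulr1 binom_mean_sum.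
  under eq_bigr do rewrite binom_mean_sqr lN subrr expr0n/= add0r.
  rewrite -mulr_sumr.
  have hs : \sum_(i < m) s i x * (1 - s i x) <= m%:R / 4.
    rewrite -[m in leRHS]card_ord -sum1_card natr_sum mulr_suml.
    by apply: ler_sum => i _; have := sqr_ge0 (s i x - 1 / 2); nra.
  rewrite [leRHS](splitr e) lerD2l (le_trans _ hN)//.
  apply: (@le_trans _ _ (B * 4 / N%:R ^+ 2 * (N%:R * (m%:R / 4)))).
    by rewrite ler_wpM2l// ler_wpM2l.
  rewrite le_eqVlt BE; apply/orP; left; apply/eqP; field.
  by rewrite !lt0r_neq0.
have lin := binom_mean_lin s l 1 (-1).
rewrite ler_norml; apply/andP; split.
- have : binom_mean s l F x <= binom_mean s l (fun J => 1 * G x - (-1) * q J) x.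
    apply: binom_mean_le => // J; have := hF J; rewrite ler_norml; lra.
  under eq_fun do rewrite -mulNr opprK.
  rewrite binom_mean_lin binom_mean_cst; lra.
- have : binom_mean s l (fun J => 1 * G x + (-1) * q J) x <= binom_mean s l F x.
    apply: binom_mean_le => // J; have := hF J; rewrite ler_norml; lra.
  rewrite binom_mean_lin binom_mean_cst; lra.
Qed.

End trig_approximation.

(** * Weak convergence from convergence of variances *)

Lemma cvg_sumr (R : realType) (U : Type) (F : set_system U) (I : Type)
    (r : seq I) (u : I -> U -> R) (l : I -> R) : Filter F ->
  (forall i, u i x @[x --> F] --> l i) ->
  \sum_(i <- r) u i x @[x --> F] --> \sum_(i <- r) l i.
Proof.
move=> FF cu; elim: r => [|i r ih].
  by rewrite big_nil; under eq_fun do rewrite big_nil; exact: cvg_cst.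
rewrite big_cons; under eq_fun do rewrite big_cons.
exact: cvgD.
Qed.

Section weak_convergence.
Context (R : realType) (m : nat).

Lemma measurable_continuous_rV (G : 'rV[R]_m -> R) :
  continuous G -> measurable_fun setT G.
Proof.
move=> cG; apply: (measurability _ (RGenOInfty.measurableE R)) => //.
move=> _ [_ [a ->] <-]; rewrite setTI; apply: open_measurable_rV.
by apply: open_comp; [move=> x _; exact: cG|exact: interval_open].
Qed.

Context d (T : measurableType d) (P : probability T R).
Context d' (T' : measurableType d') (P' : probability T' R).
Variables (X : nat -> 'I_m -> T -> R) (Y : 'I_m -> T' -> R).
Hypothesis gX : forall k c, gausslike P (fun w => \sum_i c i * X k i w).
Hypothesis gY : forall c, gausslike P' (fun w => \sum_i c i * Y i w).
Hypothesis cXY : forall c, msq P (fun w => \sum_i c i * X k i w) @[k --> \oo]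
  --> msq P' (fun w => \sum_i c i * Y i w).

Let pick1 (V : Type) (Z : 'I_m -> V -> R) i :
  (fun w => \sum_i' (i' == i)%:R * Z i' w) = Z i.
Proof.
apply/funext => w; rewrite (bigD1 i)//= eqxx mul1r big1 ?addr0//.
by move=> i' /negbTE ->; rewrite mul0r.
Qed.

Let sX k i : sqint P (X k i).
Proof. by case: (gX k (fun i' => (i' == i)%:R)); rewrite pick1. Qed.

Let sY i : sqint P' (Y i).
Proof. by case: (gY (fun i' => (i' == i)%:R)); rewrite pick1. Qed.

Let cX i : msq P (X k i) @[k --> \oo] --> msq P' (Y i).
Proof.
rewrite -(pick1 Y i) (_ : (fun k => msq P (X k i)) =
    fun k => msq P (fun w => \sum_i' (i' == i)%:R * X k i' w)).
  exact: cXY.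
by apply/funext => k; rewrite pick1.
Qed.

Let measurable_row e (U : measurableType e) (Z : 'I_m -> U -> R)
    (G : 'rV[R]_m -> R) : (forall i, measurable_fun setT (Z i)) ->
  continuous G -> measurable_fun setT (fun w => G (\row_i Z i w)).
Proof.
move=> mZ cG; apply: (measurableT_comp (measurable_continuous_rV cG)).
apply/measurable_rVP => i; rewrite (_ : (fun w => _) = Z i)//.
by apply/funext => w; rewrite mxE.
Qed.

Let trig_continuous f : @trig R m f -> continuous f.
Proof.
elim=> [a c b x|f1 f2 _ h1 _ h2 x]; last exact: (cvgD (h1 x) (h2 x)).
apply: continuousM; first exact: cst_continuous.
apply: (@continuous_comp _ _ _ (fun z : 'rV[R]_m => \sum_i c i * z ord0 i + b)
  (@cos R)); last exact: continuous_cos.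
apply: continuousD; last exact: cst_continuous.
apply: (cvg_sumr _ (F := nbhs x)) => i.
apply: continuousM; first exact: cst_continuous.
exact: coord_continuous.
Qed.

Let trig_bounded f : @trig R m f -> exists M, forall x, `|f x| <= M.
Proof.
elim=> [a c b|f1 f2 _ [M1 h1] _ [M2 h2]].
  by exists `|a| => x; rewrite normrM ler_piMr// cos_max.
by exists (M1 + M2) => x; rewrite (le_trans (ler_normD _ _))// lerD.
Qed.

Let integrable_row e (U : measurableType e) (Q : probability U R)
    (Z : 'I_m -> U -> R) (G : 'rV[R]_m -> R) (M : R) :
  (forall i, measurable_fun setT (Z i)) ->
  continuous G -> (forall x, `|G x| <= M) ->
  Q.-integrable setT (EFin \o (fun w => G (\row_i Z i w))).
Proof.
move=> mZ cG GM; apply: (@integrable_bounded _ _ _ Q _ M) => //.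
exact: measurable_row.
Qed.

Let trig_cvg f : @trig R m f ->
  \int[P]_w f (\row_i X k i w) @[k --> \oo] --> \int[P']_w f (\row_i Y i w).
Proof.
have mX k i : measurable_fun setT (X k i) by case: (sX k i).
have mY i : measurable_fun setT (Y i) by case: (sY i).
elim=> [a c b|f1 f2 t1 h1 t2 h2].
  have hZ e (U : measurableType e) (Q : probability U R) (Z : 'I_m -> U -> R) :
      gausslike Q (fun w => \sum_i c i * Z i w) ->
      \int[Q]_w (a * cos (\sum_i c i * (\row_i Z i w) ord0 i + b)) =
      a * gauss_cos b (msq Q (fun w => \sum_i c i * Z i w)).
    move=> [[mS _] <-]; rewrite -RintegralZl//; last first.
      apply: (@integrable_bounded _ _ _ Q _ 1); last by move=> w; exact: cos_max.
      apply: (measurableT_comp (@measurable_cos R)).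
      exact: measurable_funD.
    apply: eq_Rintegral => w _; congr (_ * cos (_ + _)).
    by apply: eq_bigr => i _; rewrite mxE.
  rewrite hZ//; under eq_fun do rewrite hZ//.
  apply: cvgM; first exact: cvg_cst.
  exact: gauss_cos_cvg.
have [M1 b1] := trig_bounded t1; have [M2 b2] := trig_bounded t2.
have c1 := trig_continuous t1; have c2 := trig_continuous t2.
rewrite RintegralD//; [|exact: integrable_row..].
rewrite (_ : (fun k => _) = fun k => \int[P]_w f1 (\row_i X k i w) +
    \int[P]_w f2 (\row_i X k i w)); first exact: cvgD.
by apply/funext => k; rewrite RintegralD//; exact: integrable_row.
Qed.

(* Outside the box the error 2 * M is at most 2 * M / K ^+ 2 times the sum of
   the squared coordinates, whose mean stays bounded along the sequence. *)
Let approx_integral e (U : measurableType e) (Q : probability U R)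
    (Z : 'I_m -> U -> R) (G f : 'rV[R]_m -> R) (M K eps : R) :
  (forall i, sqint Q (Z i)) -> continuous G -> (forall x, `|G x| <= M) ->
  trig f -> (forall x, `|f x| <= M) -> 0 < K -> 0 < eps ->
  (forall x, box K x -> `|G x - f x| <= eps) ->
  `|\int[Q]_w G (\row_i Z i w) - \int[Q]_w f (\row_i Z i w)| <=
  eps + 2 * M / K ^+ 2 * \sum_i msq Q (Z i).
Proof.
move=> sZ cG GM tf fM K0 e0 Gf.
have mZ i : measurable_fun setT (Z i) by case: (sZ i).
have M0 : 0 <= M by apply: le_trans (GM 0).
have C0 : 0 <= 2 * M / K ^+ 2.
  by apply: divr_ge0; [exact: mulr_ge0|exact: sqr_ge0].
have cf := trig_continuous tf.
have bnd x : `|G x - f x| <= eps + 2 * M / K ^+ 2 * \sum_i x ord0 i ^+ 2.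
  have [bx|bx] := pselect (box K x).
    rewrite (le_trans (Gf x bx))// lerDl mulr_ge0// sumr_ge0// => i _.
    exact: sqr_ge0.
  have /existsNP[i /negP] := bx; rewrite -ltNge => Ki.
  apply: (@le_trans _ _ (2 * M)).
    by rewrite (le_trans (ler_normB _ _))//; have := GM x; have := fM x; lra.
  apply: ler_wpDl; first exact: ltW.
  rewrite mulrAC ler_pdivlMr ?exprn_gt0// ler_wpM2l ?mulr_ge0//.
  apply: (@le_trans _ _ (x ord0 i ^+ 2)).
    by rewrite -[leRHS]real_normK ?num_real// lerXn2r ?nnegrE// ltW.
  by rewrite (bigD1 i)//= lerDl sumr_ge0// => i' _; exact: sqr_ge0.
have iG : Q.-integrable setT (EFin \o (fun w => G (\row_i Z i w))).
  exact: integrable_row GM.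
have If : Q.-integrable setT (EFin \o (fun w => f (\row_i Z i w))).
  exact: integrable_row fM.
rewrite -RintegralB//.
have iGf : Q.-integrable setT (EFin \o
    (fun w => G (\row_i Z i w) - f (\row_i Z i w))).
  exact: (integrable_sub iG If).
rewrite (le_trans (le_normr_Rintegral _ iGf))//.
have [is1 is2] := Rintegral_sum (f := fun i w => Z i w ^+ 2) (index_enum 'I_m)
  (fun i => (sZ i).2).
have ic : Q.-integrable setT (EFin \o cst eps).
  exact: finite_measure_integrable_cst.
have iC : Q.-integrable setT (EFin \o
    (fun w => 2 * M / K ^+ 2 * \sum_i Z i w ^+ 2)).
  exact: (integrable_scale (2 * M / K ^+ 2) is1).
have <- : \int[Q]_w (eps + 2 * M / K ^+ 2 * \sum_i Z i w ^+ 2) =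
    eps + 2 * M / K ^+ 2 * \sum_i msq Q (Z i).
  by rewrite RintegralD// RintegralZl// is2 Rintegral_prob_cst.
apply: le_Rintegral => //.
- exact: integrable_norm iGf.
- exact: (integrable_add ic iC).
move=> w _; rewrite (le_trans (bnd _))// lerD2l ler_wpM2l//.
by apply: ler_sum => i _; rewrite mxE.
Qed.

(** Replacing G by a trigonometric polynomial f that is close to it on a large
    box costs little for X k, uniformly in large k, and for Y, by boundedness
    of the second moments.  The integral of f is a finite combination of terms
    E cos (\sum_i c i * X k i + b), each a continuous function of the variance
    of a linear combination. *)
Lemma gausslike_weak_cvg (G : 'rV[R]_m -> R) (M : R) : continuous G ->
  (forall x, `|G x| <= M) ->
  \int[P]_w G (\row_i X k i w) @[k --> \oo] --> \int[P']_w G (\row_i Y i w).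
Proof.
move=> cG GM; have M0 : 0 <= M by apply: le_trans (GM 0).
apply/cvgrPdist_lt => e e0; pose eps := e / 6.
have eps0 : 0 < eps by rewrite divr_gt0.
have [V VE] : exists V, V = \sum_i msq P' (Y i) + 1 by eexists.
have V0 : 0 < V.
  by rewrite VE ltr_wpDl// sumr_ge0// => i _; exact: msq_ge0.
have [K K0 KE] : exists2 K, 0 < K & 2 * M / K ^+ 2 * V <= eps.
  exists (Num.sqrt (2 * M * V / eps) + 1).
    by rewrite ltr_wpDl// sqrtr_ge0.
  rewrite mulrAC ler_pdivrMr; last by rewrite exprn_gt0// ltr_wpDl// sqrtr_ge0.
  have h0 : 0 <= 2 * M * V / eps by rewrite !mulr_ge0 ?invr_ge0// ltW.
  have h1 : Num.sqrt (2 * M * V / eps) ^+ 2 = 2 * M * V / eps by rewrite sqr_sqrtr.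
  have h2 := sqrtr_ge0 (2 * M * V / eps).
  have h3 : 2 * M * V / eps <= (Num.sqrt (2 * M * V / eps) + 1) ^+ 2.
    by rewrite -[leLHS]h1 lerXn2r ?nnegrE ?addr_ge0// lerDl.
  by rewrite [leRHS]mulrC -ler_pdivrMr.
have C0 : 0 <= 2 * M / K ^+ 2.
  by apply: divr_ge0; [exact: mulr_ge0|exact: sqr_ge0].
have [f [tf fM Gf]] := trig_approx cG GM K0 eps0.
have cs : \sum_i msq P (X k i) @[k --> \oo] --> \sum_i msq P' (Y i).
  by apply: cvg_sumr => i; exact: cX.
have := cs => /cvgrPdist_lt/(_ _ ltr01).
have := trig_cvg tf => /cvgrPdist_lt/(_ _ eps0).
apply: filterS2 => k h1 h2.
have a1 : `|\int[P]_w G (\row_i X k i w) - \int[P]_w f (\row_i X k i w)| <=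
    eps + eps.
  rewrite (le_trans (approx_integral (sX k) cG GM tf fM K0 eps0 Gf))// lerD2l.
  rewrite (le_trans _ KE)// ler_wpM2l//.
  by rewrite VE; move: h2; rewrite ltr_norml; lra.
have a2 : `|\int[P']_w G (\row_i Y i w) - \int[P']_w f (\row_i Y i w)| <=
    eps + eps.
  rewrite (le_trans (approx_integral sY cG GM tf fM K0 eps0 Gf))// lerD2l.
  rewrite (le_trans _ KE)// ler_wpM2l//.
  by rewrite VE lerDl.
have -> : e = eps * 6 by rewrite /eps; field.
by move: a1 a2 h1; rewrite !ler_norml !ltr_norml; lra.
Qed.

End weak_convergence.

(** * Wiener integrals *)

Lemma gaussian_family_gausslike d (T : measurableType d) (R : realType)
    (P : probability T R) (I : eqType) (D : set I) (X : I -> T -> R)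
    (s : seq (R * I)) : gaussian_family P D X ->
  (forall t, D t -> expectation P (X t) = 0%E) -> (forall p, p \in s -> D p.2) ->
  gausslike P (fun w => \sum_(p <- s) p.1 * X p.2 w).
Proof.
move=> gX eX sD; have sX t : D t -> sqint P (X t).
  move=> Dt; have := gX 1%N (fun=> t) (fun=> 1) (fun=> Dt).
  rewrite (_ : (fun w => _) = X t); last first.
    by apply/funext => w; rewrite big_ord1 mul1r.
  by move/gaussian_rv_gausslike => /(_ (eX t Dt))[].
apply: gaussian_rv_gausslike.
  have h i : D (tnth (in_tuple s) i).2 by apply/sD/mem_tnth.
  have := gX _ _ (fun i => (tnth (in_tuple s) i).1) h.
  congr (gaussian_rv P); apply/funext => w.
  by rewrite [RHS]big_tnth.
rewrite unlock.
suff [] : P.-integrable setT (fun w => (\sum_(p <- s) p.1 * X p.2 w)%:E) /\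
    (\int[P]_w (\sum_(p <- s) p.1 * X p.2 w)%:E = 0)%E by [].
elim: s sD => [|p s ih] sD.
  rewrite (_ : (fun w => _) = cst 0%E); last first.
    by apply/funext => w; rewrite big_nil.
  by rewrite integral0; split=> //; exact: integrable0.
have [|i1 i2] := ih; first by move=> q qs; apply: sD; rewrite inE qs orbT.
have Dp : D p.2 by apply: sD; rewrite inE eqxx.
have iX : P.-integrable setT (EFin \o X p.2) by apply/sqint_integrable/sX.
have iXp : P.-integrable setT (fun w => p.1%:E * (X p.2 w)%:E)%E.
  exact: integrableZl.
rewrite (_ : (fun w => _) = fun w => (p.1%:E * (X p.2 w)%:E +
    (\sum_(p <- s) p.1 * X p.2 w)%:E)%E); last first.
  by apply/funext => w; rewrite big_cons EFinD EFinM.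
split; first exact: (integrableD _ iXp i1).
rewrite integralD// i2 adde0 integralZl//.
by have := eX _ Dp; rewrite unlock => ->; rewrite mule0.
Qed.

Section wiener.
Context d (T : measurableType d) (R : realType) (P : probability T R) (n : nat).
Local Notation mu := (lebesgue_rV R n).
Variable Z : set 'rV[R]_n -> T -> R.
Hypothesis wnZ : white_noise P Z.
Implicit Types (e : seq (R * set 'rV[R]_n)) (f : 'rV[R]_n -> R).

Definition admissible_steps e := forall p, p \in e -> finite_volume p.2.

Let gZ A : finite_volume A -> gausslike P (Z A).
Proof.
move=> fA; have [gf eZ _ _] := wnZ.
have := gf 1%N (fun=> A) (fun=> 1) (fun=> fA).
rewrite (_ : (fun w => _) = Z A); last first.
  by apply/funext => w; rewrite big_ord1 mul1r.
by move/gaussian_rv_gausslike; apply; exact: eZ.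
Qed.

Let cov_Z A B : finite_volume A -> finite_volume B ->
  \int[P]_w (Z A w * Z B w) = \int[mu]_u (\1_A u * \1_B u).
Proof.
move=> fA fB; have [_ _ cZ _] := wnZ.
have := cZ _ _ fA fB; rewrite unlock => h.
rewrite /Rintegral h; congr fine.
rewrite -[in LHS](setIT (A `&` B)) -integral_indic//.
  by apply: eq_integral => u _; rewrite indicI.
by case: fA => mA _; case: fB => mB _; exact: measurableI.
Qed.

Let sqint_indic A : finite_volume A -> sqint mu (\1_A : 'rV[R]_n -> R).
Proof.
move=> [mA fA]; apply: sqintP => //.
rewrite (_ : (fun u => _) = fun u => (\1_A u)%:E).
  by rewrite integral_indic// setIT.
by apply/funext => u; rewrite indicE; case: (_ \in _); rewrite ?expr1n ?expr0n.
Qed.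

Lemma sqint_step_fun e : admissible_steps e -> sqint mu (step_fun e).
Proof.
elim: e => [|p e ih] he.
  rewrite (_ : step_fun [::] = cst 0); first exact: sqint0.
  by apply/funext => u; rewrite /step_fun big_nil.
rewrite (_ : step_fun _ = fun u => p.1 * \1_(p.2) u + step_fun e u).
  apply: sqintD; last by apply: ih => q qe; apply: he; rewrite inE qe orbT.
  by apply/sqintZ/sqint_indic/he; rewrite inE eqxx.
by apply/funext => u; rewrite /step_fun big_cons.
Qed.

Lemma sqint_step_integral e : admissible_steps e -> sqint P (step_integral Z e).
Proof.
elim: e => [|p e ih] he.
  rewrite (_ : step_integral Z [::] = cst 0); first exact: sqint0.
  by apply/funext => u; rewrite /step_integral big_nil.
rewrite (_ : step_integral Z _ = fun u => p.1 * Z p.2 u + step_integral Z e u).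
  apply: sqintD; last by apply: ih => q qe; apply: he; rewrite inE qe orbT.
  by apply/sqintZ; case: (@gZ p.2)=> //; apply: he; rewrite inE eqxx.
by apply/funext => u; rewrite /step_integral big_cons.
Qed.

Let integralMl d1 (U : measurableType d1) (nu : {measure set U -> \bar R})
    (a : R) (F G H : U -> R) : sqint nu F -> sqint nu G -> sqint nu H ->
  \int[nu]_w ((a * F w + G w) * H w) =
  a * \int[nu]_w (F w * H w) + \int[nu]_w (G w * H w).
Proof.
move=> sF sG sH; have i1 := sqint_mul sF sH; have i2 := sqint_mul sG sH.
have i3 : nu.-integrable setT (EFin \o (fun w => a * (F w * H w))).
  exact: (integrable_scale a i1).
rewrite -RintegralZl// -RintegralD//; apply: eq_Rintegral => w _; ring.
Qed.

(** Proved for two lists at once: by bilinearity the claim reduces to the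
    covariance of Z on two sets, and the sets of a list may overlap. *)
Lemma step_isometry e : admissible_steps e ->
  msq P (step_integral Z e) = msq mu (step_fun e).
Proof.
suff H e1 e2 : admissible_steps e1 -> admissible_steps e2 ->
    \int[P]_w (step_integral Z e1 w * step_integral Z e2 w) =
    \int[mu]_u (step_fun e1 u * step_fun e2 u).
  move=> he; rewrite /msq; under eq_Rintegral do rewrite expr2.
  by rewrite H//; apply: eq_Rintegral => u _; rewrite expr2.
elim: e1 => [|p e1 ih] he1 he2.
  rewrite [LHS](_ : _ = \int[P]_w 0); last first.
    by apply: eq_Rintegral => w _; rewrite /step_integral big_nil mul0r.
  rewrite [RHS](_ : _ = \int[mu]_w 0); last first.
    by apply: eq_Rintegral => w _; rewrite /step_fun big_nil mul0r.
  by rewrite /Rintegral !integral0.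
have hp : finite_volume p.2 by apply: he1; rewrite inE eqxx.
have he1' : admissible_steps e1 by move=> q qe; apply: he1; rewrite inE qe orbT.
rewrite [LHS](_ : _ = \int[P]_w ((p.1 * Z p.2 w + step_integral Z e1 w) *
    step_integral Z e2 w)); last first.
  by apply: eq_Rintegral => w _; rewrite /step_integral big_cons.
rewrite [RHS](_ : _ = \int[mu]_u ((p.1 * \1_(p.2) u + step_fun e1 u) *
    step_fun e2 u)); last first.
  by apply: eq_Rintegral => w _; rewrite /step_fun big_cons.
have sZ A : finite_volume A -> sqint P (Z A) by move=> /gZ[].
rewrite (integralMl p.1 (sZ _ hp) (sqint_step_integral he1')
  (sqint_step_integral he2)).
rewrite (integralMl p.1 (sqint_indic hp) (sqint_step_fun he1')
  (sqint_step_fun he2)) ih//.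
congr (_ * _ + _).
elim: e2 he2 {ih} => [|q e2 ih] he2.
  rewrite [LHS](_ : _ = \int[P]_w 0); last first.
    by apply: eq_Rintegral => w _; rewrite /step_integral big_nil mulr0.
  rewrite [RHS](_ : _ = \int[mu]_w 0); last first.
    by apply: eq_Rintegral => w _; rewrite /step_fun big_nil mulr0.
  by rewrite /Rintegral !integral0.
have hq : finite_volume q.2 by apply: he2; rewrite inE eqxx.
have he2' : admissible_steps e2 by move=> r re; apply: he2; rewrite inE re orbT.
rewrite [LHS](_ : _ = \int[P]_w ((q.1 * Z q.2 w + step_integral Z e2 w) *
    Z p.2 w)); last first.
  by apply: eq_Rintegral => w _; rewrite /step_integral big_cons mulrC.
rewrite [RHS](_ : _ = \int[mu]_u ((q.1 * \1_(q.2) u + step_fun e2 u) *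
    \1_(p.2) u)); last first.
  by apply: eq_Rintegral => w _; rewrite /step_fun big_cons mulrC.
rewrite (integralMl q.1 (sZ _ hq) (sqint_step_integral he2') (sZ _ hp)).
rewrite (integralMl q.1 (sqint_indic hq) (sqint_step_fun he2') (sqint_indic hp)).
rewrite cov_Z//; congr (_ + _).
rewrite [LHS](_ : _ = \int[P]_w (Z p.2 w * step_integral Z e2 w)); last first.
  by apply: eq_Rintegral => w _; rewrite mulrC.
by rewrite ih//; apply: eq_Rintegral => u _; rewrite mulrC.
Qed.

Lemma step_integral_gausslike e : admissible_steps e ->
  gausslike P (step_integral Z e).
Proof.
move=> he; have [gf eZ _ _] := wnZ.
exact: (gaussian_family_gausslike gf eZ he).
Qed.

End wiener.

Section wiener_exists.
Context d (T : measurableType d) (R : realType) (P : probability T R) (n : nat).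
Local Notation mu := (lebesgue_rV R n).
Variable Z : set 'rV[R]_n -> T -> R.
Hypothesis wnZ : white_noise P Z.
Implicit Types (e : seq (R * set 'rV[R]_n)) (f : 'rV[R]_n -> R).
Local Notation sqint_step_integral := (sqint_step_integral wnZ).

Definition scale_steps (a : R) e : seq (R * set 'rV[R]_n) :=
  [seq (a * p.1, p.2) | p <- e].

Lemma admissible_cat e1 e2 : admissible_steps e1 -> admissible_steps e2 ->
  admissible_steps (e1 ++ e2).
Proof. by move=> h1 h2 p; rewrite mem_cat => /orP[/h1|/h2]. Qed.

Lemma admissible_scale a e : admissible_steps e ->
  admissible_steps (scale_steps a e).
Proof. by move=> h p /mapP[q /h qe ->]. Qed.

Lemma step_fun_cat e1 e2 u :
  step_fun (e1 ++ e2) u = step_fun e1 u + step_fun e2 u.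
Proof. by rewrite /step_fun big_cat. Qed.

Lemma step_integral_cat e1 e2 w :
  step_integral Z (e1 ++ e2) w = step_integral Z e1 w + step_integral Z e2 w.
Proof. by rewrite /step_integral big_cat. Qed.

Lemma step_fun_scale a e u : step_fun (scale_steps a e) u = a * step_fun e u.
Proof.
rewrite /step_fun big_map mulr_sumr; apply: eq_bigr => p _; by rewrite mulrA.
Qed.

Lemma step_integral_scale a e w :
  step_integral Z (scale_steps a e) w = a * step_integral Z e w.
Proof.
rewrite /step_integral big_map mulr_sumr; apply: eq_bigr => p _; by rewrite mulrA.
Qed.

(** The convergence of the extended integrals already forces f and I to be
    square integrable, which puts the definition within the reach of msq. *)
Lemma is_wiener_integralP f I : is_wiener_integral P Z f I <->
  [/\ sqint mu f, sqint P I & exists e_ : nat -> seq (R * set 'rV[R]_n),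
    [/\ forall k, admissible_steps (e_ k),
      msq mu (fun u => f u - step_fun (e_ k) u) @[k --> \oo] --> 0 &
      msq P (fun w => I w - step_integral Z (e_ k) w) @[k --> \oo] --> 0]].
Proof.
have aux dU (U : measurableType dU) (nu : {measure set U -> \bar R})
    (F : U -> R) (F_ : nat -> U -> R) : measurable_fun setT F ->
    (forall k, sqint nu (F_ k)) ->
    (\int[nu]_x ((F x - F_ k x) ^+ 2)%:E)%E @[k --> \oo] --> 0%E -> sqint nu F.
  move=> mF sF /fine_cvgP[] [N _ /(_ N (leqnn N)) /= hN] _.
  have s1 : sqint nu (fun x => F x - F_ N x).
    apply: sqintP; first by apply: measurable_funB => //; case: (sF N).
    by rewrite -ge0_fin_numE// integral_ge0// => x _; rewrite lee_fin sqr_ge0.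
  have := sqintD s1 (sF N).
  by under [X in sqint _ X -> _]eq_fun do rewrite subrK.
split.
  move=> [mf mI [e_ [he h1 h2]]].
  have hs k := sqint_step_fun (he k).
  have hS k := sqint_step_integral (he k).
  have sf := aux _ _ _ _ _ mf hs h1.
  move: h2; rewrite unlock => h2.
  have sI := aux _ _ _ _ _ mI hS h2.
  split=> //; exists e_; split=> //.
    by apply/msq_cvg0P => // k; exact: sqintB.
  by apply/msq_cvg0P => // k; exact: sqintB.
move=> [sf sI [e_ [he h1 h2]]].
have [[mf _] [mI _]] := (sf, sI).
have hs k := sqint_step_fun (he k).
have hS k := sqint_step_integral (he k).
split=> //; exists e_; split=> //.
  by apply/msq_cvg0P => // k; exact: sqintB.
by rewrite unlock; apply/msq_cvg0P => // k; exact: sqintB.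
Qed.

(** Both properties hold for step functions and pass to mean-square limits. *)
Lemma wiener_gausslike f I : is_wiener_integral P Z f I ->
  gausslike P I /\ msq P I = msq mu f.
Proof.
move=> /is_wiener_integralP[sf sI [e_ [he h1 h2]]].
have hs k := sqint_step_fun (he k).
have hS k := sqint_step_integral (he k).
split.
  apply: gausslike_lim sI h2 => k; exact: step_integral_gausslike.
have c1 := msq_cvg sI hS h2; have c2 := msq_cvg sf hs h1.
rewrite -(cvg_lim _ c1)// -(cvg_lim _ c2)//; congr (limn _).
by apply/funext => k; exact: step_isometry.
Qed.

Lemma is_wiener_integral0 : is_wiener_integral P Z (cst 0) (cst 0).
Proof.
apply/is_wiener_integralP; split; [exact: sqint0|exact: sqint0|].
exists (fun=> [::]); split=> //.
  rewrite (_ : (fun k => _) = cst 0); first exact: cvg_cst.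
  apply/funext => k; rewrite /msq/= /Rintegral.
  under eq_integral do rewrite /step_fun big_nil subrr expr0n/=.
  by rewrite integral0.
rewrite (_ : (fun k => _) = cst 0); first exact: cvg_cst.
apply/funext => k; rewrite /msq/= /Rintegral.
under eq_integral do rewrite /step_integral big_nil subrr expr0n/=.
by rewrite integral0.
Qed.

Lemma is_wiener_integralD a f I g J : is_wiener_integral P Z f I ->
  is_wiener_integral P Z g J ->
  is_wiener_integral P Z (fun u => a * f u + g u) (fun w => a * I w + J w).
Proof.
move=> /is_wiener_integralP[sf sI [e_ [he h1 h2]]].
move=> /is_wiener_integralP[sg sJ [e'_ [he' h1' h2']]].
have hs k := sqint_step_fun (he k).
have hS k := sqint_step_integral (he k).
have hs' k := sqint_step_fun (he' k).
have hS' k := sqint_step_integral (he' k).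
have cvgZ dU (U : measurableType dU) (nu : {measure set U -> \bar R})
    (F_ : nat -> U -> R) : (forall k, sqint nu (F_ k)) ->
    msq nu (F_ k) @[k --> \oo] --> 0 ->
    msq nu (fun x => a * F_ k x) @[k --> \oo] --> 0.
  move=> sF cF; rewrite (_ : (fun k => _) = fun k => a ^+ 2 * msq nu (F_ k)).
    by rewrite -[X in _ --> X](mulr0 (a ^+ 2)); apply: cvgM => //; exact: cvg_cst.
  by apply/funext => k; exact: msqZ.
apply/is_wiener_integralP; split.
- by apply: sqintD => //; exact: sqintZ.
- by apply: sqintD => //; exact: sqintZ.
exists (fun k => scale_steps a (e_ k) ++ e'_ k); split.
- by move=> k; apply: admissible_cat => //; exact: admissible_scale.
- rewrite (_ : (fun k => _) = fun k => msq mu (fun u =>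
    a * (f u - step_fun (e_ k) u) + (g u - step_fun (e'_ k) u))); last first.
    apply/funext => k; congr (msq mu); apply/funext => u.
    by rewrite step_fun_cat step_fun_scale; ring.
  apply: cvg_msqD0 => //.
  + by move=> k; apply/sqintZ/sqintB.
  + by move=> k; exact: sqintB.
  + by apply: cvgZ => // k; exact: sqintB.
- rewrite (_ : (fun k => _) = fun k => msq P (fun w =>
    a * (I w - step_integral Z (e_ k) w) + (J w - step_integral Z (e'_ k) w))); last first.
    apply/funext => k; congr (msq P); apply/funext => u.
    by rewrite step_integral_cat step_integral_scale; ring.
  apply: cvg_msqD0 => //.
  + by move=> k; apply/sqintZ/sqintB.
  + by move=> k; exact: sqintB.
  + by apply: cvgZ => // k; exact: sqintB.
Qed.

Lemma is_wiener_integral_sum (K : Type) (r : seq K) (c : K -> R)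
    (f : K -> 'rV[R]_n -> R) (I : K -> T -> R) :
  (forall i, is_wiener_integral P Z (f i) (I i)) ->
  is_wiener_integral P Z (fun u => \sum_(i <- r) c i * f i u)
    (fun w => \sum_(i <- r) c i * I i w).
Proof.
move=> h; elim: r => [|i r ih].
  under eq_fun do rewrite big_nil.
  under [X in is_wiener_integral _ _ _ X]eq_fun do rewrite big_nil.
  exact: is_wiener_integral0.
under eq_fun do rewrite big_cons.
under [X in is_wiener_integral _ _ _ X]eq_fun do rewrite big_cons.
exact: is_wiener_integralD.
Qed.

End wiener_exists.

Section step_dense.
Context (R : realType) (n : nat).
Local Notation mu := (lebesgue_rV R n).
Import HBNNSimple.

(** Simple functions increasing to f, cut off by an exhaustion of the space by
    sets of finite volume, converge to f under the bound f ^+ 2. *)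
Lemma step_dense_ge0 (f : 'rV[R]_n -> R) (eps : R) : sqint mu f ->
  (forall u, 0 <= f u) -> 0 < eps -> exists2 e, admissible_steps e &
    msq mu (fun u => f u - step_fun e u) <= eps.
Proof.
move=> sf f0 eps0; have [mf fi] := sf.
have mEf : measurable_fun setT (EFin \o f) by exact/measurable_EFinP.
pose h := nnsfun_approx measurableT mEf.
have /sigma_finiteP[F [FT ndF Foo]] := sigma_finiteT mu.
pose e k : seq (R * set 'rV[R]_n) :=
  [seq (y, h k @^-1` [set y] `&` F k) | y <- finmap.enum_fset (fset_set (range (h k)))].
have he k : admissible_steps (e k).
  move=> p /mapP[y _ ->] /=; have [mF Fk] := Foo k; split.
    exact: measurableI.
  by rewrite (le_lt_trans _ Fk)// le_measure ?inE//; exact: measurableI.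
have eE k u : step_fun (e k) u = h k u * \1_(F k) u.
  rewrite /step_fun big_map [in RHS](fimfunE (h k) u) fsbig_finite//=.
  by rewrite mulr_suml; apply: eq_bigr => y _; rewrite indicI/= mulrA.
have hf k u : h k u <= f u.
  by rewrite -lee_fin /h nnsfun_approxE le_approx// => x _; rewrite lee_fin.
have mge : measurable_fun setT (cst 0 : 'rV[R]_n -> R) by [].
have c0 := @cvg_Rintegral_dominated _ _ _ mu setT
  (fun k u => (f u - step_fun (e k) u) ^+ 2) (cst 0)
  (fun u => (f u ^+ 2)%:E) measurableT.
have hc : msq mu (fun u => f u - step_fun (e k) u) @[k --> \oo] --> 0.
  have [] := c0 => //.
  - by move=> k; apply: measurable_funX; case: (sqintB sf (sqint_step_fun (he k))).
  - apply: aeW => u _ /=.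
    have hcv : h k u @[k --> \oo] --> f u.
      have fge0 x : [set: 'rV[R]_n] x -> (0 <= (EFin \o f) x)%E.
        by move=> _; rewrite lee_fin.
      exact: (fine_cvg (cvg_nnsfun_approx measurableT mEf fge0 (I : setT u))).
    have hFcv : step_fun (e k) u @[k --> \oo] --> f u.
      have : [set: 'rV[R]_n] u by []; rewrite FT => -[N _ FN].
      apply: cvg_trans hcv; apply: near_eq_cvg.
      exists N => // k /= Nk; rewrite eE indicE mem_set ?mulr1//.
      by move: FN; apply/subsetPset/ndF.
    have c : f u - step_fun (e k) u @[k --> \oo] --> f u - f u.
      by apply: cvgB => //; exact: cvg_cst.
    have := cvg_comp _ _ c (@exprn_continuous R 2 (f u - f u)).
    by rewrite subrr expr0n /=; exact.
  - move=> k u _; rewrite lee_fin ger0_norm ?sqr_ge0// eE.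
    have h0 : 0 <= h k u * \1_(F k) u.
      by rewrite mulr_ge0// indicE; case: (_ \in _).
    have h1 : h k u * \1_(F k) u <= f u.
      rewrite (le_trans _ (hf k u))// indicE; case: (_ \in _); rewrite ?mulr1//.
      by rewrite mulr0.
    by rewrite lerXn2r ?nnegrE ?subr_ge0// gerBl.
  by move=> _; rewrite [X in _ --> X](_ : _ = 0)// /Rintegral integral0.
move/cvgrPdist_le : hc => /(_ _ eps0) [N _ /(_ N (leqnn N)) /=].
rewrite sub0r normrN ger0_norm ?msq_ge0// => hN.
by exists (e N).
Qed.

Lemma step_dense (f : 'rV[R]_n -> R) (eps : R) : sqint mu f -> 0 < eps ->
  exists2 e, admissible_steps e &
    msq mu (fun u => f u - step_fun e u) <= eps.
Proof.
move=> sf eps0; have [mf fi] := sf.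
have part (g : 'rV[R]_n -> R) : measurable_fun setT g ->
    (forall u, `|g u| <= `|f u|) -> sqint mu g.
  move=> mg gf; split=> //; apply: le_integrable fi => //.
    by apply/measurable_EFinP; exact: measurable_funX.
  move=> u _ /=; rewrite lee_fin !ger0_norm ?sqr_ge0//.
  rewrite -[leLHS]real_normK ?num_real// -[leRHS]real_normK ?num_real//.
  by rewrite lerXn2r ?nnegrE.
pose fp u := Num.max (f u) 0; pose fn u := Num.max (- f u) 0.
have sp : sqint mu fp.
  apply: part; first exact: measurable_maxr.
  by move=> u; rewrite /fp maxEle; case: ifPn; rewrite ?normr0.
have sn : sqint mu fn.
  apply: part; first by apply: measurable_maxr => //; exact: measurableT_comp.
  by move=> u; rewrite /fn maxEle; case: ifPn; rewrite ?normr0// normrN.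
have eps4 : 0 < eps / 4 by rewrite divr_gt0.
have [u|ep hp ep4] := step_dense_ge0 sp _ eps4.
  by rewrite /fp le_max lexx orbT.
have [u|en hn en4] := step_dense_ge0 sn _ eps4.
  by rewrite /fn le_max lexx orbT.
exists (ep ++ scale_steps (-1) en).
  by apply: admissible_cat => //; exact: admissible_scale.
have -> : (fun u => f u - step_fun (ep ++ scale_steps (-1) en) u) =
    fun u => (fp u - step_fun ep u) + (-1) * (fn u - step_fun en u).
  apply/funext => u; rewrite step_fun_cat step_fun_scale /fp /fn !maxEle.
  by case: ifPn => h1; case: ifPn => h2; lra.
have s1 := sqintB sp (sqint_step_fun hp).
have s2 := sqintB sn (sqint_step_fun hn).
rewrite (le_trans (msqD_le s1 (sqintZ _ s2)))// msqZ//; lra.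
Qed.

End step_dense.

Section wiener_integral_exists.
Context d (T : measurableType d) (R : realType) (P : probability T R) (n : nat).
Local Notation mu := (lebesgue_rV R n).
Variable Z : set 'rV[R]_n -> T -> R.
Hypothesis wnZ : white_noise P Z.

(** Step functions within 8 ^- k / 4 of f have increments of energy at most
    8 ^- k; the isometry transfers this to their integrals, which therefore
    converge. *)
Lemma is_wiener_integral_exists (f : 'rV[R]_n -> R) : sqint mu f ->
  is_wiener_integral P Z f (wiener_integral P Z f).
Proof.
move=> sf; rewrite /wiener_integral; apply: xgetPex.
have /choice[e_ he] : forall k : nat, exists e, admissible_steps e /\
    msq mu (fun u => f u - step_fun e u) <= 8^-1 ^+ k / 4.
  move=> k; have [|e he1 he2] := step_dense sf (_ : 0 < 8^-1 ^+ k / 4).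
    by rewrite divr_gt0// exprn_gt0.
  by exists e.
have ha k : admissible_steps (e_ k) by case: (he k).
have hs k := sqint_step_fun (ha k).
have hS k := sqint_step_integral wnZ (ha k).
have [k|I sI cI] := sqint_complete hS.
  have -> : (fun w => step_integral Z (e_ k.+1) w - step_integral Z (e_ k) w) =
      step_integral Z (e_ k.+1 ++ scale_steps (-1) (e_ k)).
    apply/funext => w; rewrite step_integral_cat step_integral_scale.
    by rewrite mulN1r.
  rewrite step_isometry//; last first.
    by apply: admissible_cat => //; exact: admissible_scale.
  have -> : step_fun (e_ k.+1 ++ scale_steps (-1) (e_ k)) =
      fun u => (-1) * (f u - step_fun (e_ k.+1) u) + (f u - step_fun (e_ k) u).
    apply/funext => u; rewrite step_fun_cat step_fun_scale; ring.
  have s1 := sqintB sf (hs k.+1); have s2 := sqintB sf (hs k).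
  rewrite (le_trans (msqD_le (sqintZ (-1) s1) s2))// msqZ// sqrrN expr1n mul1r.
  have [_ h1] := he k.+1; have [_ h2] := he k.
  have p8 : 0 <= 8^-1 ^+ k :> R by rewrite exprn_ge0.
  by move: h1 h2; rewrite exprS; lra.
exists I; apply/is_wiener_integralP => //; split=> //; exists e_; split=> //.
have half0 : 8^-1 ^+ k / 4 @[k --> \oo] --> (0 : R).
  have h : 8^-1 ^+ k @[k --> \oo] --> (0 : R).
    have := @cvg_geometric R 1 8^-1; rewrite /geometric/=.
    under eq_fun do rewrite mul1r.
    by apply; rewrite ger0_norm// invf_lt1// ltr1n.
  by rewrite -[X in _ --> X](mul0r (4^-1)); apply: cvgM => //; exact: cvg_cst.
apply: (@squeeze_cvgr _ _ _ _ (cst 0) (fun k => 8^-1 ^+ k / 4)) => //.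
- by apply: nearW => k; rewrite msq_ge0; case: (he k).
- exact: cvg_cst.
Qed.

End wiener_integral_exists.

(** * Weighted integrals of the random field *)

Section fubini_weighted.
Context (R : realType).

Lemma measurable_Rintegral_param d1 d2 (T1 : measurableType d1)
    (T2 : measurableType d2) (m2 : {sigma_finite_measure set T2 -> \bar R})
    (h : T1 * T2 -> R) : measurable_fun setT h ->
  measurable_fun setT (fun x => \int[m2]_y h (x, y)).
Proof.
move=> mh; have mEh : measurable_fun setT (EFin \o h) by exact/measurable_EFinP.
apply: (measurableT_comp (fine_measurable measurableT)).
rewrite (_ : (fun x => _) = fun x => (fubini_F m2 (EFin \o h)^\+ x -
  fubini_F m2 (EFin \o h)^\- x)%E).
  apply: emeasurable_funB; apply: measurable_fun_fubini_tonelli_F => //.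
  - exact: measurable_funepos.
  - exact: measurable_funeneg.
apply/funext => x /=.
have hp : fubini_F m2 (EFin \o h)^\+%E x =
    (\int[m2]_y (fun y => (h (x, y))%:E)^\+ y)%E.
  by apply: eq_integral => y _; rewrite !funeposE.
have hn : fubini_F m2 (EFin \o h)^\-%E x =
    (\int[m2]_y (fun y => (h (x, y))%:E)^\- y)%E.
  by apply: eq_integral => y _; rewrite !funenegE.
by rewrite hp hn integralE.
Qed.

(** An integrable weight F on one side and a uniform bound on the norms of the
    sections k (x, _) on the other make F * k jointly integrable. *)
Lemma Fubini_weighted d1 d2 (T1 : measurableType d1) (T2 : measurableType d2)
    (m1 : {sigma_finite_measure set T1 -> \bar R})
    (m2 : {sigma_finite_measure set T2 -> \bar R})
    (F : T1 -> R) (k : T1 * T2 -> R) (M : R) :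
  m1.-integrable setT (EFin \o F) -> measurable_fun setT k ->
  (forall x, m2.-integrable setT (fun y => (k (x, y))%:E)) ->
  (forall x, \int[m2]_y `|k (x, y)| <= M) ->
  [/\ \int[m1]_x (F x * \int[m2]_y k (x, y)) =
      \int[m2]_y \int[m1]_x (F x * k (x, y)),
      {ae m2, forall y, m1.-integrable setT (fun x => (F x * k (x, y))%:E)} &
      m2.-integrable setT (fun y => (\int[m1]_x (F x * k (x, y)))%:E)].
Proof.
move=> iF mk ik kM.
have mF : measurable_fun setT F by apply/measurable_EFinP; exact: measurable_int iF.
pose f (z : T1 * T2) : \bar R := (F z.1 * k z)%:E.
have mf : measurable_fun setT f.
  apply/measurable_EFinP; apply: measurable_funM => //.
  exact: (measurableT_comp mF measurable_fst).
have if_ : (m1 \x m2)%E.-integrable setT f.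
  apply/(integrable12ltyP m1 m2 mf).
  apply: (@le_lt_trans _ _ (\int[m1]_x (`|F x|%:E * M%:E))%E).
    apply: ge0_le_integral => //.
    - by move=> x _; apply: integral_ge0.
    - rewrite (_ : (fun x => _) = fubini_F m2 (abse \o f))//.
      apply: measurable_fun_fubini_tonelli_F => //.
        by apply: measurableT_comp => //; exact: mf.
      by move=> z; exact: abse_ge0.
    - by apply: emeasurable_funM => //; apply/measurable_EFinP; exact: measurableT_comp.
    move=> x _; rewrite /f /=.
    under eq_integral do rewrite normrM EFinM.
    rewrite ge0_integralZl//; last first.
      apply/measurable_EFinP/measurableT_comp => //; exact: (measurable_fun_pair2 x mk).
    have ix : m2.-integrable setT (EFin \o (fun y => k (x, y))) by exact: ik.
    rewrite lee_wpmul2l// -[leLHS]fineK; first by rewrite lee_fin; exact: kM.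
    exact: (integrable_fin_num _ (integrable_norm ix)).
  have iaF := integrable_norm iF.
  have -> : (\int[m1]_x (`|F x|%:E * M%:E) =
      (\int[m1]_x `|F x|%:E) * M%:E)%E by rewrite integralZr.
  by rewrite -(fineK (integrable_fin_num _ iaF))// -EFinM ltry.
have ae2 := ae_integrable2 if_.
have FubE := Fubini if_.
have mG : measurable_fun setT (fun y => \int[m1]_x (F x * k (x, y))).
  have := @measurable_Rintegral_param _ _ _ _ m1
    (fun z : T2 * T1 => F z.2 * k (z.2, z.1)).
  apply; apply: measurable_funM; first exact: (measurableT_comp mF measurable_snd).
  by apply: (measurableT_comp mk); exact: measurable_swap.
have lG := (integrable21ltyP m1 m2 mf).1 if_.
have mG' := measurable_fubini_G if_.
have aeE : ae_eq m2 setT (fun y => (\int[m1]_x (F x * k (x, y)))%:E)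
    (fubini_G m1 f).
  apply: filterS ae2 => y iy _; rewrite /Rintegral fineK//.
  exact: integrable_fin_num.
split => //.
- rewrite {1}/Rintegral.
  under eq_integral => x _.
    rewrite EFinM fineK; last exact: integrable_fin_num.
    rewrite -integralZl//; over.
  rewrite /= [RHS]/Rintegral; congr fine.
  transitivity (\int[m2]_y fubini_G m1 f y)%E; last first.
    by apply/esym/ae_eq_integral => //; exact/measurable_EFinP.
  by rewrite /fubini_G -FubE; apply: eq_integral => x _; apply: eq_integral.
- apply/integrableP; split; first exact/measurable_EFinP.
  apply: le_lt_trans lG; apply: ge0_le_integral => //.
  + by apply: measurableT_comp => //; exact/measurable_EFinP.
  + rewrite (_ : (fun y => _) = fubini_G m1 (abse \o f))//.
    apply: measurable_fun_fubini_tonelli_G => //.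
      by apply: measurableT_comp => //; exact: mf.
    by move=> z; exact: abse_ge0.
  move=> y _; have mfy : measurable_fun setT (fun x => f (x, y)).
    exact: (measurable_fun_pair1 y mf).
  apply: le_trans (le_abse_integral _ _ mfy) => //.
  by rewrite /Rintegral /f/=; case: integral => [r||]//=; rewrite ?normr0 ?leey.
Qed.

Lemma finite_measureW d (T : measurableType d)
    (mu : {measure set T -> \bar R}) : (mu setT < +oo)%E ->
  exists nu : {finite_measure set T -> \bar R}, forall A, nu A = mu A.
Proof.
move=> fmu; have h : fin_num_fun mu by apply: lty_fin_num_fun.
have m0 : (mu set0 < +oo)%E by rewrite measure0.
pose H1 := isFinite.Build _ _ _ _ h.
pose H2 := isSFinite.Build _ _ _ _ (sfinite_measure_sigma_finite
  (fin_num_fun_sigma_finite m0 h)).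
pose H3 := isSigmaFinite.Build _ _ _ _ (fin_num_fun_sigma_finite m0 h).
pose nu := HB.pack_for (FiniteMeasure.type T R) (Measure.sort mu) H1 H2 H3.
by exists nu.
Qed.

End fubini_weighted.

Section dotp_measurable.
Context (R : realType) (n : nat).

Lemma measurable_dotp d (U : measurableType d) (f g : U -> 'rV[R]_n) :
  measurable_fun setT f -> measurable_fun setT g ->
  measurable_fun setT (fun z => dotp (f z) (g z)).
Proof.
move=> /measurable_rVP mf /measurable_rVP mg.
by apply: measurable_sum => i; exact: measurable_funM.
Qed.

Lemma dotpBr (u x y : 'rV[R]_n) : dotp u (x - y) = dotp u x - dotp u y.
Proof. by rewrite /dotp -sumrB; apply: eq_bigr => i _; rewrite !mxE mulrBr. Qed.

Lemma measurable_enorm : measurable_fun setT (@enorm R n).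
Proof.
rewrite /enorm; apply: (measurableT_comp (f := @Num.sqrt R)).
  by apply: continuous_measurable_fun; exact: sqrt_continuous.
apply: measurable_sum => i.
by apply: measurable_funM; exact: measurable_coord_rV.
Qed.

End dotp_measurable.

Section field_integral.
Context d (T : measurableType d) (R : realType) (P : probability T R) (n : nat).
Local Notation mu := (lebesgue_rV R n).
Implicit Types (F : 'rV[R]_n -> R) (D : 'rV[R]_n * T -> R).

Let integrable_abs F : mu.-integrable setT (EFin \o F) ->
  mu.-integrable setT (EFin \o (fun x => `|F x|)).
Proof. exact: integrable_norm. Qed.

(** Cauchy-Schwarz for the measure of density |F|, for fixed w, followed by
    Tonelli's theorem. *)
Lemma weighted_energy F D (V : R) : mu.-integrable setT (EFin \o F) ->
  measurable_fun setT D -> (forall x, sqint P (fun w => D (x, w))) ->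
  (forall x, msq P (fun w => D (x, w)) <= V) ->
  [/\ sqint P (fun w => \int[mu]_x (F x * D (x, w))),
      msq P (fun w => \int[mu]_x (F x * D (x, w))) <=
        (\int[mu]_x `|F x|) * \int[mu]_x (`|F x| * msq P (fun w => D (x, w))) &
      {ae P, forall w, mu.-integrable setT (fun x => (F x * D (x, w))%:E)}].
Proof.
move=> iF mD sD VD; have iaF := integrable_abs iF.
have mF : measurable_fun setT F by apply/measurable_EFinP; exact: measurable_int iF.
have [|||E1 E2 E3] := @Fubini_weighted _ _ _ _ _ mu P (fun x => `|F x|)
  (fun z => D z ^+ 2) V iaF.
- exact: measurable_funX.
- by move=> x; case: (sD x).
- move=> x; rewrite (le_trans _ (VD x))// le_eqVlt; apply/orP; left; apply/eqP.
  by apply: eq_Rintegral => w _; rewrite ger0_norm// sqr_ge0.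
set J := fun w => _; set A := \int[mu]_x `|F x|.
have A0 : 0 <= A by apply: Rintegral_ge0.
have mJ : measurable_fun setT J.
  apply: (@measurable_Rintegral_param _ _ _ _ _ mu (fun z => F z.2 * D (z.2, z.1))).
  apply: measurable_funM; first exact: (measurableT_comp mF measurable_snd).
  by apply: (measurableT_comp mD); exact: measurable_swap.
have aew : {ae P, forall w, mu.-integrable setT (fun x => (F x * D (x, w))%:E) /\
    J w ^+ 2 <= A * \int[mu]_x (`|F x| * D (x, w) ^+ 2)}.
  apply: filterS E2 => w iw; apply: Rintegral_weighted_sqr => //.
  exact: (measurable_fun_pair1 w mD).
have iB : P.-integrable setT
    (EFin \o (fun w => A * \int[mu]_x (`|F x| * D (x, w) ^+ 2))).
  exact: (integrable_scale A E3).
have le1 : (\int[P]_w (J w ^+ 2)%:E <=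
    \int[P]_w (A * \int[mu]_x (`|F x| * D (x, w) ^+ 2))%:E)%E.
  apply: ae_ge0_le_integral => //.
  - by move=> w _; rewrite lee_fin sqr_ge0.
  - by apply/measurable_EFinP; exact: measurable_funX.
  - move=> w _; rewrite lee_fin mulr_ge0//; apply: Rintegral_ge0 => x _.
    by rewrite mulr_ge0// sqr_ge0.
  - exact: measurable_int iB.
  - by apply: filterS aew => w [_ h] _; rewrite lee_fin.
have sJ : sqint P J.
  by apply: sqintP => //; apply: le_lt_trans le1 _; exact: integrable_lty.
split=> //; last by apply: filterS aew => w [].
rewrite -lee_fin msqE// (le_trans le1)//.
rewrite [X in (_ <= (_ * X)%:E)%E]E1 -RintegralZl// /Rintegral fineK//.
exact: integrable_fin_num.
Qed.

Lemma weighted_pairing F D (V : R) (Y : T -> R) :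
  mu.-integrable setT (EFin \o F) ->
  measurable_fun setT D -> (forall x, sqint P (fun w => D (x, w))) ->
  (forall x, msq P (fun w => D (x, w)) <= V) -> sqint P Y ->
  \int[P]_w ((\int[mu]_x (F x * D (x, w))) * Y w) =
  \int[mu]_x (F x * \int[P]_w (D (x, w) * Y w)).
Proof.
move=> iF mD sD VD sY; have [mY iY] := sY.
have mF : measurable_fun setT F by apply/measurable_EFinP; exact: measurable_int iF.
have [sJ _ aeJ] := weighted_energy iF mD sD VD.
have [|||E1 _ iE] := @Fubini_weighted _ _ _ _ _ mu P F
  (fun z => D z * Y z.2) (V + msq P Y) iF.
- by apply: measurable_funM => //; exact: (measurableT_comp mY measurable_snd).
- by move=> x; exact: sqint_mul.
- move=> x /=; apply: le_trans (lerD (VD x) (lexx _)).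
  have [_ iD] := sD x; rewrite /msq -RintegralD//; apply: le_Rintegral => //.
  + exact: (integrable_norm (sqint_mul (sD x) sY)).
  + exact: (integrable_add iD iY).
  + by move=> w _; rewrite ler_norml; apply/andP; split; nra.
rewrite E1 /Rintegral; congr fine; apply: ae_eq_integral => //.
- apply/measurable_EFinP; apply: measurable_funM => //; by case: sJ.
- exact: measurable_int iE.
apply: filterS aeJ => w iw _; congr EFin => /=.
rewrite -RintegralZr//; apply: eq_Rintegral => x _; by rewrite mulrA.
Qed.

Variable xi : 'rV[R]_n -> T -> R.
Hypothesis mxi : measurable_field xi.
Hypothesis gxi : gaussian_family P setT xi.
Hypothesis zxi : zero_mean P xi.
Hypothesis cxi : mean_square_continuous P xi.
Variable Fs : {measure set 'rV[R]_n -> \bar R}.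
Hypothesis sFs : spectral_measure P xi Fs.

Let gausslike_xi (s : seq (R * 'rV[R]_n)) :
  gausslike P (fun w => \sum_(p <- s) p.1 * xi p.2 w).
Proof. by apply: (gaussian_family_gausslike gxi) => // t _; exact: zxi. Qed.

Lemma sqint_field x : sqint P (xi x).
Proof.
have [+ _] := gausslike_xi [:: (1, x)].
by under [X in sqint _ X -> _]eq_fun do rewrite big_seq1 mul1r.
Qed.

Lemma cov_field x y :
  \int[P]_w (xi x w * xi y w) = \int[Fs]_u cos (dotp u (x - y)).
Proof.
have [_ h _] := sFs; have := h (x - y) y.
rewrite addrC subrK unlock !zxi /= => h'.
rewrite [RHS]/Rintegral -h' unlock /Rintegral; congr fine.
by apply: eq_integral => w _; rewrite !fctE /= !subr0.
Qed.

Lemma msq_field x : msq P (xi x) = fine (Fs setT).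
Proof.
rewrite /msq; under eq_Rintegral do rewrite expr2.
rewrite cov_field /Rintegral; congr fine.
rewrite -[RHS]mul1e -integral_cst//; apply: eq_integral => u _.
rewrite subrr /dotp big1 ?cos0// => i _; by rewrite mxE mulr0.
Qed.

(** Mean-square continuity covers the space by countably many sets C j on which
    xi x is within e1 of xi (v j) in mean square, with rational points v j.
    Replacing xi by xi (v j) on the j-th of the disjoint sets C' j, for j < N,
    turns the integral into a finite combination of values of xi; the error
    comes from e1 and from the mass of F outside the first N sets. *)
Lemma field_approx F (eps : R) : mu.-integrable setT (EFin \o F) -> 0 < eps ->
  exists2 J, gausslike P J &
    msq P (fun w => \int[mu]_x (F x * xi x w) - J w) <= eps.
Proof.
move=> iF eps0; have iaF := integrable_abs iF.
have mF : measurable_fun setT F by apply/measurable_EFinP; exact: measurable_int iF.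
have mxi' : measurable_fun setT (fun z : 'rV[R]_n * T => xi z.1 z.2) := mxi.
pose A := \int[mu]_x `|F x|; have A0 : 0 <= A by apply: Rintegral_ge0.
pose B := fine (Fs setT); have B0 : 0 <= B by exact: fine_ge0.
pose v (j : nat) : 'rV[R]_n :=
  if unpickle j is Some q then map_mx ratr (q : 'rV[rat]_n) else 0.
pose e1 := eps / (2 * (A * A + 1)).
have AA1 : 0 < A * A + 1 by rewrite ltr_wpDl// mulr_ge0.
have e10 : 0 < e1 by rewrite divr_gt0// mulr_gt0.
pose dist j x := msq P (fun w => xi x w - xi (v j) w).
have mdist j : measurable_fun setT (dist j).
  apply: (@measurable_Rintegral_param _ _ _ _ _ P
    (fun z => (xi z.1 z.2 - xi (v j) z.2) ^+ 2)).
  apply: measurable_funX; apply: measurable_funB => //.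
  by apply: (measurableT_comp _ measurable_snd); case: (sqint_field (v j)).
pose C j := [set x | dist j x <= e1].
have mC j : measurable (C j).
  rewrite (_ : C j = dist j @^-1` `]-oo, e1]%classic); last first.
    by apply/seteqP; split=> x /=; rewrite in_itv.
  by rewrite -[X in measurable X]setTI; exact: mdist.
(* A rational point in the ball where xi is mean-square close to xi x. *)
have Ccover : \bigcup_j C j = setT.
  apply/seteqP; split=> // x _.
  have /fine_cvgP[fx] := cxi x.
  move=> /cvgrPdist_le/(_ _ e10) => hx.
  have /nbhs_ballP[r /= r0 hr] : \forall y \near x, dist 0%N x <= dist 0%N x /\
      msq P (fun w => xi y w - xi x w) <= e1.
    apply: filterS hx => y; rewrite sub0r normrN => hy; split=> //.
    by apply: le_trans hy; rewrite unlock; exact: ler_norm.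
  have /choice[q qx] : forall i, exists q : rat, `|x ord0 i - ratr q| < r.
    move=> i; have [|q] := @rat_in_itvoo R (x ord0 i - r) (x ord0 i + r).
      by rewrite ltrD2l gtrN.
    rewrite in_itv/= => /andP[q1 q2]; exists q.
    by rewrite ltr_norml; apply/andP; split; lra.
  have [|_ hv] := hr (map_mx ratr (\row_i q i)).
    by split=> // i j; rewrite !ord1 !mxE -ball_normE/=; exact: qx.
  exists (pickle (\row_i q i : 'rV[rat]_n)) => //=.
  rewrite /C /dist /= /v pickleK; apply: le_trans hv.
  rewrite le_eqVlt; apply/orP; left; apply/eqP; apply: eq_Rintegral => w _.
  by rewrite -sqrrN opprB.
pose C' := seqDU C.
have mC' j : measurable (C' j) by exact: seqDU_measurable.
have tC' : trivIset setT C' by exact: trivIset_seqDU.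
have C'cover : \bigcup_j C' j = setT by rewrite -seqDU_bigcup_eq.
pose D N (z : 'rV[R]_n * T) : R :=
  xi z.1 z.2 - \sum_(j < N) \1_(C' j) z.1 * xi (v j) z.2.
have mD N : measurable_fun setT (D N).
  apply: measurable_funB => //; apply: measurable_sum => j.
  apply: measurable_funM.
    have m1 : measurable_fun setT (\1_(C' j) : 'rV[R]_n -> R).
      exact: measurable_indic.
    exact: (measurableT_comp m1 measurable_fst).
  by apply: (measurableT_comp _ measurable_snd); case: (sqint_field (v j)).
have DE1 N x j : (j < N)%N -> C' j x ->
    (fun w => D N (x, w)) = fun w => xi x w - xi (v j) w.
  move=> jN C'x; apply/funext => w; rewrite /D/=; congr (_ - _).
  rewrite (bigD1 (Ordinal jN))//= indicE mem_set// mul1r big1 ?addr0//.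
  move=> i ij; rewrite indicE memNset ?mul0r// => C'ix.
  move: ij; apply/negP; rewrite negbK; apply/eqP/val_inj => /=.
  by apply: (tC' i j) => //; exists x.
have DE2 N x : (forall j, (j < N)%N -> ~ C' j x) ->
    (fun w => D N (x, w)) = xi x.
  move=> nC; apply/funext => w; rewrite /D/= big1 ?subr0// => j _.
  by rewrite indicE memNset ?mul0r//; exact: nC.
have C'in x : exists j, C' j x.
  by have : [set: 'rV[R]_n] x by []; rewrite -C'cover => -[j _ ?]; exists j.
have distC' j x : C' j x -> dist j x <= e1.
  by move=> C'x; have : C j x by case: C'x.
have sD N x : sqint P (fun w => D N (x, w)).
  have [j C'x] := C'in x; have [jN|jN] := ltnP j N.
    by rewrite (DE1 _ _ _ jN C'x); apply: sqintB; exact: sqint_field.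
  rewrite DE2; first exact: sqint_field.
  move=> i iN C'i; have : i = j by apply: (tC' i j) => //; exists x.
  by move=> ij; move: iN; rewrite ij ltnNge jN.
have msqD N x : msq P (fun w => D N (x, w)) <=
    e1 + B * \1_(~` \bigcup_(j < N) C' j) x.
  have [j C'x] := C'in x; have [jN|jN] := ltnP j N.
    by rewrite (DE1 _ _ _ jN C'x) (le_trans (distC' _ _ C'x))// lerDl mulr_ge0.
  have nC i : (i < N)%N -> ~ C' i x.
    move=> iN C'i; have : i = j by apply: (tC' i j) => //; exists x.
    by move=> ij; move: iN; rewrite ij ltnNge jN.
  rewrite DE2// msq_field -/B indicE mem_set ?mulr1 ?lerDr ?ltW//.
  by move=> [i /= iN]; exact: nC.
have msqD1 N x : msq P (fun w => D N (x, w)) <= e1 + B.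
  by rewrite (le_trans (msqD N x))// lerD2l ler_piMr// indicE lern1 leq_b1.
pose tail N := \int[mu]_x (`|F x| * \1_(~` \bigcup_(j < N) C' j) x).
have mtl N : measurable (~` \bigcup_(j < N) C' j).
  by apply/measurableC/bigcup_measurable => j _.
have mtail N : measurable_fun setT (fun x => `|F x| * \1_(~` \bigcup_(j < N) C' j) x).
  by apply: measurable_funM; [exact: measurableT_comp|exact: measurable_indic].
have tail0 : tail N @[N --> \oo] --> 0.
  have [||] := @cvg_Rintegral_dominated _ _ _ mu setT
    (fun N x => `|F x| * \1_(~` \bigcup_(j < N) C' j) x) (cst 0)
    (EFin \o (fun x => `|F x|)) measurableT mtail (measurable_cst _) _ iaF.
  - apply: aeW => x _ /=; have [j C'x] := C'in x.
    apply: (@cvg_near_cst) => //; exists j.+1 => // N /= jN.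
    by rewrite indicE memNset ?mulr0// => nU; apply: nU; exists j.
  - move=> N x _ /=; rewrite lee_fin normrM normr_id ler_piMr// indicE.
    by case: (_ \in _); rewrite ?normr1 ?normr0.
  by move=> _; rewrite [X in _ --> X](_ : _ = 0)// /Rintegral integral0.
have [N hN] : exists N, A * (B * tail N) <= eps / 2.
  have : A * (B * tail N) @[N --> \oo] --> A * (B * 0).
    by do 2 (apply: cvgM; first exact: cvg_cst).
  have eps2 : 0 < eps / 2 by rewrite divr_gt0.
  rewrite !mulr0 => /cvgrPdist_le/(_ _ eps2) [N _ /(_ N (leqnn N)) /=].
  by rewrite sub0r normrN => /(le_trans (ler_norm _)) ?; exists N.
have msqB x : msq P (xi x) <= B by rewrite msq_field.
have [sI _ aeI] := weighted_energy iF mxi' sqint_field msqB.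
have [sID hID _] := weighted_energy iF (mD N) (sD N) (msqD1 N).
pose c (j : nat) := \int[mu]_x (F x * \1_(C' j) x).
have iFC (j : nat) : mu.-integrable setT (EFin \o (fun x => F x * \1_(C' j) x)).
  apply: le_integrable iF => //.
    by apply/measurable_EFinP; apply: measurable_funM => //; exact: measurable_indic.
  move=> x _ /=; rewrite lee_fin normrM ler_piMr// indicE.
  by case: (_ \in _); rewrite ?normr1 ?normr0.
pose J w := \sum_(p <- [seq (c j, v j) | j <- index_iota 0 N]) p.1 * xi p.2 w.
exists J; first exact: gausslike_xi.
have JE w : J w = \sum_(j < N) c j * xi (v j) w by rewrite /J big_map big_mkord.
have sJ : sqint P J by case: (gausslike_xi [seq (c j, v j) | j <- index_iota 0 N]).
have -> : msq P (fun w => \int[mu]_x (F x * xi x w) - J w) =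
    msq P (fun w => \int[mu]_x (F x * D N (x, w))).
  rewrite /msq /Rintegral; congr fine; apply: ae_eq_integral => //.
  - by apply/measurable_EFinP/measurable_funX; case: (sqintB sI sJ).
  - by apply/measurable_EFinP/measurable_funX; case: sID.
  apply: filterS aeI => w iw _ /=; congr (_ ^+ 2)%:E.
  have iFCx (j : 'I_N) : mu.-integrable setT
      (EFin \o (fun x => F x * \1_(C' j) x * xi (v j) w)).
    exact: (integrable_scaler (xi (v j) w) (iFC j)).
  have [is1 is2] := Rintegral_sum (index_enum 'I_N) iFCx.
  rewrite JE.
  have -> : \sum_(j < N) c j * xi (v j) w =
      \int[mu]_x \sum_(j < N) F x * \1_(C' j) x * xi (v j) w.
    rewrite is2; apply: eq_bigr => j _; rewrite /c -RintegralZr//; exact: iFC.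
  rewrite -RintegralB//; apply: eq_Rintegral => x _.
  rewrite /D/= mulrBr mulr_sumr; congr (_ - _); apply: eq_bigr => j _.
  by rewrite mulrA.
apply: (le_trans hID); rewrite -/A.
have i1 : mu.-integrable setT (EFin \o (fun x => e1 * `|F x|)).
  exact: (integrable_scale e1 iaF).
have itl : mu.-integrable setT
    (EFin \o (fun x => `|F x| * \1_(~` \bigcup_(j < N) C' j) x)).
  apply: le_integrable iaF => //; first exact/measurable_EFinP.
  move=> x _ /=; rewrite lee_fin normrM ler_piMr// indicE.
  by case: (_ \in _); rewrite ?normr1 ?normr0.
have i2 : mu.-integrable setT
    (EFin \o (fun x => B * (`|F x| * \1_(~` \bigcup_(j < N) C' j) x))).
  exact: (integrable_scale B itl).
have le2 : \int[mu]_x (`|F x| * msq P (fun w => D N (x, w))) <=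
    e1 * A + B * tail N.
  rewrite /A /tail -!RintegralZl// -RintegralD//; apply: le_Rintegral => //.
  - apply: le_integrable (integrableZl _ (e1 + B) iaF) => //.
      apply/measurable_EFinP; apply: measurable_funM; first exact: measurableT_comp.
      apply: (@measurable_Rintegral_param _ _ _ _ _ P (fun z => D N z ^+ 2)).
      exact: measurable_funX.
    move=> x _ /=; rewrite lee_fin !normrM normr_id [leRHS]mulrC ler_wpM2l//.
    by rewrite !ger0_norm ?msq_ge0 ?addr_ge0// ltW.
  - exact: (integrable_add i1 i2).
  - move=> x _; apply: le_trans (ler_wpM2l (normr_ge0 (F x)) (msqD N x)) _.
    by rewrite mulrDr [_ * e1]mulrC mulrCA.
apply: (le_trans (ler_wpM2l A0 le2)); rewrite mulrDr [leRHS](splitr eps).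
apply: lerD hN; rewrite mulrCA mulrC /e1 mulrA ler_pdivrMr ?mulr_gt0//.
have -> : eps / 2 * (2 * (A * A + 1)) = A * A * eps + eps by field.
by rewrite lerDl ltW.
Qed.

(** A mean-square limit of finite linear combinations of values of xi. *)
Lemma field_integral_gausslike F : mu.-integrable setT (EFin \o F) ->
  gausslike P (fun w => \int[mu]_x (F x * xi x w)).
Proof.
move=> iF; have mxi' : measurable_fun setT (fun z : 'rV[R]_n * T => xi z.1 z.2) := mxi.
have msqB x : msq P (xi x) <= fine (Fs setT) by rewrite msq_field.
have [sI _ _] := weighted_energy iF mxi' sqint_field msqB.
have /choice[J hJ] : forall k : nat, exists J, gausslike P J /\
    msq P (fun w => \int[mu]_x (F x * xi x w) - J w) <= k.+1%:R^-1.
  move=> k; have k0 : 0 < k.+1%:R^-1 :> R by rewrite invr_gt0.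
  by have [J ? ?] := field_approx iF k0; exists J.
apply: (@gausslike_lim _ _ _ P _ J) => // [k|]; first by case: (hJ k).
apply: (@squeeze_cvgr _ _ _ _ (cst 0) (fun k => k.+1%:R^-1)).
- by apply: nearW => k; rewrite msq_ge0; case: (hJ k).
- exact: cvg_cst.
- exact: cvg_harmonic.
Qed.

(** Fubini's theorem turns the second moment into the integral of
    F x * F y * cos (dotp u (x - y)) over x, y and u, that is the integral of
    the squared modulus of the Fourier transform of F against Fs; its imaginary
    part vanishes by hypothesis. *)
Lemma field_integral_msq F : mu.-integrable setT (EFin \o F) ->
  (forall u, \int[mu]_x (F x * sin (dotp u x)) = 0) ->
  msq P (fun w => \int[mu]_x (F x * xi x w)) =
  \int[Fs]_u (\int[mu]_x (F x * cos (dotp u x))) ^+ 2.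
Proof.
move=> iF S0; have iaF := integrable_abs iF.
have mF : measurable_fun setT F by apply/measurable_EFinP; exact: measurable_int iF.
have mxi' : measurable_fun setT (fun z : 'rV[R]_n * T => xi z.1 z.2) := mxi.
have msqB x : msq P (xi x) <= fine (Fs setT) by rewrite msq_field.
have [sI _ _] := weighted_energy iF mxi' sqint_field msqB.
have [Foo _ _] := sFs; have [Ff FfE] := finite_measureW Foo.
have RFf (h : 'rV[R]_n -> R) : \int[Fs]_u h u = \int[Ff]_u h u.
  by rewrite /Rintegral; congr fine; apply: eq_measure_integral => A _ _; exact/esym/FfE.
have icst (c : R) : Ff.-integrable setT (EFin \o cst c).
  exact: finite_measure_integrable_cst.
have ibnd (h : 'rV[R]_n -> R) c : measurable_fun setT h -> (forall u, `|h u| <= c) ->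
    Ff.-integrable setT (EFin \o h).
  move=> mh hc; apply: (le_integrable measurableT _ _ (icst c)) => //.
    exact/measurable_EFinP.
  by move=> x _ /=; rewrite lee_fin (le_trans (hc x))// ler_norm.
have lebnd (h : 'rV[R]_n -> R) c : measurable_fun setT h -> (forall u, `|h u| <= c) ->
    \int[Ff]_u `|h u| <= \int[Ff]_u c.
  move=> mh hc; apply: le_Rintegral => //; first exact: (integrable_norm (ibnd _ _ mh hc)).
  exact: icst.
have mdot u : measurable_fun setT (dotp (n := n) (R := R) u).
  exact: measurable_dotp.
have mdotl y : measurable_fun setT (fun u => dotp (n := n) (R := R) u y).
  exact: measurable_dotp.
pose C u := \int[mu]_x (F x * cos (dotp u x)).
have iFc (h : 'rV[R]_n -> R) : measurable_fun setT h -> (forall x, `|h x| <= 1) ->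
    mu.-integrable setT (EFin \o (fun x => F x * h x)).
  move=> mh h1; apply: le_integrable iF => //.
    by apply/measurable_EFinP; exact: measurable_funM.
  by move=> x _ /=; rewrite lee_fin normrM ler_piMr.
have mcosd u : measurable_fun setT (fun x : 'rV[R]_n => cos (dotp u x)).
  exact: (measurableT_comp (@measurable_cos R)).
have msind u : measurable_fun setT (fun x : 'rV[R]_n => sin (dotp u x)).
  exact: (measurableT_comp (@measurable_sin R)).
have iFcos u : mu.-integrable setT (EFin \o (fun x => F x * cos (dotp u x))).
  by apply: iFc => // x; exact: cos_max.
have iFsin u : mu.-integrable setT (EFin \o (fun x => F x * sin (dotp u x))).
  by apply: iFc => // x; exact: sin_max.
pose A := \int[mu]_x `|F x|.
have CA u : `|C u| <= A.
  rewrite (le_trans (le_normr_Rintegral _ (iFcos u)))//.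
  apply: le_Rintegral => //; first exact: (integrable_norm (iFcos u)).
  by move=> x _; rewrite normrM ler_piMr// cos_max.
have mC : measurable_fun setT C.
  apply: (@measurable_Rintegral_param _ _ _ _ _ mu
    (fun z => F z.2 * cos (dotp z.1 z.2))).
  apply: measurable_funM; first exact: (measurableT_comp mF measurable_snd).
  apply: (measurableT_comp (@measurable_cos R)).
  by apply: measurable_dotp; [exact: measurable_fst|exact: measurable_snd].
have conv y : \int[mu]_x (F x * \int[P]_w (xi x w * xi y w)) =
    \int[Ff]_u (C u * cos (dotp u y)).
  rewrite (@eq_Rintegral _ _ _ mu _ (fun x => F x * \int[Ff]_u cos (dotp u (x - y))));
    last by move=> x _; rewrite cov_field RFf.
  have mk : measurable_fun setT
      (fun z : 'rV[R]_n * 'rV[R]_n => cos (dotp z.2 (z.1 - y))).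
    apply: (measurableT_comp (@measurable_cos R)).
    under eq_fun do rewrite dotpBr.
    apply: measurable_funB; last exact: (measurableT_comp (mdotl y) measurable_snd).
    by apply: measurable_dotp; [exact: measurable_snd|exact: measurable_fst].
  have [||-> _ _] := @Fubini_weighted _ _ _ _ _ mu Ff F
    (fun z => cos (dotp z.2 (z.1 - y))) (\int[Ff]_u 1) iF mk.
  - move=> x; apply: (ibnd _ 1); last by move=> u; exact: cos_max.
    exact: (measurable_fun_pair2 x mk).
  - move=> x; apply: lebnd; last by move=> u; exact: cos_max.
    exact: (measurable_fun_pair2 x mk).
  apply: eq_Rintegral => u _ /=.
  have i1 : mu.-integrable setT
      (EFin \o (fun x => F x * cos (dotp u x) * cos (dotp u y))).
    exact: (integrable_scaler (cos (dotp u y)) (iFcos u)).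
  have i2 : mu.-integrable setT
      (EFin \o (fun x => F x * sin (dotp u x) * sin (dotp u y))).
    exact: (integrable_scaler (sin (dotp u y)) (iFsin u)).
  rewrite (@eq_Rintegral _ _ _ mu _ (fun x => F x * cos (dotp u x) * cos (dotp u y) +
    F x * sin (dotp u x) * sin (dotp u y))); last first.
    by move=> x _; rewrite dotpBr cosB mulrDr !mulrA.
  by rewrite RintegralD// !RintegralZr// S0 mul0r addr0.
rewrite {1}/msq.
rewrite (@eq_Rintegral _ _ _ P _ (fun w => (\int[mu]_x (F x * xi x w)) *
  (\int[mu]_x (F x * xi x w)))); last by move=> w _; rewrite expr2.
rewrite (weighted_pairing iF mxi' sqint_field msqB sI)/=.
rewrite (@eq_Rintegral _ _ _ mu _
  (fun y => F y * \int[Ff]_u (C u * cos (dotp u y)))); last first.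
  move=> y _; rewrite -conv -(weighted_pairing iF mxi' sqint_field msqB (sqint_field y))/=.
  by congr (_ * _); apply: eq_Rintegral => w _; rewrite mulrC.
have mk : measurable_fun setT
    (fun z : 'rV[R]_n * 'rV[R]_n => C z.2 * cos (dotp z.2 z.1)).
  apply: measurable_funM; first exact: (measurableT_comp mC measurable_snd).
  apply: (measurableT_comp (@measurable_cos R)).
  by apply: measurable_dotp; [exact: measurable_snd|exact: measurable_fst].
have Ccos u y : `|C u * cos (dotp u y)| <= A.
  by rewrite normrM (le_trans _ (CA u))// ler_piMr// cos_max.
have [||/= -> _ _] := @Fubini_weighted _ _ _ _ _ mu Ff F
  (fun z => C z.2 * cos (dotp z.2 z.1)) (\int[Ff]_u A) iF mk.
- by move=> y; apply: (ibnd _ A) => //; exact: (measurable_fun_pair2 y mk).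
- by move=> y; apply: lebnd => //; exact: (measurable_fun_pair2 y mk).
rewrite RFf; apply: eq_Rintegral => u _ /=.
rewrite (@eq_Rintegral _ _ _ mu _ (fun x => F x * cos (dotp u x) * C u)); last first.
  by move=> x _; rewrite mulrAC mulrA.
by rewrite RintegralZr// -/(C u) -expr2.
Qed.

End field_integral.

(** * Polar coordinates *)

Section cdf_unique.
Context (R : realType).

Lemma measure_cdf_unique (m1 m2 : {measure set (measurableTypeR R) -> \bar R}) :
  (forall x : R, m1 `]-oo, x]%classic = m2 `]-oo, x]%classic) ->
  (forall x : R, (m1 `]-oo, x]%classic < +oo)%E) ->
  forall A : set R, measurable A -> m1 A = m2 A.
Proof.
move=> m12 m1oo.
have ocE (m : {measure set (measurableTypeR R) -> \bar R}) (a b : R) :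
    (forall x : R, (m `]-oo, x]%classic < +oo)%E) -> a <= b ->
    m `]a, b]%classic = (m `]-oo, b]%classic - m `]-oo, a]%classic)%E.
  move=> moo ab.
  have -> : `]a, b]%classic = `]-oo, b]%classic `\` `]-oo, a]%classic.
    apply/seteqP; split=> x /=; rewrite !in_itv/=.
      by move=> /andP[ax ->]; split=> //; apply/negP; rewrite -ltNge.
    by move=> [-> /negP]; rewrite -ltNge andbT.
  rewrite measureD//; last exact: moo.
  congr (_ - m _)%E; apply/seteqP; split=> x /=; rewrite !in_itv/=; first by case.
  by move=> xa; split=> //; exact: le_trans ab.
move=> A mA; apply: (@g_sigma_algebra_measure_unique _ R (measurableTypeR R)
  (@ocitv R) _ (fun k : nat => `]- k%:R, k%:R]%classic)) => //.
- by move=> _ [[a b] _ <-]; exact: measurable_itv.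
- by move=> k; exists (- k%:R, k%:R).
- apply/seteqP; split=> // x _; exists (Num.truncn `|x|).+1 => //=.
  rewrite in_itv/=; have : `|x| < (Num.truncn `|x|).+1%:R by rewrite truncnS_gt.
  by rewrite ltr_norml => /andP[-> /ltW].
- exact: ocitvI.
- move=> _ [[a b] _ <-] /=; have [ab|ba] := leP a b.
    by rewrite !ocE// ?m12// => x; rewrite -m12.
  by rewrite set_itv_ge ?measure0//= bnd_simp -leNgt ltW.
- move=> k; apply: le_lt_trans (m1oo k%:R); apply: le_measure; rewrite ?inE//.
  by move=> x /=; rewrite !in_itv/= => /andP[].
Qed.

End cdf_unique.

Section density_measure.
Context d (T : measurableType d) (R : realType).
Variables (mu : {measure set T -> \bar R}) (w : T -> R).
Hypotheses (mw : measurable_fun setT w) (w0 : forall x, 0 <= w x).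

Definition density_measure (A : set T) : \bar R := (\int[mu]_(x in A) (w x)%:E)%E.

Let density0 : density_measure set0 = 0%E.
Proof. by rewrite /density_measure integral_set0. Qed.

Let density_ge0 A : (0 <= density_measure A)%E.
Proof. by apply: integral_ge0 => x _; rewrite lee_fin. Qed.

Let density_sigma_additive : semi_sigma_additive density_measure.
Proof.
move=> F mF tF mUF; rewrite /density_measure.
rewrite ge0_integral_bigcup//; last 2 first.
- by apply: measurable_funTS; exact/measurable_EFinP.
- by move=> x _; rewrite lee_fin.
by apply: is_cvg_ereal_nneg_natsum_cond => k _ _; exact: density_ge0.
Qed.

HB.instance Definition _ := isMeasure.Build _ _ _ density_measure
  density0 density_ge0 density_sigma_additive.

Definition density_meas : {measure set T -> \bar R} := density_measure.

Lemma ge0_integral_density (f : T -> \bar R) :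
  measurable_fun setT f -> (forall y, 0 <= f y)%E ->
  (\int[density_meas]_y f y = \int[mu]_x (f x * (w x)%:E))%E.
Proof. by move=> mf f0; apply: (@ge0_integral_transport _ _ _ _ _ mu _ id). Qed.

End density_measure.

Section radial.
Context d (X : measurableType d) (R : realType).
Local Notation leb := (@lebesgue_measure R).
Variables (nu : {measure set X -> \bar R}) (N : X -> R) (w : R -> R).
Hypotheses (mN : measurable_fun setT N) (N0 : forall x, 0 <= N x).
Hypothesis mw : measurable_fun (`[0, +oo[ : set R) w.
Hypothesis w0 : forall z : R, 0 <= z -> 0 <= w z.
Hypothesis nuE : forall r : R, 0 <= r ->
  nu [set x | N x <= r] = (\int[leb]_(z in `[0%R, r]) (w z)%:E)%E.
Hypothesis nuoo : forall r : R, 0 <= r -> (nu [set x | (N x <= r)%R] < +oo)%E.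

(** The image of nu under N has the distribution function \int_[0, r] w, hence
    the density w on [0, +oo[. *)
Lemma ge0_integral_radial (psi : R -> \bar R) : measurable_fun setT psi ->
  (forall z, 0 <= psi z)%E ->
  (\int[nu]_x psi (N x) = \int[leb]_(z in `[0%R, +oo[) (psi z * (w z)%:E))%E.
Proof.
move=> mpsi psi0.
pose v := w \_ (`[0, +oo[ : set R).
have mv : measurable_fun setT v.
  by apply/(measurable_restrictT _ _).1 => //; exact: measurable_itv.
have v0 z : 0 <= v z.
  rewrite /v patchE; case: ifPn => //; rewrite inE /= in_itv/= andbT.
  exact: w0.
have mN' : measurable_fun setT (N : X -> measurableTypeR R) by exact: mN.
pose push := measure_function_pushforward__canonical__measure_function_Measure nu mN'.
have pushE (x : R) : push `]-oo, x]%classic = nu [set y | N y <= x].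
  by rewrite /push/= /pushforward; congr (nu _); apply/seteqP; split=> y /=;
    rewrite in_itv.
have eqm (A : set R) : measurable A -> push A = density_meas leb mv v0 A.
  apply: (@measure_cdf_unique R push (density_meas leb mv v0)) => x;
    rewrite pushE.
    have [x0|x0] := leP 0 x.
      rewrite nuE// /density_meas /= /density_measure.
      rewrite [LHS]integral_mkcond [RHS]integral_mkcond.
      apply: eq_integral => z _; rewrite /v !patchE.
      have inE1 (i : interval R) : (z \in [set` i]) = (z \in i).
        by rewrite mem_setE.
      rewrite !inE1 !in_itv/= andbT.
      by case: (leP 0 z) => z0; case: (leP z x).
    rewrite (_ : [set y | N y <= x] = set0) ?measure0; last first.
      by rewrite -subset0 => y /=; apply/negP; rewrite -ltNge (lt_le_trans x0).
    rewrite /density_meas /= /density_measure.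
    symmetry; apply: integral0_eq => z /=; rewrite in_itv/= => zx.
    rewrite /v patchE memNset//= in_itv/= andbT; apply/negP.
    by rewrite -ltNge (le_lt_trans zx).
  have [x0|x0] := leP 0 x; first exact: nuoo.
  rewrite (_ : [set y | N y <= x] = set0) ?measure0//.
  by rewrite -subset0 => y /=; apply/negP; rewrite -ltNge (lt_le_trans x0).
transitivity (\int[push]_z psi z)%E.
  symmetry; apply: (@integral_transport _ _ _ _ _ nu push N psi) => //.
transitivity (\int[density_meas leb mv v0]_z psi z)%E.
  by apply: eq_measure_integral => A mA _; exact: eqm.
rewrite ge0_integral_density// [RHS]integral_mkcond.
apply: eq_integral => z _; rewrite /v !patchE.
by case: ifPn => //; rewrite mule0.
Qed.

End radial.

Section polar.
Context (R : realType).
Local Notation leb := (@lebesgue_measure R).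
Local Notation mu n := (lebesgue_rV R n).

Lemma integral_rV0 (f : 'rV[R]_0 -> \bar R) : measurable_fun setT f ->
  (\int[mu 0%N]_x f x = f 0%R)%E.
Proof. by move=> mf; rewrite /= integral_dirac// diracT mul1e. Qed.

Lemma ge0_integral_rVS n (f : 'rV[R]_n.+1 -> \bar R) :
  measurable_fun setT f -> (forall x, 0 <= f x)%E ->
  (\int[mu n.+1]_x f x = \int[leb]_a \int[mu n]_x f (rV_cons (a, x)))%E.
Proof.
move=> mf f0; transitivity (\int[leb \x mu n]_p f (rV_cons p))%E.
  apply: (@integral_transport _ _ _ _ _ (leb \x mu n)%E (mu n.+1)
    (@rV_cons R n) f) => //.
  exact: measurable_rV_cons.
rewrite fubini_tonelli1//.
exact: (measurableT_comp mf (@measurable_rV_cons R n)).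
Qed.

Lemma measurable_scale_rV n (r : R) :
  measurable_fun setT (fun x : 'rV[R]_n => r *: x).
Proof.
apply/measurable_rVP => i; under eq_fun do rewrite mxE.
by apply: measurable_funM => //; exact: measurable_coord_rV.
Qed.

Lemma ge0_integral_rV_scale n (r : R) (f : 'rV[R]_n -> \bar R) : 0 < r ->
  measurable_fun setT f -> (forall x, 0 <= f x)%E ->
  (\int[mu n]_x f x = (r ^+ n)%:E * \int[mu n]_x f (r *: x)%R)%E.
Proof.
move=> r0; elim: n f => [|n IH] f mf f0.
  rewrite !integral_rV0// ?scaler0 ?expr0 ?mul1e//.
  exact: (measurableT_comp mf (measurable_scale_rV r)).
have mfc : measurable_fun setT (fun p : R * 'rV[R]_n => f (rV_cons p)).
  exact: (measurableT_comp mf (@measurable_rV_cons R n)).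
have mfa a : measurable_fun setT (fun x : 'rV[R]_n => f (rV_cons (a, x))).
  apply: (measurableT_comp mfc); exact: measurable_pair1.
rewrite !ge0_integral_rVS//; last first.
  exact: (measurableT_comp mf (measurable_scale_rV r)).
have mI : measurable_fun setT (fun a : R => \int[mu n]_x f (rV_cons (a, x)))%E.
  exact: (measurable_fun_fubini_tonelli_F _ mfc).
rewrite (@ge0_integral_affine R r 0)//; last 2 first.
- by rewrite gt_eqF.
- by move=> a; apply: integral_ge0.
have consZ a (x : 'rV[R]_n) : r *: rV_cons (a, x) = rV_cons (r * a, r *: x).
  by apply/rowP => i; rewrite !mxE; case: unliftP => [j _|_] //=; rewrite mxE.
rewrite gtr0_norm// exprS EFinM -muleA.
under eq_integral => a _.
  rewrite addr0 (IH (fun x => f (rV_cons (r * a, x))))// -muleA muleC -muleA.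
  rewrite -EFinM.
  over.
rewrite muleA -EFinM -ge0_integralZl_EFin//; last 3 first.
- by move=> a _; apply: integral_ge0.
- apply: (@measurable_fun_fubini_tonelli_F _ _ _ _ _ (mu n)
    (fun p : R * 'rV[R]_n => f (r *: rV_cons p))) => //.
  apply: (measurableT_comp (measurableT_comp mf (measurable_scale_rV r))).
  exact: measurable_rV_cons.
- by rewrite mulr_ge0// ?exprn_ge0 ?ltW.
apply: eq_integral => a _; rewrite muleC; congr (_ * _)%E.
by apply: eq_integral => x _; rewrite consZ.
Qed.

Lemma dotp_cons n a (x : 'rV[R]_n) :
  dotp (rV_cons (a, x)) (rV_cons (a, x)) = a ^+ 2 + dotp x x.
Proof.
rewrite /dotp big_ord_recl !mxE unlift_none /= expr2; congr (_ + _).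
by apply: eq_bigr => i _; rewrite !mxE liftK.
Qed.

Lemma measurable_expR_dotp n :
  measurable_fun setT (fun x : 'rV[R]_n => expR (- dotp x x)).
Proof.
apply: (measurableT_comp (@measurable_expR R)).
exact: (measurableT_comp (@oppr_measurable R setT) (measurable_dotp _ _)).
Qed.

Lemma integral_gauss_rV n :
  (\int[mu n]_x (expR (- dotp x x))%:E = ((Num.sqrt pi) ^+ n)%:E)%E.
Proof.
elim: n => [|n IH].
  rewrite integral_rV0; last first.
    by apply/measurable_EFinP; exact: (@measurable_expR_dotp 0%N).
  by rewrite /dotp big_ord0 oppr0 expR0 expr0.
rewrite ge0_integral_rVS; last 2 first.
- by apply/measurable_EFinP; exact: measurable_expR_dotp.
- by move=> x; rewrite lee_fin expR_ge0.
have cE a : (\int[mu n]_x (expR (- dotp (rV_cons (a, x)) (rV_cons (a, x))))%:E =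
    ((Num.sqrt pi) ^+ n)%:E * (gauss_fun a)%:E)%E.
  rewrite -IH muleC -ge0_integralZl_EFin ?expR_ge0//; last first.
    by apply/measurable_EFinP; exact: measurable_expR_dotp.
  by apply: eq_integral => x _; rewrite dotp_cons opprD expRD EFinM.
under eq_integral do rewrite cE.
rewrite ge0_integralZl_EFin//; last 2 first.
- by move=> a _; rewrite lee_fin gauss_fun_ge0.
- by apply/measurable_EFinP; exact: measurable_gauss_fun.
by rewrite integralT_gauss -EFinM exprSr.
Qed.

Lemma enormZ n r (x : 'rV[R]_n) : 0 <= r -> enorm (r *: x) = r * enorm x.
Proof.
move=> r0; rewrite /enorm (_ : dotp (r *: x) (r *: x) = r ^+ 2 * dotp x x).
  by rewrite sqrtrM ?sqr_ge0// sqrtr_sqr ger0_norm.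
by rewrite /dotp mulr_sumr; apply: eq_bigr => i _; rewrite !mxE; ring.
Qed.

Lemma coord_le_enorm n (x : 'rV[R]_n) i : `|x ord0 i| <= enorm x.
Proof.
rewrite -sqrtr_sqr /enorm ler_wsqrtr// /dotp (bigD1 i)//= -expr2 lerDl.
by apply: sumr_ge0 => k _; rewrite -expr2 sqr_ge0.
Qed.

Lemma measurable_enorm_ball n (r : R) :
  measurable [set x : 'rV[R]_n | enorm x <= r].
Proof.
rewrite (_ : [set _ | _] = @enorm R n @^-1` `]-oo, r]%classic).
  rewrite -[X in measurable X]setTI.
  by apply: measurable_enorm => //; exact: measurable_itv.
by apply/seteqP; split=> x /=; rewrite in_itv.
Qed.

Lemma lebesgue_rV_ball_le n (r : R) : 0 <= r ->
  (mu n [set x | (enorm x <= r)%R] <= ((r *+ 2) ^+ n)%:E)%E.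
Proof.
move=> r0; have -> : ((r *+ 2) ^+ n)%:E =
    mu n [set x : 'rV[R]_n | forall i, `[- r, r]%classic (x ord0 i)].
  rewrite (lebesgue_rV_box (A := fun=> `[- r, r]%classic))//.
  rewrite big_const_ord iter_mule mule1 /= lebesgue_measure_itv/= lte_fin.
  case: ltP => [_|].
    by rewrite -EFinB opprK -mulr2n EFin_expe.
  by move=> rN; rewrite (_ : r = 0) ?mul0rn ?EFin_expe//; lra.
apply: le_measure; rewrite ?inE//.
- exact: measurable_enorm_ball.
- rewrite (_ : [set _ | _] = \bigcap_(i in [set: 'I_n])
    ((fun x : 'rV[R]_n => x ord0 i : R) @^-1` `[- r, r]%classic)).
    apply: fin_bigcap_measurable => // i _; rewrite -[X in measurable X]setTI.
    by apply: measurable_coord_rV => //; exact: measurable_itv.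
  by apply/seteqP; split=> [w Bw i _|w Bw i]; exact: Bw.
- move=> x /= xr i; rewrite in_itv/= -ler_norml.
  exact: le_trans (coord_le_enorm x i) xr.
Qed.

Definition unit_ball_volume n : R := fine (mu n [set x | enorm x <= 1]).

Lemma lebesgue_rV_ball n (r : R) : (0 < n)%N -> 0 <= r ->
  mu n [set x | enorm x <= r] = (r ^+ n * unit_ball_volume n)%:E.
Proof.
move=> n0; rewrite le_eqVlt => /orP[/eqP<-|r0].
  rewrite expr0n (gtn_eqF n0) mul0r; apply/eqP; rewrite eq_le measure_ge0 andbT.
  by have := @lebesgue_rV_ball_le n 0 (lexx _); rewrite mul0rn expr0n (gtn_eqF n0).
have bE s : mu n [set x | enorm x <= s] =
    (\int[mu n]_x (\1_[set x | enorm x <= s] x)%:E)%E.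
  by rewrite integral_indic ?setIT//; exact: measurable_enorm_ball.
have fin1 : mu n [set x | enorm x <= 1] \is a fin_num.
  rewrite ge0_fin_numE ?measure_ge0//.
  exact: le_lt_trans (lebesgue_rV_ball_le n ler01) (ltry _).
rewrite bE (ge0_integral_rV_scale r0)//; last first.
- by apply/measurable_EFinP; apply: measurable_indic; exact: measurable_enorm_ball.
rewrite EFinM /unit_ball_volume fineK// bE; congr (_ * _)%E.
apply: eq_integral => x _; rewrite !indicE; congr (_%:R%:E); congr nat_of_bool.
apply/idP/idP; rewrite !inE /= (enormZ _ (ltW r0)).
  by rewrite -{2}(mulr1 r) ler_pM2l.
by rewrite -{2}(mulr1 r) ler_pM2l.
Qed.

Lemma integral_power k (r : R) : 0 <= r ->
  (\int[leb]_(z in `[0%R, r]) (k.+1%:R * z ^+ k)%:E = (r ^+ k.+1)%:E)%E.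
Proof.
rewrite le_eqVlt => /orP[/eqP<-|r0].
  by rewrite set_itv1 integral_set1 expr0n.
rewrite (@continuous_FTC2 _ _ (fun z => z ^+ k.+1)) ?expr0n ?sube0//.
- apply: continuous_subspaceT => x; apply: cvgM; first exact: cvg_cst.
  exact: exprn_continuous.
- split.
  + by move=> x _; exact: exprn_derivable.
  + by apply: cvg_at_right_filter; exact: exprn_continuous.
  + by apply: cvg_at_left_filter; exact: exprn_continuous.
- move=> x _ /=; exact: (@exp_derive1 R k.+1 x).
Qed.

Lemma ge0_integral_enorm_ball n (psi : R -> \bar R) : (0 < n)%N ->
  measurable_fun setT psi -> (forall z, 0 <= psi z)%E ->
  (\int[mu n]_x psi (enorm x) = \int[leb]_(z in `[0%R, +oo[)
     (psi z * (unit_ball_volume n * (n%:R * z ^+ n.-1))%:E))%E.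
Proof.
move=> n0 mpsi psi0.
have c0 : 0 <= unit_ball_volume n by exact/fine_ge0/measure_ge0.
apply: ge0_integral_radial => //.
- exact: measurable_enorm.
- by move=> x; exact: sqrtr_ge0.
- apply: measurable_funTS; do 2 (apply: measurable_funM => //).
- by move=> z z0; rewrite mulr_ge0// mulr_ge0// exprn_ge0.
- move=> r r0; apply: etrans (lebesgue_rV_ball n0 r0) _; rewrite mulrC EFinM.
  rewrite (_ : r ^+ n = r ^+ n.-1.+1); last by rewrite prednK.
  rewrite -integral_power// -ge0_integralZl_EFin//.
  + by under eq_integral do rewrite -EFinM prednK//.
  + move=> z /=; rewrite in_itv/= => /andP[z0 _].
    by rewrite lee_fin mulr_ge0// exprn_ge0.
  + apply/measurable_EFinP/measurable_funTS; apply: measurable_funM => //.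
- by move=> r r0; exact: le_lt_trans (lebesgue_rV_ball_le n r0) (ltry _).
Qed.

(** The substitution x = z ^+ 2, in the form: the image of the density 2 * z on
    [0, +oo[ under squaring is Lebesgue measure. *)
Lemma Gamma_half_gauss n : (0 < n)%N ->
  (\int[leb]_(x in `]0%R, +oo[) (x `^ (n%:R / 2 - 1) * expR (- x))%:E =
   \int[leb]_(z in `[0%R, +oo[) (2 * (z ^+ n.-1 * expR (- z ^+ 2)))%:E)%E.
Proof.
move=> n0; pose v (z : R) := 2 * Num.max 0 z.
have mv : measurable_fun setT v.
  by apply: measurable_funM => //; exact: measurable_maxr.
have v0 z : 0 <= v z by rewrite mulr_ge0// le_max lexx.
pose psi (x : R) := (x `^ (n%:R / 2 - 1) * expR (- x))%:E.
have mpsi : measurable_fun setT psi.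
  apply/measurable_EFinP/measurable_funM; first exact: measurable_powR.
  exact: (measurableT_comp (@measurable_expR R) (@oppr_measurable R setT)).
have psi0 x : (0 <= psi x)%E by rewrite lee_fin mulr_ge0 ?powR_ge0 ?expR_ge0.
have mI (b : bool) : measurable_fun [set` Interval (BSide b (0 : R)) +oo%O]
    (fun z : R => (2 * (z ^+ n.-1 * expR (- z ^+ 2)))%:E).
  apply/measurable_EFinP/measurable_funTS/measurable_funM => //.
  apply: measurable_funM; first exact: exprn_measurable.
  exact: measurable_gauss_fun.
have cdf r : 0 <= r -> density_meas leb mv v0 [set z | z ^+ 2 <= r] = r%:E.
  move=> r0; rewrite -[in RHS](sqr_sqrtr r0) -(@integral_power 1) ?sqrtr_ge0//.
  rewrite /density_meas /= /density_measure [LHS]integral_mkcond.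
  rewrite [RHS]integral_mkcond; apply: eq_integral => z _.
  have inE1 (i : interval R) : (z \in [set` i]) = (z \in i) by rewrite mem_setE.
  rewrite !patchE inE1 in_itv/= expr1 /v.
  have [z0|z0] := leP 0 z; last by rewrite mulr0 if_same.
  congr (if _ then _ else _); apply/idP/idP; rewrite ?inE /=.
    by move=> zr; rewrite -(ger0_norm z0) -sqrtr_sqr ler_wsqrtr.
  by move=> zr; rewrite -(sqr_sqrtr r0) ler_pXn2r ?nnegrE ?sqrtr_ge0.
rewrite integral_itv_obnd_cbnd; last exact: measurable_funTS.
transitivity (\int[density_meas leb mv v0]_z psi (z ^+ 2)%R)%E.
  rewrite (@ge0_integral_radial _ _ _ (density_meas leb mv v0)
    (fun z : R => z ^+ 2) (cst 1) _ _ _ _ _ _ psi)//=.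
  - by apply: eq_integral => x _; rewrite mule1.
  - by move=> z; rewrite sqr_ge0.
  - move=> r r0; apply: etrans (cdf r r0) _.
    rewrite -[in LHS](expr1 r) -(integral_power 0 r0).
    by apply: eq_integral => x _; rewrite expr0 mulr1.
  - by move=> r r0; have -> := cdf r r0; exact: ltry.
rewrite ge0_integral_density//; last first.
  exact: (measurableT_comp mpsi (@exprn_measurable R setT 2)).
rewrite -integral_itv_obnd_cbnd// [RHS]integral_mkcond.
apply: eq_integral => z _; rewrite patchE mem_setE in_itv/= andbT /psi /v.
have [z0|z0] := ltP 0 z; last by rewrite mulr0 mule0.
have pE : (z ^+ 2) `^ (n%:R / 2 - 1) * z = z ^+ n.-1.
  rewrite -(powR_mulrn 2 (ltW z0)) -powRrM -{2}(powRr1 (ltW z0)) -powRD; last first.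
    by rewrite (gt_eqF z0) implybT.
  rewrite -(powR_mulrn _ (ltW z0)); congr (_ `^ _).
  by rewrite -subn1 natrB//; field.
by rewrite -EFinM -pE; congr EFin; ring.
Qed.

(** The integral of exp (- |x| ^+ 2) computed twice: as a product it is
    pi ^ (n / 2), in polar coordinates it is n times the volume of the unit
    ball times Gamma (n / 2) / 2. *)
Lemma unit_ball_volumeE n : (0 < n)%N ->
  unit_ball_volume n * n%:R = 2 * pi `^ (n%:R / 2) / Gamma (n%:R / 2).
Proof.
move=> n0; pose J := (\int[leb]_(z in `[0%R, +oo[)
  (z ^+ n.-1 * expR (- z ^+ 2))%:E)%E.
have c0 : 0 <= unit_ball_volume n * n%:R.
  by rewrite mulr_ge0//; exact/fine_ge0/measure_ge0.
have mf : measurable_fun (`[0, +oo[ : set R)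
    (fun z : R => (z ^+ n.-1 * expR (- z ^+ 2))%:E).
  apply/measurable_EFinP/measurable_funTS/measurable_funM => //.
  exact: measurable_gauss_fun.
have f0 (z : R) : `[0, +oo[%classic z -> (0 <= (z ^+ n.-1 * expR (- z ^+ 2))%:E)%E.
  rewrite /= in_itv/= andbT => z0.
  by rewrite lee_fin mulr_ge0 ?expR_ge0 ?exprn_ge0.
have J0 : (0 <= J)%E by apply: integral_ge0.
have GJ : Gamma (n%:R / 2) = fine (2%:E * J)%E.
  rewrite /Gamma /Rintegral Gamma_half_gauss// /J -ge0_integralZl_EFin//.
have piJ : ((Num.sqrt pi ^+ n)%:E = (unit_ball_volume n * n%:R)%:E * J)%E.
  rewrite -integral_gauss_rV /J -ge0_integralZl_EFin//.
  transitivity (\int[mu n]_x (gauss_fun (enorm x))%:E)%E.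
    apply: eq_integral => x _; rewrite /gauss_fun /enorm sqr_sqrtr//.
    by apply: sumr_ge0 => i _; rewrite -expr2 sqr_ge0.
  rewrite (ge0_integral_enorm_ball n0 (psi := fun z => (gauss_fun z)%:E)).
  - by apply: eq_integral => z _; rewrite -!EFinM; congr EFin; rewrite /gauss_fun; ring.
  - by apply/measurable_EFinP; exact: measurable_gauss_fun.
  - by move=> z; rewrite lee_fin gauss_fun_ge0.
have pin : 0 < Num.sqrt (pi : R) ^+ n by rewrite exprn_gt0// sqrtr_gt0 pi_gt0.
have piE : pi `^ (n%:R / 2) = Num.sqrt (pi : R) ^+ n.
  rewrite -powR12_sqrt ?pi_ge0// -powR_mulrn ?powR_ge0// -powRrM.
  by congr (_ `^ _); field.
rewrite piE GJ; move: piJ J0; rewrite {GJ}; case: J => [q| |] //=.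
  rewrite -EFinM => -[pq] _; rewrite pq.
  have q0 : q != 0 by apply: contraTneq pin => q0; rewrite pq q0 mulr0 ltxx.
  by field.
have [->|cn] := eqVneq (unit_ball_volume n * n%:R) 0.
  by rewrite mul0e => -[] pi0; rewrite pi0 ltxx in pin.
by rewrite gt0_muley// lte_fin lt0r cn.
Qed.

Lemma ge0_integral_enorm n (psi : R -> \bar R) : (0 < n)%N ->
  measurable_fun setT psi -> (forall z, 0 <= psi z)%E ->
  (\int[mu n]_x psi (enorm x) = \int[leb]_(z in `[0%R, +oo[)
     (psi z * (2 * pi `^ (n%:R / 2) / Gamma (n%:R / 2) * z ^+ n.-1)%:E))%E.
Proof.
move=> n0 mpsi psi0; rewrite ge0_integral_enorm_ball//.
by apply: eq_integral => z _; rewrite mulrA unit_ball_volumeE.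
Qed.

End polar.

(** * Localization at a singularity *)

Lemma ge0_integral_bigcup_le d (T : measurableType d) (R : realType)
    (mu : {measure set T -> \bar R}) (F : nat -> set T) (f : T -> \bar R)
    (M : \bar R) :
  nondecreasing_seq F -> (forall k, measurable (F k)) ->
  measurable_fun setT f -> (forall x, 0 <= f x)%E ->
  (forall k, \int[mu]_(x in F k) f x <= M)%E ->
  (\int[mu]_(x in \bigcup_k F k) f x <= M)%E.
Proof.
move=> ndF mF mf f0 FM.
have Fc := @ge0_nondecreasing_set_cvg_integral _ _ _ F f mu ndF mF
  (fun k => measurable_funTS mf) (fun k x _ => f0 x).
rewrite -(cvg_lim _ Fc)//; apply: lime_le; first by apply/cvg_ex; eexists; exact: Fc.
by apply: nearW => k; exact: FM.
Qed.

Section power_integrals.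
Context (R : realType).
Local Notation leb := (@lebesgue_measure R).

Lemma ge0_integral_even (f : R -> \bar R) : measurable_fun setT f ->
  (forall x, 0 <= f x)%E -> (forall x : R, f (- x)%R = f x) ->
  (\int[leb]_x f x = 2%:E * \int[leb]_(x in `[0%R, +oo[) f x)%E.
Proof.
move=> mf f0 ef.
have mI : measurable (`[0, +oo[ : set R) by exact: measurable_itv.
have half : (\int[leb]_(x in ~` `[0%R, +oo[) f x =
    \int[leb]_(x in `[0%R, +oo[) f x)%E.
  have mp : measurable_fun setT (f \_ (~` `[0, +oo[%classic)).
    apply/(measurable_restrictT f); first exact: measurableC.
    exact: measurable_funTS.
  rewrite integral_mkcond (@ge0_integral_affine R (-1) 0)//; last first.
    by move=> x; rewrite patchE; case: ifPn.
  rewrite -integral_itv_obnd_cbnd; last exact: measurable_funTS.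
  rewrite [RHS]integral_mkcond; apply: eq_integral => x _.
  have inE1 (i : interval R) : (x \in [set` i]) = (x \in i) by rewrite mem_setE.
  rewrite normrN1 mule1 !patchE inE1 in_itv/= andbT addr0 mulN1r ef.
  congr (if _ then _ else _); apply/idP/idP; rewrite inE /= in_itv/= andbT.
    by move/negP; rewrite -ltNge oppr_lt0.
  by move=> x0; apply/negP; rewrite -ltNge oppr_lt0.
rewrite -(setUv `[0%R, +oo[%classic) ge0_integral_setU//=; last 3 first.
- exact: measurableC.
- by rewrite setUv.
- by apply/disj_setPCl.
by rewrite half mule_natl mule2n.
Qed.

Lemma integral_powR (x y b : R) : 0 < x -> x <= y -> b != 0 ->
  (\int[leb]_(v in `[x, y]) (v `^ (b - 1))%:E = ((y `^ b - x `^ b) / b)%:E)%E.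
Proof.
move=> x0; rewrite le_eqVlt => /orP[/eqP<- _|xy b0].
  by rewrite set_itv1 integral_set1 subrr mul0r.
have dF (v : R) : 0 < v -> is_derive v 1 (fun u : R => u `^ b * b^-1) (v `^ (b - 1)).
  move=> v0; have d1 : is_derive v 1 (@powR R ^~ b) (b * v `^ (b - 1)).
    exact: is_derive1_powR.
  have d2 : is_derive v 1 (b^-1 \*: (@powR R ^~ b)) (b^-1 *: (b * v `^ (b - 1))).
    exact: is_deriveZ.
  rewrite (_ : (fun u => _) = b^-1 \*: (@powR R ^~ b)); last first.
    by apply/funext => u /=; rewrite mulrC.
  by rewrite scalerA mulVf// scale1r in d2.
have ct (c v : R) : 0 < v -> {for v, continuous (fun u : R => u `^ c)}.
  move=> v0; apply: differentiable_continuous; apply/derivable1_diffP.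
  by apply: derivable_powR; rewrite in_itv/= andbT.
rewrite (@continuous_FTC2 _ _ (fun u : R => u `^ b * b^-1))//.
- by rewrite -EFinB mulrBl.
- apply: continuous_in_subspaceT => v; rewrite inE/= in_itv/= => /andP[xv _].
  by apply: ct; exact: lt_le_trans xv.
- split.
  + move=> v; rewrite in_itv/= => /andP[xv _].
    by have [] := dF v (lt_trans x0 xv).
  + apply: cvg_at_right_filter; apply: cvgM; last exact: cvg_cst.
    exact: ct.
  + apply: cvg_at_left_filter; apply: cvgM; last exact: cvg_cst.
    by apply: ct; exact: lt_trans xy.
- move=> v; rewrite in_itv/= => /andP[xv _]; rewrite derive1E.
  by have [_ ->] := dF v (lt_trans x0 xv).
Qed.

Lemma integrable_powR_near0 (b : R) : 0 < b ->
  leb.-integrable `]0, 1] (fun v : R => (v `^ (b - 1))%:E).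
Proof.
move=> b0; have mp : measurable_fun setT (fun v : R => (v `^ (b - 1))%:E).
  by apply/measurable_EFinP; exact: measurable_powR.
apply/integrableP; split; first exact: measurable_funTS.
under eq_integral do rewrite abse_EFin ger0_norm ?powR_ge0//.
have -> : `]0, 1]%classic = \bigcup_k `[k.+1%:R^-1, 1 : R]%classic.
  apply/seteqP; split=> [x /=|x [k _]/=]; rewrite !in_itv/= => /andP[x0 x1].
    exists (Num.truncn x^-1) => //=; rewrite in_itv/= x1 andbT.
    rewrite invf_ple ?posrE ?ltr0n//; apply: ltW; exact: truncnS_gt.
  by rewrite x1 andbT (lt_le_trans _ x0)// invr_gt0 ltr0n.
apply: le_lt_trans (ltry b^-1); apply: ge0_integral_bigcup_le => //.
- apply/nondecreasing_seqP => k; rewrite subsetEset => x /=.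
  rewrite !in_itv/= => /andP[kx ->]; rewrite andbT (le_trans _ kx)//.
  by rewrite lef_pV2 ?posrE ?ltr0n// ler_nat.
- by move=> x; rewrite lee_fin powR_ge0.
- move=> k; rewrite integral_powR ?gt_eqF ?invr_gt0 ?ltr0n//; last first.
    by rewrite invf_le1 ?ltr0n// ler1n.
  rewrite lee_fin powR1 ler_pdivrMr// mulVf ?gt_eqF// lerBlDr lerDl.
Qed.

Lemma integrable_powR_neary (b : R) : b < 0 ->
  leb.-integrable `[1, +oo[ (fun v : R => (v `^ (b - 1))%:E).
Proof.
move=> b0; have mp : measurable_fun setT (fun v : R => (v `^ (b - 1))%:E).
  by apply/measurable_EFinP; exact: measurable_powR.
apply/integrableP; split; first exact: measurable_funTS.
under eq_integral do rewrite abse_EFin ger0_norm ?powR_ge0//.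
have -> : `[1, +oo[%classic = \bigcup_k `[1 : R, k.+1%:R]%classic.
  apply/seteqP; split=> [x /=|x [k _]/=]; rewrite !in_itv/=.
    rewrite andbT => x1; exists (Num.truncn x) => //=; rewrite in_itv/= x1/=.
    by apply: ltW; exact: truncnS_gt.
  by rewrite andbT => /andP[].
apply: le_lt_trans (ltry (- b^-1)); apply: ge0_integral_bigcup_le => //.
- apply/nondecreasing_seqP => k; rewrite subsetEset => x /=.
  rewrite !in_itv/= => /andP[-> kx]; rewrite (le_trans kx)//.
  by rewrite ler_nat.
- by move=> x; rewrite lee_fin powR_ge0.
- move=> k; rewrite integral_powR ?lt_eqF ?ler1n// lee_fin powR1.
  rewrite mulrBl mul1r lerBlDr addrC subrr.
  by rewrite mulr_ge0_le0 ?powR_ge0// invr_le0 ltW.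
Qed.

End power_integrals.

Section tame.
Context (R : realType).
Local Notation leb := (@lebesgue_measure R).
Implicit Types g : R -> R.

(** What is used of the profile of an admissible weight, in a form stable under
    the linear combinations s |-> \sum_i c i * g (t i * s).  For 0 < al < 1 the
    bound by a constant makes g v ^+ 2 * |v| ^ (al - 1) integrable near 0, the
    bound by C / s makes it integrable near infinity. *)
Definition tame g := [/\ measurable_fun setT g, forall s, g (- s) = g s,
  exists B : R, forall s, `|g s| <= B
  & exists C : R, forall s, 0 < s -> g s ^+ 2 <= C / s].

Lemma tame0 : tame (cst 0).
Proof.
split=> //; first by exists 0 => s; rewrite normr0.
by exists 0 => s _; rewrite mul0r expr0n.
Qed.

Lemma tameD f g : tame f -> tame g -> tame (fun s => f s + g s).
Proof.
move=> [mf ef [B fB] [C fC]] [mg eg [B' gB] [C' gC]]; split.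
- exact: measurable_funD.
- by move=> s; rewrite ef eg.
- by exists (B + B') => s; rewrite (le_trans (ler_normD _ _))// lerD.
- exists (2 * (C + C')) => s s0; have := fC s s0; have := gC s s0.
  rewrite -mulrA mulrDl; have := sqr_ge0 (f s - g s); nra.
Qed.

Lemma tame_scale c t g : 0 < t -> tame g -> tame (fun s => c * g (t * s)).
Proof.
move=> t0 [mg eg [B gB] [C gC]]; split.
- apply: measurable_funM => //; apply: (measurableT_comp mg).
  exact: measurable_funM.
- by move=> s; rewrite mulrN eg.
- by exists (`|c| * B) => s; rewrite normrM ler_wpM2l.
- exists (c ^+ 2 * (C / t)) => s s0; rewrite exprMn -mulrA ler_wpM2l ?sqr_ge0//.
  by rewrite -mulrA -invfM; apply: gC; exact: mulr_gt0.
Qed.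

Lemma tame_sum (I : Type) (r : seq I) (F : I -> R -> R) :
  (forall i, tame (F i)) -> tame (fun s => \sum_(i <- r) F i s).
Proof.
move=> tF; elim: r => [|i r IH].
  by under eq_fun do rewrite big_nil; exact: tame0.
by under eq_fun do rewrite big_cons; exact: tameD.
Qed.

Section weight.
Variables (g : R -> R) (al : R).
Hypotheses (tg : tame g) (al01 : 0 < al < 1).

Let G (v : R) : R := g v ^+ 2 * `|v| `^ (al - 1).

Let G0 v : 0 <= G v.
Proof. by rewrite mulr_ge0 ?sqr_ge0 ?powR_ge0. Qed.

Let mG : measurable_fun setT G.
Proof.
have [mg _ _ _] := tg; apply: measurable_funM; first exact: measurable_funX.
by apply: (measurableT_comp (measurable_powR _)); exact: normr_measurable.
Qed.

Let eG v : G (- v) = G v.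
Proof. by rewrite /G normrN; have [_ -> _ _] := tg. Qed.

Let G_half : leb.-integrable `[0, +oo[ (EFin \o G).
Proof.
have [mg _ [B gB] [C gC]] := tg; have [al0 al1] := andP al01.
have C0 : 0 <= C by have := gC 1 ltr01; rewrite divr1; apply: le_trans; exact: sqr_ge0.
pose p1 := (fun v : R => (v `^ (al - 1))%:E) \_ (`]0, 1]%classic).
pose p2 := (fun v : R => (v `^ (al - 1 - 1))%:E) \_ (`[1, +oo[%classic).
have i1 : leb.-integrable setT p1.
  rewrite -(@integrable_mkcond _ _ _ leb)//; exact: integrable_powR_near0.
have i2 : leb.-integrable setT p2.
  rewrite -(@integrable_mkcond _ _ _ leb)//; apply: integrable_powR_neary.
  by rewrite subr_lt0.
have i12 : leb.-integrable setT (fun v => (B ^+ 2)%:E * p1 v + C%:E * p2 v)%E.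
  by apply: integrableD => //; exact: integrableZl.
have bnd v : `[0, +oo[%classic v ->
    (`|(G v)%:E| <= `|(B ^+ 2)%:E * p1 v + C%:E * p2 v|)%E.
  move=> /=; rewrite in_itv/= andbT => v0.
  have inE1 (i : interval R) : (v \in [set` i]) = (v \in i) by rewrite mem_setE.
  rewrite /p1 /p2 !patchE !inE1 !in_itv/= andbT.
  have p0 := powR_ge0 v.
  rewrite (ger0_norm (G0 v)) /G (ger0_norm v0).
  have [v0'|v0'] := ltP 0 v; last first.
    have -> : v = 0 by apply/eqP; rewrite eq_le v0 v0'.
    rewrite powR0 ?mulr0 ?abse_ge0//; last by rewrite subr_eq0 lt_eqF.
  have gB2 : g v ^+ 2 <= B ^+ 2.
    rewrite -(real_normK (num_real (g v))) ler_pXn2r ?nnegrE//.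
    exact: le_trans (gB v).
  case: (leP v 1) => v1 /=.
    apply: (@le_trans _ _ ((B ^+ 2)%:E * (v `^ (al - 1))%:E)%E).
      by rewrite -EFinM lee_fin ler_wpM2r.
    apply: le_trans (lee_abs _); rewrite leeDl//.
    by case: ifPn => _; rewrite ?mule0// -EFinM lee_fin mulr_ge0.
  rewrite (ltW v1) mule0 add0e -EFinM lee_fin (le_trans _ (ler_norm _))//.
  rewrite (_ : v `^ (al - 1) = v * v `^ (al - 1 - 1)); last first.
    rewrite -{2}(powRr1 v0) -powRD; last by rewrite (gt_eqF v0') implybT.
    by congr (_ `^ _); ring.
  rewrite mulrA ler_wpM2r// -ler_pdivlMr//; exact: gC.
apply: (@le_integrable _ _ _ leb _ _ _
  (fun v => (B ^+ 2)%:E * p1 v + C%:E * p2 v)%E) => //.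
  by apply/measurable_EFinP; exact: measurable_funTS.
by apply: integrableS i12.
Qed.

Lemma tame_weight_integrable : leb.-integrable setT (EFin \o G).
Proof.
apply/integrableP; split; first exact/measurable_EFinP.
under eq_integral do rewrite abse_EFin ger0_norm ?G0//.
rewrite ge0_integral_even//; last 2 first.
- exact/measurable_EFinP.
- by move=> v; rewrite eG.
rewrite lte_mul_pinfty//; have /integrableP[_] := G_half.
by under eq_integral do rewrite /= ger0_norm//.
Qed.

Lemma tame_weight_even : \int[leb]_v (g v ^+ 2 * `|v| `^ (al - 1)) =
  2 * \int[leb]_(v in `[0, +oo[) (g v ^+ 2 * v `^ (al - 1)).
Proof.
rewrite /Rintegral ge0_integral_even//; last 2 first.
- exact/measurable_EFinP.
- by move=> v; congr EFin; exact: eG.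
have -> : (\int[leb]_(v in `[0%R, +oo[) (g v ^+ 2 * v `^ (al - 1))%:E =
    \int[leb]_(v in `[0%R, +oo[) (G v)%:E)%E.
  apply: eq_integral => v; rewrite inE/= in_itv/= andbT => v0.
  by rewrite /G ger0_norm.
have : (\int[leb]_(v in `[0%R, +oo[) (G v)%:E)%E \is a fin_num.
  by apply: integrable_fin_num => //; exact: G_half.
by case: (\int[leb]_(v in _) _)%E.
Qed.

(** Substituting z = a + v / r magnifies the neighbourhood of the singularity
    a, where w behaves like L * |z - a| ^ (al - 1); the factor r ^ al is the
    scaling that turns the image of this power into a fixed weight.  At a
    distance at least de from a the decay of g ^+ 2 only leaves a contribution
    of order r ^ (al - 1). *)
Lemma tame_localize (a de K L : R) (q w : R -> R) (r : nat -> R) :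
  0 < de <= a -> leb.-integrable `[0, +oo[ (EFin \o w) ->
  (forall z, 0 <= z -> 0 <= w z) ->
  (forall z, 0 < `|z - a| < de -> w z = q z * `|z - a| `^ (al - 1)) ->
  (forall z, `|z - a| < de -> `|q z| <= K) -> q z @[z --> a] --> L ->
  (forall k, 0 < r k) -> r k @[k --> \oo] --> +oo ->
  r k `^ al * (\int[leb]_(z in `[0, +oo[) (g (r k * (z - a)) ^+ 2 * w z))
    @[k --> \oo] --> L * \int[leb]_v (g v ^+ 2 * `|v| `^ (al - 1)).
Proof.
move=> /andP[de0 dea] iw w0 wq qK qL r0 ry.
have [mg eg [B gB] [C gC]] := tg; have [al0 al1] := andP al01.
have C0 : 0 <= C by have := gC 1 ltr01; rewrite divr1; apply: le_trans; exact: sqr_ge0.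
have B0 : 0 <= B by exact: le_trans (gB 0).
have gB2 v : g v ^+ 2 <= B ^+ 2.
  by rewrite -(real_normK (num_real (g v))) ler_pXn2r ?nnegrE.
pose N : set R := [set z | 0 < `|z - a| < de].
pose far : set R := [set z | 0 <= z /\ de <= `|z - a|].
have mdist : measurable_fun setT (fun z : R => `|z - a|).
  by apply: measurableT_comp => //; exact: measurable_funB.
have mN : measurable N.
  rewrite (_ : N = (fun z => `|z - a|) @^-1` `]0, de[%classic); last first.
    by apply/seteqP; split=> z /=; rewrite in_itv.
  by rewrite -[X in measurable X]setTI; apply: mdist => //; exact: measurable_itv.
have mfar : measurable far.
  rewrite (_ : far = `[0, +oo[%classic `&`
      (fun z => `|z - a|) @^-1` `[de, +oo[%classic); last first.
    by apply/seteqP; split=> z /=; rewrite !in_itv/= !andbT.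
  apply: measurableI; first exact: measurable_itv.
  by rewrite -[X in measurable X]setTI; apply: mdist => //; exact: measurable_itv.
have N0 z : N z -> 0 <= z.
  by rewrite /N /= => /andP[_]; rewrite ltr_norml => /andP[? _]; lra.
(* The point a, where the formula for w is not available, is negligible. *)
have Dsplit : `[0, +oo[%classic `\ a = N `|` far.
  apply/seteqP; split=> [z [/=]|z [Nz|[z0 zde]]]; rewrite ?in_itv/= ?andbT.
  - move=> z0 za; have [zde|zde] := ltP `|z - a| de; last by right.
    by left; rewrite /N /= zde andbT normr_gt0 subr_eq0; exact/eqP.
  - split; first by rewrite /= in_itv/= andbT; exact: N0.
    by move=> /= za; move: Nz; rewrite /N /= za subrr normr0 ltxx.
  - split; first by rewrite /= in_itv/= andbT.
    by move=> /= za; move: zde; rewrite za subrr normr0 leNgt de0.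
have mw : measurable_fun (`[0, +oo[ : set R) w.
  by apply/measurable_EFinP; have /integrableP[] := iw.
pose psi k z := g (r k * (z - a)) ^+ 2.
have mpsi k : measurable_fun setT (psi k).
  apply: measurable_funX; apply: (measurableT_comp mg).
  by apply: measurable_funM => //; exact: measurable_funB.
have ipsi k : leb.-integrable `[0, +oo[ (fun z => (psi k z * w z)%:E).
  have iBw : leb.-integrable `[0, +oo[ (fun z => ((B ^+ 2)%:E * (w z)%:E)%E).
    exact: integrableZl.
  apply: le_integrable iBw => //.
    apply/measurable_EFinP; apply: measurable_funM => //.
    exact: measurable_funTS (mpsi k).
  move=> z /=; rewrite in_itv/= andbT => z0; rewrite lee_fin.
  rewrite /psi !(ger0_norm (mulr_ge0 (sqr_ge0 _) (w0 _ z0))).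
  by rewrite ler_wpM2r ?w0//; exact: gB2.
have ND : N `<=` `[0, +oo[%classic by move=> z /N0; rewrite /= in_itv/= andbT.
have farD : far `<=` `[0, +oo[%classic by move=> z []; rewrite /= in_itv/= andbT.
have iN k : leb.-integrable N (fun z => (psi k z * w z)%:E).
  by apply: integrableS (ipsi k).
have ifar k : leb.-integrable far (fun z => (psi k z * w z)%:E).
  by apply: integrableS (ipsi k).
have iwfar : leb.-integrable far (EFin \o w) by apply: integrableS iw.
have split_int k : \int[leb]_(z in `[0, +oo[) (psi k z * w z) =
    \int[leb]_(z in N) (psi k z * w z) + \int[leb]_(z in far) (psi k z * w z).
  rewrite -Rintegral_setU//.
  - rewrite /Rintegral -Dsplit integral_setD1//.
      by rewrite Dsplit; exact: measurableU.
    by have /integrableP[mp _] := ipsi k; apply: measurable_funS mp => // z [].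
  - rewrite -Dsplit; apply: integrableS (ipsi k) => //.
    by rewrite Dsplit; exact: measurableU.
  - by apply/disj_setPS => z [/= /andP[_ zde] [_]]; rewrite leNgt zde.
have rV0 : (r k)^-1 @[k --> \oo] --> (0 : R).
  by apply/gtr0_cvgV0 => //; exact: nearW.
have rV0p : (r k)^-1 @[k --> \oo] --> (0 : R)^'+.
  move=> A A0.
  have H : \forall k \near \oo, 0 < (r k)^-1 -> A (r k)^-1 := rV0 _ A0.
  change (\forall k \near \oo, A (r k)^-1).
  by apply: filterS H => k; apply; rewrite invr_gt0.
have psi_far k z : far z -> psi k z <= C / (r k * de).
  move=> [z0 zde]; rewrite /psi.
  have -> : g (r k * (z - a)) = g (r k * `|z - a|).
    have [za|za] := lerP 0 (z - a); first by rewrite ger0_norm.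
    by rewrite ltr0_norm// mulrN eg.
  have zp : 0 < `|z - a| by exact: lt_le_trans zde.
  apply: (le_trans (gC _ (mulr_gt0 (r0 k) zp))).
  rewrite ler_wpM2l// lef_pV2 ?posrE ?mulr_gt0//.
  by rewrite ler_wpM2l// ltW.
have far_cvg : r k `^ al * (\int[leb]_(z in far) (psi k z * w z))
    @[k --> \oo] --> (0 : R).
  pose I := \int[leb]_(z in far) w z.
  apply: (@squeeze_cvgr _ _ _ _ (cst 0) (fun k => (r k)^-1 `^ (1 - al) * (C / de * I))).
  - apply: nearW => k; apply/andP; split.
      rewrite mulr_ge0 ?powR_ge0//; apply: Rintegral_ge0 => z [z0 _].
      by apply: mulr_ge0; [exact: sqr_ge0 | exact: w0].
    have -> : (r k)^-1 `^ (1 - al) * (C / de * I) =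
        r k `^ al * (C / (r k * de) * I).
      rewrite -{1}(powR_inv1 (ltW (r0 k))) -powRrM.
      rewrite -(mulr_powRB1 (ltW (r0 k)) al0) (_ : -1 * (1 - al) = al - 1); last by ring.
      by field; rewrite !gt_eqF.
    rewrite ler_wpM2l ?powR_ge0// /I -RintegralZl//.
    apply: le_Rintegral => //; first exact: ifar.
      have iCw : leb.-integrable far (fun z => ((C / (r k * de))%:E * (w z)%:E)%E).
        exact: integrableZl.
      by apply: eq_integrable iCw => // x _; rewrite /= EFinM.
    by move=> z fz; rewrite ler_wpM2r ?psi_far//; apply: w0; case: fz.
  - exact: cvg_cst.
  - rewrite -[X in _ --> X](mul0r (C / de * I)); apply: cvgM; last exact: cvg_cst.
    have al1' : 0 < 1 - al by rewrite subr_gt0.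
    exact: (cvg_comp _ _ rV0p (powR_cvg0 al1')).
have near_cvg : r k `^ al * (\int[leb]_(z in N) (psi k z * w z))
    @[k --> \oo] --> L * \int[leb]_v (g v ^+ 2 * `|v| `^ (al - 1)).
  pose X k := (fun z => r k `^ al * (psi k z * w z)) \_ N.
  pose F k v := (q \_ N) ((r k)^-1 * v + a) * G v.
  (* The powers of r k cancel: r ^ al * (1 / r) ^ (al - 1) * (1 / r) = 1. *)
have XE k v : X k ((r k)^-1 * v + a) * (r k)^-1 = F k v.
    rewrite /X /F !patchE; case: ifPn => [/set_mem Nz|_]; last by rewrite !mul0r.
    have rk0 : r k != 0 by rewrite gt_eqF.
    have -> : psi k ((r k)^-1 * v + a) = g v ^+ 2.
      by rewrite /psi addrK mulrA mulfV// mul1r.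
    rewrite wq// /G addrK normrM.
    rewrite gtr0_norm ?invr_gt0// powRM ?invr_ge0 ?(ltW (r0 k))//.
    have r1 : r k `^ al * ((r k)^-1 `^ (al - 1) * (r k)^-1) = 1.
      rewrite mulrC (mulrC _ (r k)^-1) mulr_powRB1// ?invr_ge0 ?(ltW (r0 k))//.
      by rewrite -powRM ?invr_ge0 ?(ltW (r0 k))// mulVf// powR1.
    move: r1; move: (r k)^-1 (r k `^ al) ((r k)^-1 `^ _) (`|v| `^ _) => x1 x2 x3 x4 r1.
    by rewrite -[RHS]mul1r -r1; ring.
  have mX k : measurable_fun setT (X k).
    rewrite /X; apply/(measurable_restrictT _ _).1 => //.
    apply: measurable_funM; first exact: measurable_cst.
    apply: measurable_funM; first exact: measurable_funTS (mpsi k).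
    exact: measurable_funS mw.
  have X0 k z : 0 <= X k z.
    rewrite /X patchE; case: ifPn => // /set_mem Nz.
    rewrite mulr_ge0 ?powR_ge0//.
    by apply: mulr_ge0; [exact: sqr_ge0 | exact: w0 (N0 _ Nz)].
  have mF k : measurable_fun setT (F k).
    rewrite (_ : F k = fun v => X k ((r k)^-1 * v + a) * (r k)^-1); last first.
      by apply/funext => v; rewrite XE.
    apply: measurable_funM => //.
    apply: (measurableT_comp (mX k)); exact: measurable_funD.
  have FE k : r k `^ al * (\int[leb]_(z in N) (psi k z * w z)) = \int[leb]_v F k v.
    rewrite -RintegralZl//; last exact: iN.
    rewrite Rintegral_mkcond /Rintegral.
    rewrite (@ge0_integral_affine R (r k)^-1 a)//; last 3 first.
    - by rewrite invr_neq0// gt_eqF.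
    - by apply/measurable_EFinP; exact: mX.
    - by move=> x; rewrite lee_fin; exact: X0.
    apply: f_equal; apply: eq_integral => v _.
    by rewrite gtr0_norm ?invr_gt0// -EFinM -XE.
  under eq_fun do rewrite FE.
  have iG : leb.-integrable setT (EFin \o G) by exact: tame_weight_integrable.
  rewrite -RintegralZl//.
  apply: (@cvg_Rintegral_dominated _ _ _ leb setT F _
    (fun v => (K * G v)%:E) measurableT mF _ _ _ _).2.
  - exact: measurable_funM.
  - apply: aeW => v _; rewrite /F -[g v ^+ 2 * _]/(G v).
    have [->|v0] := eqVneq v 0.
      have -> : G 0 = 0 by rewrite /G normr0 powR0 ?mulr0// subr_eq0 lt_eqF.
      by under eq_fun do rewrite mulr0; rewrite mulr0; exact: cvg_cst.
    apply: cvgM; last exact: cvg_cst.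
    have zv0 : (r k)^-1 * v @[k --> \oo] --> (0 : R).
      by rewrite -[X in _ --> X](mul0r v); apply: cvgM => //; exact: cvg_cst.
    have za : (r k)^-1 * v + a @[k --> \oo] --> a.
      rewrite -[X in _ --> X]add0r; apply: cvgD => //; exact: cvg_cst.
    apply: cvg_trans (cvg_comp _ _ za qL); apply: near_eq_cvg.
    have zvde : \forall k \near \oo, `|(r k)^-1 * v| < de.
      by move/cvgr0Pnorm_lt: zv0 => /(_ _ de0).
    move: zvde; apply: filterS => k kde /=.
    rewrite patchE mem_set// /N /= addrK kde andbT normr_gt0 mulf_neq0//.
    by rewrite invr_neq0// gt_eqF.
  - exact: (integrable_scale K iG).
  - move=> k v _; rewrite lee_fin /F normrM (ger0_norm (G0 v)).
    rewrite ler_wpM2r ?G0// patchE; case: ifPn => [/set_mem [/= /andP[_ ]]|_].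
      exact: qK.
    rewrite normr0; apply: le_trans (qK a _); first exact: normr_ge0.
    by rewrite subrr normr0.
rewrite -[X in _ --> X]addr0; under eq_fun do rewrite split_int mulrDr.
exact: cvgD near_cvg far_cvg.
Qed.

End weight.
End tame.

(** * Linear combinations of field integrals *)

Lemma gausslike_ae (R : realType) d (T : measurableType d) (P : probability T R)
    (X Y : T -> R) : measurable_fun setT Y -> {ae P, forall w, X w = Y w} ->
  gausslike P X -> gausslike P Y /\ msq P Y = msq P X.
Proof.
move=> mY XY [sX gX]; have [mX iX] := sX.
have E (F : R -> R) : measurable_fun setT F ->
    (\int[P]_w (F (Y w))%:E = \int[P]_w (F (X w))%:E)%E.
  move=> mF; apply: ae_eq_integral => //.
  - by apply/measurable_EFinP; exact: (measurableT_comp mF mY).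
  - by apply/measurable_EFinP; exact: (measurableT_comp mF mX).
  - by apply: filterS XY => w -> _.
have ER (F : R -> R) : measurable_fun setT F ->
    \int[P]_w F (Y w) = \int[P]_w F (X w).
  by move=> mF; rewrite /Rintegral E.
have m2 : measurable_fun setT (fun x : R => x ^+ 2) by exact: exprn_measurable.
have mE : msq P Y = msq P X by rewrite /msq -(ER (fun x => x ^+ 2) m2).
split=> //; split=> [|b].
  apply: sqintP => //; rewrite (E (fun x => x ^+ 2))//.
  by rewrite -msqE// ltry.
have mc : measurable_fun setT (fun x : R => cos (x + b)).
  apply: (measurableT_comp (@measurable_cos R)); exact: measurable_funD.
by rewrite mE -gX -(ER (fun x => cos (x + b)) mc).
Qed.

Section field_combinations.
Context d (T : measurableType d) (R : realType) (P : probability T R) (n : nat).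
Local Notation mu := (lebesgue_rV R n).
Variable xi : 'rV[R]_n -> T -> R.
Hypothesis mxi : measurable_field xi.
Hypothesis gxi : gaussian_family P setT xi.
Hypothesis zxi : zero_mean P xi.
Hypothesis cxi : mean_square_continuous P xi.
Variable Fs : {measure set 'rV[R]_n -> \bar R}.
Hypothesis sFs : spectral_measure P xi Fs.

Lemma measurable_field_integral F : mu.-integrable setT (EFin \o F) ->
  measurable_fun setT (fun w => \int[mu]_x (F x * xi x w)).
Proof.
move=> iF; have [[mI _] _] := field_integral_gausslike mxi gxi zxi cxi sFs iF.
exact: mI.
Qed.

Lemma field_integral_ae F : mu.-integrable setT (EFin \o F) ->
  {ae P, forall w, mu.-integrable setT (fun x => (F x * xi x w)%:E)}.
Proof.
move=> iF; have mxi' : measurable_fun setT (fun z : 'rV[R]_n * T => xi z.1 z.2) := mxi.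
have msqB x : msq P (xi x) <= fine (Fs setT) by rewrite (msq_field zxi sFs).
by have [_ _] := weighted_energy iF mxi' (sqint_field gxi zxi) msqB.
Qed.

Lemma integrable_comb (K : Type) (s : seq K) (c : K -> R)
    (F : K -> 'rV[R]_n -> R) : (forall i, mu.-integrable setT (EFin \o F i)) ->
  mu.-integrable setT (EFin \o (fun x => \sum_(i <- s) c i * F i x)).
Proof.
move=> iF; elim: s => [|i s IH].
  by under eq_fun do rewrite /= big_nil; exact: integrable0.
have := integrable_add (integrable_scale (c i) (iF i)) IH.
by apply: eq_integrable => // x _; rewrite /= big_cons.
Qed.

(** Linearity of the integral holds at those w for which all the integrands are
    integrable, that is almost surely. *)
Lemma field_integral_comb (K : Type) (s : seq K) (c : K -> R)
    (F : K -> 'rV[R]_n -> R) : (forall i, mu.-integrable setT (EFin \o F i)) ->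
  {ae P, forall w, \int[mu]_x ((\sum_(i <- s) c i * F i x) * xi x w) =
    \sum_(i <- s) c i * \int[mu]_x (F i x * xi x w)}.
Proof.
move=> iF; have iC (s' : seq K) := integrable_comb s' c iF.
elim: s => [|i s IH].
  apply: aeW => w; rewrite big_nil /Rintegral integral0_eq// => x _.
  by rewrite big_nil mul0r.
move: IH (field_integral_ae (iF i)) (field_integral_ae (iC s)).
apply: filterS3 => w IHw iFw iCw; rewrite big_cons -IHw -RintegralZl// -RintegralD//.
  by apply: eq_Rintegral => x _; rewrite big_cons mulrDl mulrA.
exact: (integrable_scale (c i) iFw).
Qed.

Lemma field_comb_gausslike (K : Type) (s : seq K) (c : K -> R)
    (F : K -> 'rV[R]_n -> R) : (forall i, mu.-integrable setT (EFin \o F i)) ->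
  (forall i u, \int[mu]_x (F i x * sin (dotp u x)) = 0) ->
  let S w := \sum_(i <- s) c i * \int[mu]_x (F i x * xi x w) in
  gausslike P S /\ msq P S =
    \int[Fs]_u (\sum_(i <- s) c i * \int[mu]_x (F i x * cos (dotp u x))) ^+ 2.
Proof.
move=> iF sF S; have iC := integrable_comb s c iF.
have mS : measurable_fun setT S.
  apply: measurable_sum => i; apply: measurable_funM => //.
  exact: measurable_field_integral.
have comb (k : 'rV[R]_n -> R) : measurable_fun setT k -> (forall x, `|k x| <= 1) ->
    \int[mu]_x ((\sum_(i <- s) c i * F i x) * k x) =
    \sum_(i <- s) c i * \int[mu]_x (F i x * k x).
  move=> mk k1.
  have ik (G : 'rV[R]_n -> R) : mu.-integrable setT (EFin \o G) ->
      mu.-integrable setT (fun x => (G x * k x)%:E).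
    move=> iG; have mG : measurable_fun setT G.
      by apply/measurable_EFinP; exact: measurable_int iG.
    apply: le_integrable iG => //.
      by apply/measurable_EFinP; exact: measurable_funM.
    by move=> x _ /=; rewrite lee_fin normrM ler_piMr.
  have iCs (s' : seq K) := integrable_comb s' c iF.
  elim: (s) => [|i s' IH].
    rewrite big_nil /Rintegral integral0_eq// => x _.
    by rewrite big_nil mul0r.
  rewrite big_cons -IH -RintegralZl//; last exact: ik.
  rewrite -RintegralD//; last exact: ik.
    by apply: eq_Rintegral => x _; rewrite big_cons mulrDl mulrA.
  exact: (integrable_scale (c i) (ik _ (iF i))).
have mdot u : measurable_fun setT (dotp (n := n) (R := R) u).
  exact: measurable_dotp.
have [gS mE] := gausslike_ae mS (field_integral_comb s c iF)
  (field_integral_gausslike mxi gxi zxi cxi sFs iC).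
split=> //; rewrite mE (field_integral_msq mxi gxi zxi sFs iC).
  apply: eq_Rintegral => u _; rewrite comb// => [|x]; last exact: cos_max.
  exact: (measurableT_comp (@measurable_cos R)).
move=> u; rewrite comb => [||x]; last exact: sin_max.
  by rewrite big1 // => i _; rewrite sF mulr0.
exact: (measurableT_comp (@measurable_sin R)).
Qed.

End field_combinations.

(** * Radial spectra and weights *)
Section radial_spectrum.
Context (R : realType) (n : nat).
Local Notation leb := (@lebesgue_measure R).
Local Notation mu := (lebesgue_rV R n).
Hypothesis n0 : (0 < n)%N.

Definition sphere_area : R := 2 * pi `^ (n%:R / 2) / Gamma (n%:R / 2).

Lemma sphere_area_ge0 : 0 <= sphere_area.
Proof.
by rewrite /sphere_area -unit_ball_volumeE// mulr_ge0//; exact/fine_ge0/measure_ge0.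
Qed.

(** As fine is 0 at both infinities, constants can be moved out of integrals
    that are possibly infinite. *)
Lemma fineZ (c : R) (x : \bar R) : fine (c%:E * x)%E = c * fine x.
Proof.
case: x => [x| |] //=; have [c0|c0|->] := ltgtP c 0.
- by rewrite lt0_muley// mulr0.
- by rewrite gt0_muley// mulr0.
- by rewrite mul0e mul0r.
- by rewrite lt0_muleNy// mulr0.
- by rewrite gt0_muleNy// mulr0.
- by rewrite mul0e mul0r.
Qed.

Lemma spectral_radial d (T : measurableType d) (P : probability T R)
    (xi : 'rV[R]_n -> T -> R) (phi : R -> R) :
  isotropic_spectral_density P xi phi ->
  exists2 Fs : {measure set 'rV[R]_n -> \bar R}, spectral_measure P xi Fs &
    forall psi : R -> R, measurable_fun setT psi -> (forall z, 0 <= psi z) ->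
    \int[Fs]_u psi (enorm u) = sphere_area *
      \int[leb]_(z in `[0, +oo[) (psi z * (z ^+ n.-1 * phi z)).
Proof.
move=> [phi0 iphi [Fs sFs FsE]]; exists Fs => // psi mpsi psi0.
have mw : measurable_fun (`[0, +oo[ : set R) (fun z => z ^+ n.-1 * phi z).
  by apply/measurable_EFinP; have /integrableP[] := iphi.
have w0 (z : R) : 0 <= z -> 0 <= z ^+ n.-1 * phi z.
  by move=> z0; rewrite mulr_ge0 ?exprn_ge0 ?phi0.
rewrite /Rintegral -fineZ; congr fine.
rewrite (@ge0_integral_radial _ _ _ Fs (@enorm R n)
  (fun z => sphere_area * (z ^+ n.-1 * phi z)) _ _ _ _ _ _ (EFin \o psi))//.
- rewrite -ge0_integralZl_EFin ?sphere_area_ge0//.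
  + by apply: eq_integral => z _; rewrite -!EFinM; congr EFin; ring.
  + by move=> z /=; rewrite in_itv/= andbT => z0; rewrite lee_fin mulr_ge0 ?w0.
  + apply/measurable_EFinP; apply: measurable_funM => //; exact: measurable_funTS.
- exact: measurable_enorm.
- by move=> x; exact: sqrtr_ge0.
- exact: measurable_funM.
- by move=> z z0; rewrite mulr_ge0 ?sphere_area_ge0// w0.
- move=> r r0; rewrite FsE// -/sphere_area.
  have ir : leb.-integrable `[0, r] (fun z => (z ^+ n.-1 * phi z)%:E).
    by apply: integrableS iphi => // z /=; rewrite !in_itv/= andbT => /andP[].
  rewrite EFinM /Rintegral fineK; last by apply: integrable_fin_num ir.
  rewrite -integralZl//.
- by move=> r r0; rewrite FsE// ltry.
- exact/measurable_EFinP.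
Qed.

(** In polar coordinates |u| ^ (al - n) and the Jacobian |u| ^ (n - 1) combine to
    |u| ^ (al - 1). *)
Lemma tame_sqint (g : R -> R) (al : R) : tame g -> 0 < al < 1 ->
  let F u := g (enorm u) / enorm u `^ ((n%:R - al) / 2) in
  sqint mu F /\ msq mu F = sphere_area *
    \int[leb]_(v in `[0, +oo[) (g v ^+ 2 * v `^ (al - 1)).
Proof.
move=> tg al01 F; have [al0 al1] := andP al01.
have [mg _ _ _] := tg.
pose psi (z : R) : R := (g z / z `^ ((n%:R - al) / 2)) ^+ 2.
have mpsi1 : measurable_fun setT (fun z : R => g z / z `^ ((n%:R - al) / 2)).
  apply: measurable_funM => //.
  under eq_fun do rewrite -powRN.
  exact: measurable_powR.
have mpsi : measurable_fun setT psi by exact: measurable_funX.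
have n1 : 1 <= n%:R :> R by rewrite ler1n.
have psiE z : 0 <= z -> psi z * z ^+ n.-1 = g z ^+ 2 * z `^ (al - 1).
  rewrite le_eqVlt /psi => /orP[/eqP<-|z0].
    rewrite !powR0 ?invr0 ?mulr0 ?expr0n ?mul0r//; first by rewrite subr_eq0 lt_eqF.
    by rewrite mulf_neq0// gt_eqF// subr_gt0 (lt_le_trans al1).
  rewrite expr_div_n -(powR_mulrn 2 (powR_ge0 _ _)) -powRrM divfK//.
  rewrite -(powR_mulrn _ (ltW z0)) -mulrA; congr (_ * _).
  rewrite mulrC -powRB; last by rewrite (gt_eqF z0) implybT.
  by congr (_ `^ _); rewrite -subn1 natrB//; ring.
have mG : measurable_fun setT (fun v : R => g v ^+ 2 * v `^ (al - 1)).
  by apply: measurable_funM; [exact: measurable_funX | exact: measurable_powR].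
have E : (\int[mu]_u (F u ^+ 2)%:E = sphere_area%:E *
    \int[leb]_(v in `[0%R, +oo[) (g v ^+ 2 * v `^ (al - 1))%:E)%E.
  rewrite -ge0_integralZl_EFin ?sphere_area_ge0//; last 2 first.
  - by move=> v _; rewrite lee_fin mulr_ge0 ?sqr_ge0 ?powR_ge0.
  - by apply/measurable_EFinP; exact: measurable_funTS.
  rewrite (ge0_integral_enorm n0 (psi := EFin \o psi)); last 2 first.
  - exact/measurable_EFinP.
  - by move=> z; rewrite lee_fin sqr_ge0.
  apply: eq_integral => z; rewrite inE/= in_itv/= andbT => z0.
  by rewrite -psiE// -!EFinM; congr EFin; rewrite /sphere_area; ring.
have Ifin : (\int[leb]_(v in `[0%R, +oo[) (g v ^+ 2 * v `^ (al - 1))%:E < +oo)%E.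
  have iG : leb.-integrable `[0, +oo[ (fun v => (g v ^+ 2 * `|v| `^ (al - 1))%:E).
    by apply: integrableS (tame_weight_integrable tg al01).
  rewrite (@eq_integral _ _ _ leb _ (fun v => (g v ^+ 2 * `|v| `^ (al - 1))%:E)).
    exact: integrable_lty iG.
  by move=> v; rewrite inE/= in_itv/= andbT => v0; rewrite ger0_norm.
split; last by rewrite /msq /Rintegral E fineZ.
apply: sqintP; last by rewrite E; apply: lte_mul_pinfty => //;
  rewrite lee_fin sphere_area_ge0.
exact: (measurableT_comp mpsi1 (@measurable_enorm R n)).
Qed.

End radial_spectrum.

Lemma cvg_prodr (R : realType) (I : eqType) (T : Type) (F : set_system T)
    (FF : Filter F) (s : seq I) (P : pred I) (f : I -> T -> R) (l : I -> R) :
  (forall i, i \in s -> P i -> f i x @[x --> F] --> l i) ->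
  \prod_(i <- s | P i) f i x @[x --> F] --> \prod_(i <- s | P i) l i.
Proof.
elim: s => [|i s IH] fl.
  by rewrite big_nil; under eq_fun do rewrite big_nil; exact: cvg_cst.
have fs : \prod_(i <- s | P i) f i x @[x --> F] --> \prod_(i <- s | P i) l i.
  by apply: IH => i' si'; apply: fl; rewrite in_cons si' orbT.
rewrite big_cons; under eq_fun do rewrite big_cons.
by case: ifPn => // Pi; apply: cvgM => //; apply: fl => //; rewrite in_cons eqxx.
Qed.

Section admissible.
Context (R : realType) (n : nat).
Local Notation mu := (lebesgue_rV R n).
Hypothesis n0 : (0 < n)%N.

Definition ray (z : R) : 'rV[R]_n := \row_(i < n) if val i == 0%N then z else 0.

Lemma enorm_ray z : enorm (ray z) = `|z|.
Proof.
rewrite -sqrtr_sqr /enorm; congr Num.sqrt.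
rewrite /dotp (bigD1 (Ordinal n0))//= !mxE /= big1 ?addr0 ?expr2// => i i0.
rewrite !mxE ifN ?mulr0//; exact: contra i0.
Qed.

Lemma measurable_ray : measurable_fun setT ray.
Proof.
apply/measurable_rVP => i; under eq_fun do rewrite mxE.
by case: (val i == 0%N); [exact: measurable_id | exact: measurable_cst].
Qed.

(** The transform of the integrable function f 1 is bounded and measurable;
    restricted to a ray it recovers the profile g on [0, +oo[, and evenness
    gives the rest. *)
Lemma admissible_tame (a : R) (f : R -> 'rV[R]_n -> R) (g : R -> R) : 0 <= a ->
  admissible_weights a f g -> tame g.
Proof.
move=> a0 [fP gP eg Cg].
have [_ _ if1 _] := fP 1 ltr01.
have mf1 : measurable_fun setT (f 1) by apply/measurable_EFinP; exact: measurable_int if1.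
pose J l := \int[mu]_x (cos (dotp l x) * f 1 x).
have gJ s : g s = J (ray (`|s| + a)).
  have -> : g s = g `|s| by case: (ger0P s) => // _; rewrite eg.
  have [+ _] := gP 1 ltr01 (ray (`|s| + a)).
  rewrite expr1n invr1 !mul1r enorm_ray (ger0_norm (addr_ge0 (normr_ge0 s) a0)).
  by rewrite addrK => <-.
split=> //.
  rewrite (_ : g = fun s => J (ray (`|s| + a))); last exact/funext.
  have mJ : measurable_fun setT J.
    apply: (@measurable_Rintegral_param _ _ _ _ _ mu
      (fun z => cos (dotp z.1 z.2) * f 1 z.2)).
    apply: measurable_funM; last exact: (measurableT_comp mf1 measurable_snd).
    apply: (measurableT_comp (@measurable_cos R)).
    by apply: measurable_dotp; [exact: measurable_fst|exact: measurable_snd].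
  apply: (measurableT_comp mJ); apply: (measurableT_comp measurable_ray).
  by apply: measurable_funD => //; exact: normr_measurable.
exists (\int[mu]_x `|f 1 x|) => s; rewrite gJ /J.
have ic : mu.-integrable setT (EFin \o (fun x => cos (dotp (ray (`|s| + a)) x) * f 1 x)).
  apply: le_integrable if1 => //.
    apply/measurable_EFinP; apply: measurable_funM => //.
    apply: (measurableT_comp (@measurable_cos R)); exact: measurable_dotp.
  by move=> x _ /=; rewrite lee_fin normrM ler_piMl// cos_max.
rewrite (le_trans (le_normr_Rintegral _ ic))//.
apply: le_Rintegral => //; first exact: integrable_norm ic.
- exact: integrable_norm if1.
- by move=> x _; rewrite normrM ler_piMl// cos_max.
Qed.

End admissible.

Section local_density.
Context (R : realType) (n k : nat) (phi h : R -> R) (a alpha : nat -> R) (j : nat).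
Hypothesis n0 : (0 < n)%N.
Hypothesis a0 : a 0%N = 0.
Hypothesis ltSa : forall i, (i.+1 < k)%N -> a i < a i.+1.
Hypothesis jk : (0 < j < k)%N.

Lemma singularities_lt i i' : (i < i')%N -> (i' < k)%N -> a i < a i'.
Proof.
elim: i' => // i' IH; rewrite ltnS leq_eqVlt => /orP[/eqP->|ii'] i'k.
  exact: ltSa.
by apply: lt_trans (ltSa i'k); apply: IH => //; exact: ltnW.
Qed.

Lemma singularity_gt0 : 0 < a j.
Proof. by have /andP[j0 ?] := jk; rewrite -a0; exact: singularities_lt. Qed.

Lemma singularities_neq i : (i < k)%N -> i != j -> a i != a j.
Proof.
move=> ik; have /andP[_ jk'] := jk; rewrite neq_ltn => /orP[ij|ji].
  by rewrite lt_eqF// singularities_lt.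
by rewrite gt_eqF// singularities_lt.
Qed.

Let V := a j `^ (1 - alpha 0%N) *
  \prod_(1 <= i < k | i != j) `|a j - a i| `^ (1 - alpha i).

Lemma singularity_weight_gt0 : 0 < V.
Proof.
rewrite mulr_gt0 ?powR_gt0 ?singularity_gt0//.
rewrite big_nat_cond; apply: prodr_gt0 => i /andP[/andP[_ ik] ij].
by rewrite powR_gt0// normr_gt0 subr_eq0 eq_sym singularities_neq.
Qed.

(** The density of the radial spectrum near a j, divided by its singular factor
    |z - a j| ^ (alpha j - 1). *)
Let q (z : R) := h z * (z `^ (n%:R - 1) / z `^ (n%:R - alpha 0%N)) *
  \prod_(1 <= i < k | i != j) (1 / `|z - a i| `^ (1 - alpha i)).

Lemma cvg_regular_part (e : R) : 0 < e ->
  {within [set z | 0 <= z /\ `|z - a j| < e], continuous h} ->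
  q z @[z --> a j] --> h (a j) / V.
Proof.
move=> e0 ch; have aj0 := singularity_gt0.
have hc : h z @[z --> a j] --> h (a j).
  pose U : set R := ball (a j) (Num.min e (a j)).
  have oU : open U by apply: ball_open; rewrite lt_min e0.
  have : {within U, continuous h}.
    apply: continuous_subspaceW ch => z; rewrite /U /ball/= lt_min => /andP[ze za].
    split; last by rewrite distrC.
    by move: za; rewrite ltr_norml => /andP[? ?]; lra.
  rewrite continuous_open_subspace// => /(_ (a j)); apply.
  by rewrite inE; apply: ballxx; rewrite lt_min e0.
have pc (c x : R) : 0 < x -> {for x, continuous (fun z : R => z `^ c)}.
  move=> x0; apply: differentiable_continuous; apply/derivable1_diffP.
  by apply: derivable_powR; rewrite in_itv/= andbT.
have -> : h (a j) / V = q (a j).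
  rewrite /q /V; have -> : \prod_(1 <= i < k | i != j)
      (1 / `|a j - a i| `^ (1 - alpha i)) =
      (\prod_(1 <= i < k | i != j) `|a j - a i| `^ (1 - alpha i))^-1.
    by rewrite -prodfV; apply: eq_bigr => i _; rewrite mul1r.
  rewrite invfM [LHS]mulrA; congr (_ * _); congr (_ * _).
  rewrite -[RHS]powRB ?(gt_eqF aj0) ?implybT// -powRN.
  by congr (_ `^ _); ring.
apply: cvgM.
  apply: cvgM => //; apply: cvgM; first exact: pc.
  apply: cvgV; last exact: pc.
  by rewrite gt_eqF// powR_gt0.
apply: cvg_prodr => i; rewrite mem_index_iota => /andP[_ ik] ij; rewrite !mul1r.
have ai : 0 < `|a j - a i| by rewrite normr_gt0 subr_eq0 eq_sym singularities_neq.
under eq_fun do rewrite mul1r.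
apply: cvgV; first by rewrite gt_eqF// powR_gt0.
have dist : `|z - a i| @[z --> a j] --> `|a j - a i|.
  by apply: cvg_norm; apply: cvgB; [exact: cvg_id | exact: cvg_cst].
exact: (cvg_comp _ _ dist (pc _ _ ai)).
Qed.

Hypothesis hC : exists2 e : R, 0 < e &
  {within [set z | 0 <= z /\ `|z - a j| < e], continuous h}.
Hypothesis phiE : forall z : R, 0 <= z -> (forall i, (i < k)%N -> z != a i) ->
  phi z = h z / z `^ (n%:R - alpha 0%N) *
    \prod_(1 <= i < k) (1 / `|z - a i| `^ (1 - alpha i)).

(** The singularities are distinct, so in a small ball around a j every factor
    of the density except |z - a j| ^ (alpha j - 1) is continuous. *)
Lemma local_density : exists (de K : R) (q : R -> R),
  [/\ 0 < de <= a j,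
    forall z, 0 < `|z - a j| < de ->
      z ^+ n.-1 * phi z = q z * `|z - a j| `^ (alpha j - 1),
    forall z, `|z - a j| < de -> `|q z| <= K
  & q z @[z --> a j] --> h (a j) / V].
Proof.
have aj0 := singularity_gt0; have [e e0 ch] := hC.
have qc := cvg_regular_part e0 ch.
have /andP[j0 jk'] := jk.
have bnd : \forall z \near a j, `|q z| < `|h (a j) / V| + 1.
  by move/cvgr_norm_lt: qc => /(_ (`|h (a j) / V| + 1)); apply; rewrite ltrDl.
have sep : \forall z \near a j, forall i : 'I_k, val i != j -> z != a i.
  suff sep1 (i : 'I_k) : \forall z \near a j, val i != j -> z != a i.
    exact: filter_forall sep1.
  have [->|ij] := eqVneq (val i) j; apply/nbhs_ballP.
    by exists 1 => //= z _.
  exists `|a j - a i|; first by rewrite /= normr_gt0 subr_eq0 eq_sym singularities_neq.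
  move=> z; rewrite /ball/= => za _; apply/eqP => zE; move: za.
  by rewrite zE ltxx.
have [e1 e10 he1] : exists2 e1 : R, 0 < e1 & forall z, `|a j - z| < e1 ->
    `|q z| < `|h (a j) / V| + 1 /\ forall i : 'I_k, val i != j -> z != a i.
  have : nbhs (a j) [set z | `|q z| < `|h (a j) / V| + 1 /\
      forall i : 'I_k, val i != j -> z != a i] by exact: filterI bnd sep.
  by move/nbhs_ballP => [e1 /= e10 h1]; exists e1.
exists (Num.min e1 (a j)), (`|h (a j) / V| + 1), q; split=> //.
- by rewrite lt_min e10 aj0 ge_min lexx orbT.
- move=> z; rewrite lt_min => /and3P[zj ze za].
  have z0 : 0 < z by move: za; rewrite ltr_norml => /andP[? ?]; lra.
  have [_ zi] := he1 z ltac:(by rewrite distrC).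
  rewrite phiE ?ltW//; last first.
    move=> i ik; have [->|ij] := eqVneq i j; last exact: (zi (Ordinal ik)).
    by rewrite -subr_eq0 -normr_gt0.
  rewrite (bigD1_seq j)/= ?iota_uniq ?mem_index_iota ?j0//.
  rewrite /q -(powR_mulrn _ (ltW z0)) -subn1 natrB// mul1r -!powRN !opprB.
  ring.
- move=> z; rewrite lt_min => /andP[ze _]; apply: ltW.
  by apply: (he1 z _).1; rewrite distrC.
Qed.

End local_density.

(** * Convergence of the finite-dimensional distributions *)

Theorem theorem4p1 (R : realType) (n : nat)
  (d : measure_display) (T : measurableType d) (P : probability T R)
  (xi : 'rV[R]_n -> T -> R) (phi h : R -> R)
  (k : nat) (a alpha : nat -> R)
  (j : nat) (f : R -> 'rV[R]_n -> R) (g : R -> R)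
  (d' : measure_display) (T' : measurableType d') (P' : probability T' R)
  (Z : set 'rV[R]_n -> T' -> R) :
  (0 < n)%N ->
  measurable_field xi ->
  gaussian_family P setT xi ->
  zero_mean P xi ->
  mean_square_continuous P xi ->
  homogeneous P xi ->
  isotropic P xi ->
  isotropic_spectral_density P xi phi ->
  (0 < k)%N ->
  a 0%N = 0 ->
  (forall i, (i.+1 < k)%N -> a i < a i.+1) ->
  0 < alpha 0%N < n%:R ->
  (forall i, (0 < i < k)%N -> 0 < alpha i < 1) ->
  (forall l : 'rV[R]_n, (forall i, (i < k)%N -> enorm l != a i) ->
    phi (enorm l) = h (enorm l) / enorm l `^ (n%:R - alpha 0%N) *
      \prod_(1 <= i < k) (1 / `|enorm l - a i| `^ (1 - alpha i))) ->
  (lebesgue_rV R n).-integrable setT (fun l => (phi (enorm l))%:E) ->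
  (forall z, 0 <= z -> 0 <= h z) ->
  (exists M : R, forall z, 0 <= z -> h z <= M) ->
  (forall i, (i < k)%N -> exists2 e : R, 0 < e &
    {within [set z | 0 <= z /\ `|z - a i| < e], continuous h}) ->
  (forall i, (i < k)%N -> h (a i) != 0) ->
  (0 < j < k)%N ->
  admissible_weights (a j) f g ->
  white_noise P' Z ->
  let V := a j `^ (1 - alpha 0%N) *
    \prod_(1 <= i < k | i != j) `|a j - a i| `^ (1 - alpha i) in
  let X (r t : R) (w : T) : R :=
    if t == 0 then 0 else
      Num.sqrt V / (Num.sqrt (2 * h (a j)) * r `^ (n%:R - alpha j / 2)) *
      \int[lebesgue_rV R n]_x (f (r * t) x * xi x w) in
  let Y (t : R) (w : T') : R :=
    if t == 0 then 0 else
      t ^+ n * wiener_integral P' Z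
        (fun u => g (enorm u * t) / enorm u `^ ((n%:R - alpha j) / 2)) w in
  fdd_converge `[0, 1] P X P' Y.
Proof.
move=> n0 mxi gxi zxi cxi _ _ sd _ a0 ltSa _ ali phiE _
  h0 _ hC hne jk adm wn V X Y.
have /andP[j0 jk'] := jk.
have aj0 : 0 < a j := singularity_gt0 a0 ltSa jk.
have V0 : 0 < V := singularity_weight_gt0 alpha a0 ltSa jk.
have alj := ali j jk; have /andP[alj0 alj1] := alj.
have haj : 0 < h (a j) by rewrite lt0r hne// h0// ltW.
have tg : tame g := admissible_tame n0 (ltW aj0) adm.
have [fP gP _ _] := adm.
have phiE' z : 0 <= z -> (forall i, (i < k)%N -> z != a i) ->
    phi z = h z / z `^ (n%:R - alpha 0%N) *
      \prod_(1 <= i < k) (1 / `|z - a i| `^ (1 - alpha i)).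
  by move=> z0; have := phiE (ray n z); rewrite enorm_ray// ger0_norm.
have [de [K [q [de_a wq qK qL]]]] :=
  local_density n0 a0 ltSa jk (hC j jk') phiE'.
have {}qL : q z @[z --> a j] --> h (a j) / V := qL.
(* From here on V enters through its sign and the limit of q at a j. *)
clearbody V.
have [phi0 iw _] := sd; have [Fs sFs Fs_radial] := spectral_radial n0 sd.
pose mu := lebesgue_rV R n; pose leb := @lebesgue_measure R.
pose prof (t s : R) : R := if t == 0 then 0 else t ^+ n * g (t * s).
pose F (r t : R) (x : 'rV[R]_n) : R := if t == 0 then 0 else f (r * t) x.
pose A r := Num.sqrt V / (Num.sqrt (2 * h (a j)) * r `^ (n%:R - alpha j / 2)).
have tame_prof c t : 0 <= t -> tame (fun s => c * prof t s).
  rewrite /prof le_eqVlt => /orP[/eqP<-|t0].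
    by under eq_fun do rewrite eqxx mulr0; exact: tame0.
  rewrite gt_eqF//; under eq_fun do rewrite mulrA.
  exact: tame_scale.
have XE r t w : X r t w = A r * \int[mu]_x (F r t x * xi x w).
  rewrite /X /F; case: eqP => // _.
  rewrite /Rintegral integral0_eq ?mulr0// => x _; by rewrite mul0r.
have iF r t : 0 < r -> 0 <= t -> mu.-integrable setT (EFin \o F r t).
  move=> r0; rewrite /F le_eqVlt => /orP[/eqP<-|t0].
    by rewrite eqxx; exact: integrable0.
  by rewrite gt_eqF//; have [_ _ iF _] := fP _ (mulr_gt0 r0 t0).
have Fsin r t u : 0 < r -> 0 <= t -> \int[mu]_x (F r t x * sin (dotp u x)) = 0.
  move=> r0; rewrite /F le_eqVlt => /orP[/eqP<-|t0].
    by rewrite eqxx /Rintegral integral0_eq// => x _; rewrite mul0r.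
  rewrite gt_eqF//; have [_ /eqP] := gP _ (mulr_gt0 r0 t0) u.
  rewrite mulf_eq0 gt_eqF ?invr_gt0 ?exprn_gt0 ?mulr_gt0//= => /eqP E.
  by rewrite -[RHS]E; apply: eq_Rintegral => x _; rewrite mulrC.
have Fcos r t u : 0 < r -> 0 <= t -> \int[mu]_x (F r t x * cos (dotp u x)) =
    r ^+ n * prof t (r * (enorm u - a j)).
  move=> r0; rewrite /F /prof le_eqVlt => /orP[/eqP<-|t0].
    by rewrite eqxx mulr0 /Rintegral integral0_eq// => x _; rewrite mul0r.
  rewrite gt_eqF//; have [E _] := gP _ (mulr_gt0 r0 t0) u.
  rewrite mulrA -exprMn [t * (r * _)]mulrA [t * r]mulrC -E mulrA.
  rewrite mulfV ?mul1r; last by rewrite gt_eqF// exprn_gt0// mulr_gt0.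
  by apply: eq_Rintegral => x _; rewrite mulrC.
(* This is where the normalisation r ^ (n - alpha j / 2) enters: the factor
   r ^ n of the transform of f leaves r ^ (alpha j) in the variance. *)
have A2 r : 0 < r -> (A r * r ^+ n) ^+ 2 = V / (2 * h (a j)) * r `^ alpha j.
  move=> r0; rewrite /A exprMn expr_div_n exprMn !sqr_sqrtr ?mulr_ge0 ?ltW//.
  rewrite -(powR_mulrn 2 (powR_ge0 _ _)) -powRrM -exprM -(powR_mulrn _ (ltW r0)).
  rewrite (_ : (n * 2)%:R = (n%:R - alpha j / 2) * 2%:R + alpha j :> R); last first.
    by rewrite natrM; field.
  rewrite powRD; last by rewrite (gt_eqF r0) implybT.
  by field; rewrite !(gt_eqF haj) gt_eqF ?powR_gt0.
have X_comb m (t c : 'I_m -> R) r : 0 < r -> (forall i, 0 <= t i) ->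
    gausslike P (fun w => \sum_i c i * X r (t i) w) /\
    msq P (fun w => \sum_i c i * X r (t i) w) =
      V / (2 * h (a j)) * (sphere_area R n * (r `^ alpha j *
        \int[leb]_(z in `[0, +oo[)
          ((\sum_i c i * prof (t i) (r * (z - a j))) ^+ 2 * (z ^+ n.-1 * phi z)))).
  move=> r0 t0; have [gX mE] := field_comb_gausslike mxi gxi zxi cxi sFs
    (index_enum 'I_m) (fun i => c i * A r) (fun i => iF r (t i) r0 (t0 i))
    (fun i u => Fsin r (t i) u r0 (t0 i)).
  have E : (fun w => \sum_i c i * X r (t i) w) =
      (fun w => \sum_i c i * A r * \int[mu]_x (F r (t i) x * xi x w)).
    by apply/funext => w; apply: eq_bigr => i _; rewrite XE mulrA.
  rewrite E; split=> //; rewrite mE.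
  have tc : tame (fun s => \sum_i c i * prof (t i) s).
    by apply: tame_sum => i; exact: tame_prof.
  have [mc _ _ _] := tc.
  rewrite (@eq_Rintegral _ _ _ Fs _ (fun u => V / (2 * h (a j)) * r `^ alpha j *
    (\sum_i c i * prof (t i) (r * (enorm u - a j))) ^+ 2)); last first.
    move=> u _; rewrite -A2// -exprMn mulr_sumr; congr (_ ^+ 2).
    by apply: eq_bigr => i _; rewrite Fcos//; ring.
  pose psi (z : R) := V / (2 * h (a j)) * r `^ alpha j *
    (\sum_i c i * prof (t i) (r * (z - a j))) ^+ 2.
  rewrite (Fs_radial psi); last 2 first.
  - apply: measurable_funM => //; apply: measurable_funX.
    apply: (measurableT_comp mc); apply: measurable_funM => //.
    exact: measurable_funB.
  - move=> z; apply: mulr_ge0; last exact: sqr_ge0.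
    by rewrite mulr_ge0 ?powR_ge0// divr_ge0 ?mulr_ge0 ?ltW.
  have -> : \int[leb]_(z in `[0, +oo[) (psi z * (z ^+ n.-1 * phi z)) =
      V / (2 * h (a j)) * r `^ alpha j * \int[leb]_(z in `[0, +oo[)
        ((\sum_i c i * prof (t i) (r * (z - a j))) ^+ 2 * (z ^+ n.-1 * phi z)).
    rewrite /Rintegral -fineZ; congr fine.
    rewrite -ge0_integralZl_EFin//.
    + by apply: eq_integral => z _; rewrite -[RHS]EFinM; congr EFin; rewrite /psi; ring.
    + move=> z /=; rewrite in_itv/= andbT => z0; rewrite lee_fin.
      apply: mulr_ge0; first exact: sqr_ge0.
      by rewrite mulr_ge0 ?exprn_ge0 ?phi0.
    + apply/measurable_EFinP; apply: measurable_funM.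
        apply: measurable_funTS; apply: measurable_funX.
        apply: (measurableT_comp mc); apply: measurable_funM => //.
        exact: measurable_funB.
      by apply/measurable_EFinP; have /integrableP[] := iw.
    + by rewrite mulr_ge0 ?powR_ge0// divr_ge0 ?mulr_ge0 ?ltW.
  by ring.
pose fY t (u : 'rV[R]_n) := prof t (enorm u) / enorm u `^ ((n%:R - alpha j) / 2).
have wY t : 0 <= t -> is_wiener_integral P' Z (fY t) (Y t).
  rewrite /fY /prof /Y le_eqVlt => /orP[/eqP<-|t0].
    rewrite eqxx (_ : (fun _ => 0 / _) = cst 0); first exact: is_wiener_integral0.
    by apply/funext => u; rewrite mul0r.
  rewrite gt_eqF//.
  pose I := wiener_integral P' Z
    (fun u => g (enorm u * t) / enorm u `^ ((n%:R - alpha j) / 2)).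
  have tgt : tame (fun s => g (s * t)).
    have := tame_scale 1 t0 tg.
    by under eq_fun do rewrite mul1r mulrC.
  have [sf _] := tame_sqint n0 tgt alj.
  have := is_wiener_integralD wn (t ^+ n) (is_wiener_integral_exists wn sf)
    (is_wiener_integral0 wn).
  rewrite (_ : (fun u => t ^+ n * _ + _) =
    fun u : 'rV[R]_n =>
      t ^+ n * g (t * enorm u) / enorm u `^ ((n%:R - alpha j) / 2)).
    by under [X in is_wiener_integral _ _ _ X -> _]eq_fun do rewrite addr0.
  by apply/funext => u; rewrite addr0 mulrA [t * _]mulrC.
have Y_comb m (t c : 'I_m -> R) : (forall i, 0 <= t i) ->
    gausslike P' (fun w => \sum_i c i * Y (t i) w) /\
    msq P' (fun w => \sum_i c i * Y (t i) w) = sphere_area R n *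
      \int[leb]_(v in `[0, +oo[)
        ((\sum_i c i * prof (t i) v) ^+ 2 * v `^ (alpha j - 1)).
  move=> t0; have := is_wiener_integral_sum wn (index_enum 'I_m) c
    (fun i => wY (t i) (t0 i)).
  move=> /(wiener_gausslike wn)[gY mE]; split=> //; rewrite mE.
  have tc : tame (fun s => \sum_i c i * prof (t i) s).
    by apply: tame_sum => i; exact: tame_prof.
  have [_ <-] := tame_sqint n0 tc alj; congr msq.
  by apply/funext => u; rewrite mulr_suml; apply: eq_bigr => i _; rewrite mulrA.
have mX r t : 0 < r -> 0 <= t -> measurable_fun setT (X r t).
  move=> r0 t0; rewrite (_ : X r t = fun w => A r * \int[mu]_x (F r t x * xi x w)).
    apply: measurable_funM => //.
    by apply: (measurable_field_integral mxi gxi zxi cxi sFs); exact: iF.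
  by apply/funext => w; rewrite XE.
have mY t : 0 <= t -> measurable_fun setT (Y t) by move=> /wY[].
have D0 (t : R) : `[0, 1]%classic t -> 0 <= t by rewrite /= in_itv/= => /andP[].
split.
- by move=> r t r0 /D0; exact: mX.
- by move=> t /D0; exact: mY.
move=> m t Dt G cG [M GM]; have t0 i : 0 <= t i := D0 _ (Dt i).
have mG := measurable_continuous_rV cG.
have expE dU (U : measurableType dU) (Q : probability U R) (W : 'I_m -> U -> R) :
    (forall i, measurable_fun setT (W i)) ->
    expectation Q (fun w => G (\row_i W i w)) = (\int[Q]_w G (\row_i W i w))%:E.
  move=> mW; rewrite unlock /Rintegral fineK//; apply: integrable_fin_num => //.
  apply: integrable_bounded (fun w => GM _) => //.
  apply: (measurableT_comp mG); apply/measurable_rVP => i.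
  by under eq_fun do rewrite mxE; exact: mW.
rewrite expE => [|i]; last exact: mY.
(* X is measurable for positive parameters only; the maximum with 1 changes
   nothing near +oo. *)
pose E r := \int[P]_w G (\row_i X (Num.max r 1) (t i) w).
have max0 r : 0 < Num.max r 1 :> R by rewrite lt_max ltr01 orbT.
have E_cvg : E r @[r --> +oo] --> \int[P']_w G (\row_i Y (t i) w).
  apply/cvg_pinftyP => u uy.
  have ry : Num.max (u i) 1 @[i --> \oo] --> +oo.
    apply/cvgryPge => B; move/cvgryPge: uy => /(_ B).
    by apply: filterS => i Bi; rewrite le_max Bi.
  apply: (gausslike_weak_cvg (X := fun i l => X (Num.max (u i) 1) (t l))
    (Y := fun l => Y (t l)) _ _ _ cG GM).
  - by move=> i c; have [] := X_comb _ t c _ (max0 (u i)) t0.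
  - by move=> c; have [] := Y_comb _ t c t0.
  move=> c; have [_ ->] := Y_comb _ t c t0.
  have tc : tame (fun s => \sum_i c i * prof (t i) s).
    by apply: tame_sum => i; exact: tame_prof.
  under eq_fun => i do rewrite (X_comb _ t c _ (max0 (u i)) t0).2.
  have w0 z : 0 <= z -> 0 <= z ^+ n.-1 * phi z.
    by move=> z0; rewrite mulr_ge0 ?exprn_ge0 ?phi0.
  have loc := tame_localize tc alj de_a iw w0 wq qK qL (fun i => max0 (u i)) ry.
  set I := \int[_]_(v in _) _.
  rewrite (_ : sphere_area R n * I = V / (2 * h (a j)) * (sphere_area R n *
    (h (a j) / V * \int[leb]_v
      ((\sum_i c i * prof (t i) v) ^+ 2 * `|v| `^ (alpha j - 1))))); last first.
    by rewrite (tame_weight_even tc alj) -/I; field; rewrite !gt_eqF.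
  apply: cvgM; first exact: cvg_cst.
  by apply: cvgM; first exact: cvg_cst.
have EE_cvg : (E r)%:E @[r --> +oo] --> (\int[P']_w G (\row_i Y (t i) w))%:E.
  by apply: cvg_EFin => //; exact: nearW.
apply: cvg_trans EE_cvg; apply: near_eq_cvg; near=> r.
have r1 : 1 < r by near: r; exact: nbhs_pinfty_gt.
rewrite /E max_l ?(ltW r1)// expE// => i; exact: mX (lt_trans ltr01 r1) (t0 i).
Unshelve. all: by end_near. Qed.
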